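(* Suppose Assumptions 1 and 2 and the error bounds (E1), (E2) of the context hold, that $F_n^h(\theta)$ is continuously differentiable in a neighbourhood $B'$ of $\bar\theta$ in $\Theta$, and that $\lim_{n\to\infty}h_n=0$. Then an estimator $\hat\theta_n^h=(\hat\theta_{n,1}',(\hat\theta_{n,2}^h)')'$ (a solution of $F_n^h(\theta)=0$ with $h=h_n$) exists with probability tending to 1 as $n\to\infty$, and $$\hat\theta_{n,2}^h\overset{p}{\to}\bar\theta_2$$ on the set where they exist. If Assumption 3 of the context also holds, the estimator $\hat\theta_n^h$ is the unique $F_n^h$-estimator on any bounded subset of $\Theta$ containing $\bar\theta$ with probability tending to 1 as $n\to\infty$. Moreover, for $n$ large enough, $\|\hat\theta_{n,2}^h-\hat\theta_{n,2}\|=O(h_n^p)$ almost surely on the set where they exist, where $\hat\theta_n=(\hat\theta_{n,1}',\hat\theta_{n,2}')'$ is the consistent solution of the exact estimating equation $F_n(\theta)=0$.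
   Context: Notation: $'$ is transpose; $(\partial_\theta F)_{i,j}=\partial_{\theta_j}F_i$; $\|\cdot\|$ is the Euclidean norm. Model. $X$ is a diffusion on an interval with endpoints $-\infty\le l<r\le\infty$, with drift $\mu$, diffusion coefficient $\sigma$ and generator $\mathcal Gf=\mu f'+\frac12\sigma^2f''$ on $L^2(q)$. Assumption 1: (1) $X$ is ergodic with stationary density $q(x)=m(x)/\int_l^rm(y)dy$, $m(x)=\sigma^{-2}(x)\exp[\int^x2\mu(y)/\sigma^2(y)dy]$; (2) the spectrum of $\mathcal G$ is purely discrete; (3) $\mu,\sigma$ are twice continuously differentiable and $\sigma>0$ on any $[a,b]$ contained in the state space. Eigenvalues: $0=\lambda_0>\lambda_1>\cdots$; eigenfunctions $\varphi_0\equiv1,\varphi_1,\dots$ form an orthonormal basis of $L^2(q)$. $T$ is an independent, not identically zero Lévy subordinator with Laplace exponent $\phi$, $E[e^{-\lambda T_t}]=e^{-\phi(\lambda)t}$. $Y_t=X_{T_t}$ has transition density $p^\phi(t,x,y)$ and stationary density $q$, is started from $q$, and is observed at $t_i=i\Delta$, $i=0,\dots,n$, with $\Delta>0$ fixed. The diffusion depends on $\theta_1\in\mathbb R^{p_1}$, the subordinator on $\theta_2\in\mathbb R^{p_2}$; $\theta=(\theta_1',\theta_2')'$ ranges in an open set $\Theta\subset\mathbb R^{p_1+p_2}$, with true value $\bar\theta=(\bar\theta_1',\bar\theta_2')'$. $\bar E$ is expectation under $\bar\theta$, and $\bar Q(x,y)=q(x;\bar\theta)p^\phi(\Delta,x,y;\bar\theta)$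 is the joint density of $(Y_{t_0},Y_{t_1})$. Estimating functions. $F_{n,1}(\theta_1)=\sum_{i=1}^nf_1(Y_{t_{i-1}},Y_{t_i};\theta_1)$ with $f_1$ $\mathbb R^{p_1}$-valued, whose components are chosen from moment conditions (expectation zero under the true parameter) of the types $\mu(Y_t)g'(Y_t)+\frac12\sigma^2(Y_t)g''(Y_t)$, $g$ in the domain of $\mathcal G$, or $\mathcal A\Psi(Y_{t+\Delta},Y_t)-\mathcal A'\Psi(Y_{t+\Delta},Y_t)$, where $\mathcal A\Psi(x,y),\mathcal A'\Psi(x,y)$ denote $\mathcal G$ applied to $\Psi$ in the first, resp. second, variable ($\Psi(x,\cdot),\Psi(\cdot,y)$ bounded, continuous, in the domain of $\mathcal G$; $\mathcal A\Psi(\cdot,y),\mathcal A'\Psi(x,\cdot)$ bounded continuous). $F_{n,2}(\theta)=\sum_{i=1}^nf_2(Y_{t_{i-1}},Y_{t_i};\theta)$ with $f_2(x,y;\theta)=W'(x;\theta)V(x,y;\theta)$, where $W$ is an arbitrary $M\times p_2$ weighting matrix and $V$ is the $M\times1$ vector with entries $V_m(x,y;\theta)=\varphi_m(y;\theta)-e^{-\phi(-\lambda_m;\theta)\Delta}\varphi_m(x;\theta)$, $1\le m\le M$. Put $f=(f_1',f_2')'$, $F_n=(F_{n,1}',F_{n,2}')'$ and $J_n=\partial_\theta F_n$. Assumption 2. $\bar\theta\in\Theta$ and there is a neighbourhood $B$ of $\bar\theta$ in $\Theta$ such that: (a) $f_1(x,y;\theta_1)$ is continuously differentiable w.r.t.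 $\theta_1$ and $f_2(x,y;\theta_1,\theta_2)$ is continuously differentiable w.r.t. $\theta_1,\theta_2$ on $B$ for all $x,y$; (b) each element of the first partial derivatives of $f_1$ w.r.t. $\theta_1$ and of $f_2$ w.r.t. $\theta$ is dominated for all $\theta\in B$ by a $\bar Q$-integrable function; (c) each element of $f_1(x,y;\theta_1)$ and $f_2(x,y;\theta)$ is $\bar Q$-integrable for all $\theta\in B\setminus\{\bar\theta\}$ and square-integrable w.r.t. $\bar Q$ for $\theta=\bar\theta$; (d) $A_1(\bar\theta_1)=\bar E[\partial_{\theta_1}f_1(Y_{t_0},Y_{t_1};\bar\theta_1)]$ and $A_2(\bar\theta)=\bar E[\partial_{\theta_2}f_2(Y_{t_0},Y_{t_1};\bar\theta)]$ are non-singular. Assumption 3. (a) $\bar E[f(Y_{t_0},Y_{t_1};\theta)]\neq0$ for all $\theta\neq\bar\theta$; (b) each element of $f_1$ and $f_2$ is locally dominated integrable w.r.t. $\bar Q$, where $g(x,y;\theta)$ is locally dominated integrable if for each $\theta\in\Theta$ there exist a neighbourhood $U(\theta)$ and a non-negative $\bar Q$-integrable $h_\theta(x,y)$ with $|g(x,y;\vartheta)|<h_\theta(x,y)$ for all $(x,y,\vartheta)\in(l,r)\times(l,r)\times U(\theta)$. Numerical approximation. $F_{n,2}^h(\theta)$ is an approximation of $F_{n,2}(\theta)$ (computed numerically from the same data on a grid with step size $h$), $F_n^h(\theta)=(F_{n,1}(\theta_1)',F_{n,2}^h(\theta)')'$, $J_n^h=\partial_\theta F_n^h$, and the step size $h=h_n>0$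 may depend on $n$. The error bounds are: for some $p,q>0$ and functions $C(\theta)$, $C_{ij}(\theta)$ continuous in $\theta$, (E1) $\|F_{n,2}^h(\theta)-F_{n,2}(\theta)\|\le C(\theta)\,n\,h^p$ almost surely; (E2) $|J_n^h(\theta)_{i,j}-J_n(\theta)_{i,j}|\le C_{ij}(\theta)\,n\,h^q$ almost surely, for $p_1<i\le p_1+p_2$, $1\le j\le p_1+p_2$. An $F_n$-estimator (resp. $F_n^h$-estimator) is a solution of $F_n(\theta)=0$ (resp. $F_n^h(\theta)=0$). Since the first block $F_{n,1}$ is not approximated, both estimators share the same first component $\hat\theta_{n,1}$, solving $F_{n,1}(\theta_1)=0$.
   Formalization: The uniqueness claim assumes in addition that f(x,y;θ) is continuous in θ on all of Θ and that the bounded subset has closure contained in Θ; the estimator is claimed to lie in the subset only when that subset is a neighbourhood of the true value. *)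

(* Defs.v *)
From HB Require Import structures.
From mathcomp Require Import all_boot all_order all_algebra.
From mathcomp Require Import all_classical all_reals all_analysis.

Set Implicit Arguments.
Unset Strict Implicit.
Unset Printing Implicit Defensive.

Import Order.TTheory GRing.Theory Num.Theory.
Import numFieldNormedType.Exports.

Local Open Scope classical_set_scope.
Local Open Scope ring_scope.

Definition enorm (R : realType) (n : nat) (v : 'rV[R]_n) : R :=
  Num.sqrt (\sum_j v 0 j ^+ 2).

(* The library's ['J F t] acts on row vectors and has entry (j, i) equal to the
   derivative of F_i along the j-th coordinate: it is the transpose of the
   matrix of partial derivatives used here. *)
Definition pderiv (R : realType) (m n : nat) (F : 'rV[R]_n -> 'rV[R]_m)
  (t : 'rV[R]_n) : 'M[R]_(m, n) := ('J F t)^T.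

(* To be used on open sets U only. *)
Definition C1_on (R : realType) (m n : nat) (U : set 'rV[R]_n)
    (F : 'rV[R]_n -> 'rV[R]_m) : Prop :=
  forall t, U t -> differentiable F t /\ {for t, continuous (pderiv F)}.

Definition C2_on (R : realType) (U : set R) (g : R -> R) : Prop :=
  forall x, U x -> [/\ derivable g x 1, derivable (g^`())%classic x 1
                     & {for x, continuous (g^`(2))%classic}].

Record diffusion (R : realType) := Diffusion {
  drift : R -> R;
  dcoef : R -> R;
  sdens : R -> R;                (* stationary density *)
  kern : R -> R.-pker R ~> R;    (* transition function, indexed by time *)
  eigval : nat -> R;
  eigfun : nat -> R -> R }.

Section Diffusion.
Variables (R : realType) (l r : \bar R) (S : set R).
Local Notation leb := (@lebesgue_measure R).

Definition oitv : set R := [set x | (l < x%:E)%E && (x%:E < r)%E].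

Definition state_space : Prop :=
  [/\ (l < r)%E, oitv `<=` S
    & forall x, S x -> (l <= x%:E)%E /\ (x%:E <= r)%E].

Variable D : diffusion R.
Local Notation mu := (drift D).
Local Notation sigma := (dcoef D).
Local Notation q := (sdens D).

Definition diffop (g : R -> R) (x : R) : R :=
  mu x * (g^`())%classic x + sigma x ^+ 2 / 2 * (g^`(2))%classic x.

Definition L2norm2 (g : R -> R) : \bar R :=
  (\int[leb]_(x in oitv) (g x ^+ 2 * q x)%:E)%E.

Definition inL2 (g : R -> R) : Prop :=
  measurable_fun oitv g /\ (L2norm2 g < +oo)%E.

Definition L2dot (g u : R -> R) : R :=
  \int[leb]_(x in oitv) (g x * u x * q x).

Definition semigroup (t : R) (g : R -> R) (x : R) : R :=
  \int[kern D t x]_(y in oitv) g y.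

(* [L2gen g u]: g is in the domain of the generator on L^2(q) and G g = u. *)
Definition L2gen (g u : R -> R) : Prop :=
  [/\ inL2 g, inL2 u
    & L2norm2 (fun x => (semigroup t g x - g x) / t - u x)
        @[t --> 0^'+] --> 0%E].

Definition in_dom (g : R -> R) : Prop := exists u, L2gen g u.

Definition resolvent_pt (z : R) : Prop :=
  exists c : R, forall v, inL2 v ->
    (exists g, L2gen g (fun x => z * g x - v x)) /\
    (forall g, L2gen g (fun x => z * g x - v x) ->
       (L2norm2 g <= c%:E * L2norm2 v)%E).

(* The generator is self-adjoint, so that its spectrum is real: only real
   spectral parameters are considered. *)
Definition purely_discrete_spectrum : Prop :=
  forall z : R, ~ resolvent_pt z ->
  [/\ exists2 e : R, 0 < e & forall w, 0 < `|w - z| < e -> resolvent_pt w,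
      exists2 g, L2gen g (fun x => z * g x) & L2norm2 g != 0%E
    & exists s : seq (R -> R), forall g, L2gen g (fun x => z * g x) ->
        exists c : nat -> R,
        {ae leb, forall x, oitv x ->
           g x = \sum_(i < size s) c i * nth (cst 0) s i x}].

(* q = m / \int m, where m is the speed density; G is an antiderivative of
   2 mu / sigma^2, and q does not depend on the choice of G. *)
Definition speed_normalized : Prop :=
  exists G : R -> R,
  let m x := (sigma x ^+ 2)^-1 * expR (G x) in
  [/\ forall x, oitv x -> is_derive x 1 G (2 * mu x / sigma x ^+ 2),
      leb.-integrable oitv (EFin \o m)
    & forall x, oitv x -> q x = m x / \int[leb]_(y in oitv) m y].

Definition transition_function : Prop :=
  [/\ forall t x, 0 <= t -> S x -> kern D t x S = 1%E,
      forall x A, S x -> measurable A -> kern D 0 x A = \d_x A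
    & forall s t x A, 0 <= s -> 0 <= t -> S x -> measurable A ->
        kern D (s + t) x A = (\int[kern D s x]_(y in S) kern D t y A)%E].

Definition stationary : Prop :=
  forall t A, 0 <= t -> measurable A ->
    (\int[leb]_(x in oitv) (kern D t x A * (q x)%:E) =
     \int[leb]_(x in oitv `&` A) (q x)%:E)%E.

Definition ergodic : Prop :=
  forall A, measurable A ->
    (forall t, 0 <= t ->
       {ae leb, forall x, oitv x -> kern D t x A = (\1_A x)%:E}) ->
    (\int[leb]_(x in oitv `&` A) (q x)%:E = 0)%E \/
    (\int[leb]_(x in oitv `&` A) (q x)%:E = 1)%E.

(* Twice continuously differentiable on a compact interval: restriction of a
   twice continuously differentiable function on the line. *)
Definition smooth_coefficients : Prop :=
  forall a b : R, a < b -> `[a, b] `<=` S ->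
  [/\ exists2 g, C2_on setT g & {in `[a, b], g =1 mu},
      exists2 g, C2_on setT g & {in `[a, b], g =1 sigma}
    & forall x, `[a, b]%classic x -> 0 < sigma x].

Definition generator_is_diffop : Prop :=
  (forall g, C2_on oitv g ->
     (exists a b : R, [/\ oitv a, oitv b & forall x, ~ (a <= x <= b) -> g x = 0]) ->
     L2gen g (diffop g)) /\
  (forall g u, L2gen g u -> C2_on oitv g ->
     {ae leb, forall x, oitv x -> u x = diffop g x}).

Definition eigensystem : Prop :=
  [/\ eigval D 0 = 0, forall m, eigval D m.+1 < eigval D m,
      forall x, oitv x -> eigfun D 0 x = 1,
      forall m, [/\ C2_on oitv (eigfun D m),
        L2gen (eigfun D m) (fun x => eigval D m * eigfun D m x)
        & forall x, oitv x ->
            diffop (eigfun D m) x = eigval D m * eigfun D m x]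
    & (forall i j, L2dot (eigfun D i) (eigfun D j) = (i == j)%:R) /\
      (forall g, inL2 g ->
         (fun n => L2norm2 (fun x =>
            g x - \sum_(m < n) L2dot g (eigfun D m) * eigfun D m x))
           @ \oo --> 0%E)].

Definition assumption1 : Prop :=
  [/\ ergodic, stationary, speed_normalized,
      purely_discrete_spectrum & smooth_coefficients].

(* The moment functions (x, y) |-> k x y, with x = Y_(t_(i-1)), y = Y_(t_i).
   In the first type Y_t may be either observation. *)
Definition bounded_cont (g : R -> R) : Prop :=
  {within oitv, continuous g} /\
  exists c : R, forall x, oitv x -> `|g x| <= c.

Definition moment_type1 (k : R -> R -> R) : Prop :=
  exists g : R -> R,
  [/\ in_dom g,
      forall x, oitv x -> derivable g x 1 /\ derivable (g^`())%classic x 1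
    & (forall x y, oitv x -> oitv y -> k x y = diffop g x) \/
      (forall x y, oitv x -> oitv y -> k x y = diffop g y)].

Definition moment_type2 (k : R -> R -> R) : Prop :=
  exists Psi APsi A'Psi : R -> R -> R,
  [/\ forall y, oitv y ->
        [/\ bounded_cont (Psi ^~ y), bounded_cont (APsi ^~ y)
          & L2gen (Psi ^~ y) (APsi ^~ y)],
      forall x, oitv x ->
        [/\ bounded_cont (Psi x), bounded_cont (A'Psi x)
          & L2gen (Psi x) (A'Psi x)]
    & forall x y, oitv x -> oitv y -> k x y = APsi y x - A'Psi y x].

End Diffusion.

Section Processes.
Variables (R : realType) (d : measure_display) (Omega : measurableType d).
Variable P : probability Omega R.
Local Notation leb := (@lebesgue_measure R).

Definition sigma_of (Z : R -> Omega -> R) (J : set R) : set (set Omega) :=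
  <<s [set A | exists u B, [/\ J u, measurable B & A = Z u @^-1` B]] >>.

Definition indep (F G : set (set Omega)) : Prop :=
  forall A B, F A -> G B -> P (A `&` B) = (P A * P B)%E.

Definition markov (Z : R -> Omega -> R) (k : R -> R -> set R -> \bar R) :=
  forall (s t : R) A B, 0 <= s -> s < t ->
    sigma_of Z [set u | 0 <= u <= s] A -> measurable B ->
    P (A `&` Z t @^-1` B) = (\int[P]_(w in A) k (t - s)%R (Z s w) B)%E.

Definition law_density (Z : Omega -> R) (J : set R) (q : R -> R) : Prop :=
  forall B, measurable B ->
    P (Z @^-1` B) = (\int[leb]_(x in J `&` B) (q x)%:E)%E.

Definition diffusion_process (l r : \bar R) (S : set R) (D : diffusion R)
    (X : R -> Omega -> R) : Prop :=
  [/\ forall t, 0 <= t -> measurable_fun setT (X t),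
      forall w, {within `[0, +oo[, continuous (X ^~ w)} /\
                forall t, 0 <= t -> S (X t w),
      transition_function S D,
      markov X (fun t x B => kern D t x B)
    & generator_is_diffop l r D].

Definition subordinator (phi : R -> R) (T : R -> Omega -> R) : Prop :=
  [/\ forall t, 0 <= t -> measurable_fun setT (T t),
      forall w, [/\ T 0 w = 0,
        forall s t, 0 <= s -> s <= t -> T s w <= T t w
        & forall t, 0 <= t -> T s w @[s --> t^'+] --> T t w],
      forall s t, 0 <= s -> s <= t ->
        indep (sigma_of T [set u | 0 <= u <= s])
              (sigma_of (fun=> T t \- T s) setT),
      forall s t B, 0 <= s -> s <= t -> measurable B ->
        P ((T t \- T s) @^-1` B) = P (T (t - s) @^-1` B)
    & (forall a t, 0 <= a -> 0 <= t ->
         ('E_P[fun w => expR (- a * T t w)%R] = (expR (- phi a * t)%R)%:E)%E) /\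
      (exists2 t, 0 <= t & P [set w | T t w != 0] != 0%E)].

Definition subordinated (X T : R -> Omega -> R) (t : R) (w : Omega) : R :=
  X (T t w) w.

Definition transition_density (l r : \bar R) (Y : R -> Omega -> R)
    (p : R -> R -> R -> R) : Prop :=
  (forall t, 0 < t ->
     measurable_fun (oitv l r `*` oitv l r) (fun z : R * R => p t z.1 z.2) /\
     forall x y, oitv l r x -> oitv l r y -> 0 <= p t x y) /\
  markov Y (fun t x B => \int[leb]_(y in oitv l r `&` B) (p t x y)%:E)%E.

(* D, phi: characteristics of X and T; p: transition density of Y = X o T *)
Definition subordinate_model (l r : \bar R) (S : set R) (D : diffusion R)
    (phi : R -> R) (p : R -> R -> R -> R) (X T : R -> Omega -> R) : Prop :=
  [/\ diffusion_process l r S D X /\ law_density (X 0) (oitv l r) (sdens D),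
      assumption1 l r S D /\ eigensystem l r D,
      subordinator phi T,
      indep (sigma_of X [set u | 0 <= u]) (sigma_of T [set u | 0 <= u])
    & transition_density l r (subordinated X T) p /\
      forall t, 0 <= t ->
        law_density (subordinated X T t) (oitv l r) (sdens D)].

Definition wp_to_one (E : nat -> set Omega) : Prop :=
  exists G : nat -> set Omega,
  [/\ forall n, measurable (G n), forall n, G n `<=` E n
    & (fun n => P (G n)) @ \oo --> 1%E].

Definition observations (Y : R -> Omega -> R) (Delta : R) (n : nat)
    (w : Omega) : n.+1.-tuple R :=
  [tuple Y (i%:R * Delta) w | i < n.+1].

End Processes.

Section EstimatingFunctions.
Variables (R : realType) (p1 p2 M : nat).
Local Notation param := 'rV[R]_(p1 + p2).

Definition Vfun (D : 'rV[R]_p1 -> diffusion R) (phi : 'rV[R]_p2 -> R -> R)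
    (Delta : R) (t : param) (x y : R) : 'cV[R]_M :=
  let D := D (lsubmx t) in
  \col_(m < M) (eigfun D m.+1 y -
    expR (- phi (rsubmx t) (- eigval D m.+1) * Delta) * eigfun D m.+1 x).

Definition f2fun D phi Delta (W : param -> R -> 'M[R]_(M, p2)) (t : param)
    (x y : R) : 'rV[R]_p2 :=
  ((W t x)^T *m Vfun D phi Delta t x y)^T.

Definition ffun (f1 : 'rV[R]_p1 -> R -> R -> 'rV[R]_p1)
    (f2 : param -> R -> R -> 'rV[R]_p2) (t : param) (x y : R) : param :=
  row_mx (f1 (lsubmx t) x y) (f2 t x y).

Definition Fsum (k : nat) (T : Type) (f : T -> R -> R -> 'rV[R]_k) (n : nat)
    (y : n.+1.-tuple R) (t : T) : 'rV[R]_k :=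
  \sum_(i < n) f t y`_i y`_i.+1.

Definition Fhsum (f1 : 'rV[R]_p1 -> R -> R -> 'rV[R]_p1)
    (F2h : forall n, R -> n.+1.-tuple R -> param -> 'rV[R]_p2)
    (n : nat) (h : R) (y : n.+1.-tuple R) (t : param) : param :=
  row_mx (Fsum f1 y (lsubmx t)) (F2h n h y t).

End EstimatingFunctions.

Section Assumptions.
Variables (R : realType) (d : measure_display) (Omega : measurableType d).
Variables (p1 p2 : nat) (l r : \bar R) (Delta : R).
Local Notation param := 'rV[R]_(p1 + p2).
Local Notation leb := (@lebesgue_measure R).
Local Notation J := (oitv l r).

Definition Epair (P : probability Omega R) (Y : R -> Omega -> R)
    (g : R -> R -> R) : R :=
  fine 'E_P[fun w => g (Y 0%R w) (Y Delta w)]%E.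

Variables (P : probability Omega R) (Y : R -> Omega -> R).
Variable Q : R -> R -> R.  (* joint density of (Y_(t_0), Y_(t_1)) *)
Variables (Theta : set param) (tbar : param).
Variables (f1 : 'rV[R]_p1 -> R -> R -> 'rV[R]_p1)
          (f2 : param -> R -> R -> 'rV[R]_p2).

Definition Qintegrable (g : R -> R -> R) : Prop :=
  measurable_fun (J `*` J) (fun z : R * R => g z.1 z.2) /\
  (leb \x leb)%E.-integrable (J `*` J)
    (fun z : R * R => (g z.1 z.2 * Q z.1 z.2)%:E).

Definition moment_functions (D : 'rV[R]_p1 -> diffusion R) : Prop :=
  forall j : 'I_p1,
  [/\ forall t, Theta t ->
        measurable_fun (J `*` J)
          (fun z : R * R => f1 (lsubmx t) z.1 z.2 0 j),
      forall t, Theta t ->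
        let k x y := f1 (lsubmx t) x y 0 j in
        moment_type1 l r (D (lsubmx t)) k \/ moment_type2 l r (D (lsubmx t)) k
    & 'E_P[fun w => f1 (lsubmx tbar) (Y 0%R w) (Y Delta w) 0%R j]%E = 0%E].

Definition A1mx : 'M[R]_p1 :=
  \matrix_(i, j) Epair P Y
    (fun x y => pderiv (fun t1 => f1 t1 x y) (lsubmx tbar) i j).

Definition A2mx : 'M[R]_p2 :=
  \matrix_(i, j) Epair P Y
    (fun x y => pderiv (fun t2 => f2 (row_mx (lsubmx tbar) t2) x y)
                  (rsubmx tbar) i j).

Definition dominated_on (B : set param) (g : param -> R -> R -> R) : Prop :=
  exists k : R -> R -> R, Qintegrable k /\
    forall t x y, B t -> J x -> J y -> `|g t x y| <= k x y.

Definition assumption2 (B : set param) : Prop :=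
  [/\ [/\ Theta tbar, open B, B `<=` Theta & B tbar],
      forall x y, J x -> J y ->
        C1_on [set lsubmx t | t in B] (fun t1 => f1 t1 x y) /\
        C1_on B (fun t => f2 t x y),
      (forall i j, dominated_on B (fun t x y =>
         pderiv (fun t1 => f1 t1 x y) (lsubmx t) i j)) /\
      (forall i j, dominated_on B (fun t x y =>
         pderiv (fun u => f2 u x y) t i j)),
      forall j,
        (forall t, B t -> t != tbar ->
           Qintegrable (fun x y => ffun f1 f2 t x y 0 j)) /\
        measurable_fun (J `*` J)
          (fun z : R * R => ffun f1 f2 tbar z.1 z.2 0 j) /\
        Qintegrable (fun x y => ffun f1 f2 tbar x y 0 j ^+ 2)
    & A1mx \in unitmx /\ A2mx \in unitmx].

Definition locally_dominated (g : param -> R -> R -> R) : Prop :=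
  forall t, Theta t -> exists U : set param, exists k : R -> R -> R,
  [/\ nbhs t U, Qintegrable k, forall x y, J x -> J y -> 0 <= k x y
    & forall x y u, J x -> J y -> U u -> Theta u -> `|g u x y| < k x y].

Definition assumption3 : Prop :=
  (forall t, Theta t -> t != tbar ->
     \row_j Epair P Y (fun x y => ffun f1 f2 t x y 0 j) != 0) /\
  (forall j, locally_dominated (fun t x y => ffun f1 f2 t x y 0 j)).

(* Continuity of the estimating functions on the whole of Theta (assumption2
   gives it near tbar only): with local domination it yields the uniform law of
   large numbers on compact sets. *)
Definition continuous_in_parameter : Prop :=
  forall x y t, J x -> J y -> Theta t ->
    {for t, continuous (fun u => ffun f1 f2 u x y)}.

End Assumptions.

Section Estimators.
Variables (R : realType) (d : measure_display) (Omega : measurableType d).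
Variables (P : probability Omega R) (Y : R -> Omega -> R) (Delta : R).
Local Notation obs := (observations Y Delta).

(* [est n], a function of the data, solves G_n = 0 in Theta almost surely on
   the event that the data belong to [A n]. *)
Definition estimator_on (p : nat) (Theta : set 'rV[R]_p)
    (G : forall n, n.+1.-tuple R -> 'rV[R]_p -> 'rV[R]_p)
    (A : forall n, set (n.+1.-tuple R))
    (est : forall n, n.+1.-tuple R -> 'rV[R]_p) : Prop :=
  forall n,
  [/\ measurable (A n),
      forall j, measurable_fun setT (fun y => est n y 0 j)
    & {ae P, forall w, A n (obs n w) ->
         Theta (est n (obs n w)) /\ G n (obs n w) (est n (obs n w)) = 0}].

Definition cvg_prob_on (k : nat) (A : forall n, set (n.+1.-tuple R))
    (Z : forall n, n.+1.-tuple R -> 'rV[R]_k) (z : 'rV[R]_k) : Prop :=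
  forall eps : R, 0 < eps ->
    (fun n => P [set w | A n (obs n w) /\ eps < enorm (Z n (obs n w) - z)])
      @ \oo --> 0%E.

Variables (p1 p2 : nat).
Local Notation param := 'rV[R]_(p1 + p2).
Variables (f1 : 'rV[R]_p1 -> R -> R -> 'rV[R]_p1)
          (f2 : param -> R -> R -> 'rV[R]_p2)
          (F2h : forall n, R -> n.+1.-tuple R -> param -> 'rV[R]_p2)
          (h : nat -> R).

Definition error_bound1 (Theta : set param) (a : R) (C : param -> R) : Prop :=
  forall n, (0 < n)%N -> {ae P, forall w, forall t, Theta t ->
    enorm (@F2h n (h n) (obs n w) t - Fsum f2 (obs n w) t)
      <= C t * n%:R * h n `^ a}.

(* Ordinals start at 0: the rows of the second block are those with p1 <= i. *)
Definition error_bound2 (U : set param) (b : R)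
    (Cij : 'I_(p1 + p2) -> 'I_(p1 + p2) -> param -> R) : Prop :=
  forall n, (0 < n)%N -> {ae P, forall w, forall t, U t ->
    forall i j : 'I_(p1 + p2), (p1 <= i)%N ->
    `|pderiv (Fhsum f1 F2h (h n) (obs n w)) t i j -
      pderiv (Fsum (ffun f1 f2) (obs n w)) t i j|
      <= Cij i j t * n%:R * h n `^ b}.

End Estimators.

(* Main.v *)
From HB Require Import structures.
Require Import Defs.
From mathcomp Require Import all_boot all_order all_algebra.
From mathcomp Require Import all_classical all_reals all_analysis.
From mathcomp Require Import measurable_realfun ring lra zify.
Import Order.TTheory GRing.Theory Num.Theory.
Import numFieldNormedType.Exports.
Local Open Scope classical_set_scope.
Local Open Scope ring_scope.

Set Implicit Arguments.
Unset Strict Implicit.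
Unset Printing Implicit Defensive.

(* The eigenfunctions turn the Markov property into exponential damping.  For the
   diffusion, E [1_A(X_0) phi_m(X_s)] = exp (lambda_m s) E [1_A(X_0) phi_m(X_0)],
   and mixing over the independent subordinator replaces exp (lambda_m s) by
   exp (- phi(-lambda_m) t), which is < 1 for m > 0.  Hence f_2 is a martingale
   difference, and indicators of rectangles evaluated at the pairs
   (Y_(i-1), Y_i) decorrelate; this gives a law of large numbers in L^1 for all
   integrable functions of the pairs, uniform over small balls of parameters for
   dominated families.

   Applied to the derivatives of f, it shows that the score
   G(t) = n^-1 F_n(t) N, with N the inverse of the (transposed) limit of the
   Jacobian matrices, differs from the identity by a 1/2-contraction on a fixed
   ball around tbar, with G(tbar) small, on events of probability tending to 1.
   By (E2) the same holds for F_n^h.  Both maps then have a unique zero in the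
   ball, and distances are controlled by values: |u - v| <= 2 |G u - G v|.  This
   gives consistency and, with (E1), the rate h^p.  The limiting Jacobian is block
   triangular, so that the first blocks of the two zeros coincide.  Outside the
   ball, uniqueness follows from the uniform law of large numbers on a compact
   set, where the expected score does not vanish. *)

(** * Mixtures of measures, laws and densities *)

(** The estimators have to be measurable functions of the data, although the estimating functions
    are controlled on the open interval only and the natural data events quantify over a continuum
    of parameters. Hence functions are extended by 0 off the interval, which carries the stationary
    law, and the conditions that define the data events are tested on a countable dense set of
    parameters. Laws are treated as mixtures of measures: a density, the Markov property on an event
    of the past and the subordination by an independent clock are instances of one identity between
    sets, which [integral_mixture] and its signed form extend to functions. The law of large numbers
    is kept in L^1 because stationarity bounds the L^1 error of an average by that of a single term,
    uniformly in [n]; this is what lets indicators of rectangles generate all integrable functions.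
    Contraction is the right form of local invertibility here: it holds on a ball whose radius is
    independent of [n], it survives the perturbations (E1) and (E2), and it turns values of the
    score into distances. *)

Section mixture.
Local Open Scope ereal_scope.
Context d1 d2 (W : measurableType d1) (T : measurableType d2) (R : realType).
Variables (mu : {measure set W -> \bar R}) (nu : {measure set T -> \bar R}).
Variables (E : set W) (k : W -> {measure set T -> \bar R}).
Hypotheses (mE : measurable E)
  (mk : forall A, measurable A -> measurable_fun E (k ^~ A))
  (nuE : forall A, measurable A -> nu A = \int[mu]_(w in E) k w A).

Import HBNNSimple.

Let nnsfunE (m : {measure set T -> \bar R}) (h : {nnsfun T >-> R}) :
  \int[m]_x (h x)%:E = \sum_(r \in range h) (r%:E * m (h @^-1` [set r])).
Proof. by rewrite integralT_nnsfun sintegralE. Qed.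

Let mixk (r : R) (h : {nnsfun T >-> R}) (w : W) :
  0 <= r%:E * k w (h @^-1` [set r]).
Proof.
have [r0|r0] := leP 0%R r; first by rewrite mule_ge0.
by rewrite preimage_nnfun0// measure0 mule0.
Qed.

Let mixture_nnsfun (h : {nnsfun T >-> R}) :
  measurable_fun E (fun w => \int[k w]_x (h x)%:E) /\
  \int[nu]_x (h x)%:E = \int[mu]_(w in E) \int[k w]_x (h x)%:E.
Proof.
have mr r : measurable_fun E (fun w => r%:E * k w (h @^-1` [set r])).
  exact/measurable_funeM/mk.
split.
  under eq_fun do rewrite nnsfunE.
  by apply: emeasurable_fsum.
rewrite nnsfunE; under eq_integral do rewrite nnsfunE.
rewrite ge0_integral_fsum//.
apply: eq_fsbigr => r _.
have [r0|r0] := leP 0%R r.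
  rewrite ge0_integralZl//; last exact: mk.
  by rewrite nuE.
rewrite preimage_nnfun0// measure0 mule0.
by under eq_integral do rewrite measure0 mule0; rewrite integral0.
Qed.

Let lim_approx (m : {measure set T -> \bar R}) (f : T -> \bar R)
    (f0 : forall x, 0 <= f x) (mf : measurable_fun setT f) :
  \int[m]_x f x = limn (fun n => \int[m]_x (nnsfun_approx measurableT mf n x)%:E).
Proof.
rewrite -monotone_convergence//=.
- apply: eq_integral => x _; apply/esym/cvg_lim => //.
  exact: cvg_nnsfun_approx.
- by move=> n; exact/measurable_EFinP.
- by move=> n x _; rewrite lee_fin.
- by move=> x _ a b ab; rewrite lee_fin; exact/lefP/nd_nnsfun_approx.
Qed.

(** True for nonnegative simple functions by additivity, then in the limit along [nnsfun_approx] by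
    monotone convergence, applied under [nu], under each [k w] and under the outer integral.
    Measurability of [k] is required on [E] only, so that [E] can be an event of the past. *)
Lemma integral_mixture (f : T -> \bar R) :
  (forall x, 0 <= f x) -> measurable_fun setT f ->
  measurable_fun E (fun w => \int[k w]_x f x) /\
  \int[nu]_x f x = \int[mu]_(w in E) \int[k w]_x f x.
Proof.
move=> f0 mf; set h := nnsfun_approx measurableT mf.
have ndk (m : {measure set T -> \bar R}) a b : (a <= b)%N ->
    \int[m]_x (h a x)%:E <= \int[m]_x (h b x)%:E.
  move=> ab; apply: ge0_le_integral => //.
  - by move=> x _; rewrite lee_fin.
  - exact/measurable_EFinP.
  - exact/measurable_EFinP.
  - by move=> x _; rewrite lee_fin; exact/lefP/nd_nnsfun_approx.
have kE : (fun w => \int[k w]_x f x) =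
    (fun w => limn (fun n => \int[k w]_x (h n x)%:E)).
  by apply/funext => w; exact: lim_approx.
split.
  rewrite kE; apply: (emeasurable_fun_cvg (fun n w => \int[k w]_x (h n x)%:E)).
    by move=> n; have [] := mixture_nnsfun (h n).
  move=> w _; apply: ereal_nondecreasing_is_cvgn => a b ab; exact: ndk.
rewrite (lim_approx nu f0 mf).
under [RHS]eq_integral do rewrite (lim_approx _ f0 mf).
rewrite monotone_convergence//.
- congr (limn _); apply/funext => n; by have [_ ->] := mixture_nnsfun (h n).
- by move=> n; have [] := mixture_nnsfun (h n).
- by move=> n w _; apply: integral_ge0 => x _; rewrite lee_fin.
- by move=> w _ a b ab; exact: ndk.
Qed.

End mixture.

(** A measure with density [D] is the mixture of the Dirac masses at [x] scaled by [D x]. *)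
Lemma integral_density d (T : measurableType d) (R : realType)
    (mu nu : {measure set T -> \bar R}) (D : T -> R) :
  (forall x, 0 <= D x) -> measurable_fun setT D ->
  (forall A, measurable A -> nu A = (\int[mu]_(x in A) (D x)%:E)%E) ->
  forall f : T -> \bar R, (forall x, 0 <= f x)%E -> measurable_fun setT f ->
  (\int[nu]_x f x = \int[mu]_x ((D x)%:E * f x))%E.
Proof.
move=> D0 mD nuE f f0 mf.
pose k x := mscale (NngNum (D0 x)) (dirac x : {measure set T -> \bar R}).
have kE A x : measurable A -> k x A = (D x * \1_A x)%:E.
  by move=> mA; rewrite /k/= /mscale/= diracE -EFinM indicE.
have [||_ ->//] := @integral_mixture _ _ _ _ _ mu nu setT k measurableT _ _ f f0 mf.
- move=> A mA.
  rewrite (_ : k ^~ A = fun x => (D x * \1_A x)%:E); last first.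
    by apply/funext => x; rewrite kE.
  by apply/measurable_EFinP; apply: measurable_funM => //.
- move=> A mA; rewrite nuE// integral_mkcond; apply: eq_integral => x _.
  rewrite [RHS]kE// patchE indicE; by case: ifPn; rewrite ?mulr1 ?mulr0.
apply: eq_integral => x _; rewrite ge0_integral_mscale//.
by rewrite integral_dirac// diracT mul1e.
Qed.

Definition law d1 d2 (T : measurableType d1) (U : measurableType d2)
    (R : realType) (m : {measure set T -> \bar R}) (f : T -> U)
    (mf : measurable_fun setT f) : {measure set U -> \bar R} :=
  measure_function_pushforward__canonical__measure_function_Measure m mf.

Section law.
Context d1 d2 (T : measurableType d1) (U : measurableType d2) (R : realType).
Variables (m : {measure set T -> \bar R}) (f : T -> U).
Hypothesis mf : measurable_fun setT f.

Lemma ge0_integral_law (g : U -> \bar R) : measurable_fun setT g ->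
  (forall y, 0 <= g y)%E ->
  (\int[law m mf]_y g y = \int[m]_x g (f x))%E.
Proof.
by move=> mg g0; rewrite [LHS](ge0_integral_pushforward mf)// => y _.
Qed.

Lemma integrable_law (g : U -> \bar R) : measurable_fun setT g ->
  m.-integrable setT (g \o f) -> (law m mf).-integrable setT g.
Proof.
move=> mg gi; apply: integrable_pushforward => //.
Qed.

Lemma integral_law (g : U -> \bar R) : measurable_fun setT g ->
  m.-integrable setT (g \o f) ->
  (\int[law m mf]_y g y = \int[m]_x g (f x))%E.
Proof. by move=> mg gi; exact: (integral_pushforward mf mg gi). Qed.

End law.

Lemma integral_prob_cst (R : realType) d (T : measurableType d)
    (P : probability T R) (c : \bar R) : (\int[P]_w c = c)%E.
Proof.
rewrite integral_cst// [X in (_ * X)%E](_ : _ = 1%E) ?mule1//.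
exact: probability_setT.
Qed.

Section mixture_signed.
Context d1 d2 (W : measurableType d1) (T : measurableType d2) (R : realType).
Variables (mu : {measure set W -> \bar R}) (nu : {measure set T -> \bar R}).
Variables (E : set W) (k : W -> {measure set T -> \bar R}).
Hypotheses (mE : measurable E)
  (mk : forall A, measurable A -> measurable_fun E (k ^~ A))
  (nuE : forall A, measurable A -> nu A = (\int[mu]_(w in E) k w A)%E).

(** Positive and negative parts are mixed separately. For a null set of [w] the inner integral may
    be infinite or undefined; [Rintegral] then returns a default real through [fine], which the
    outer integral does not see. *)
Lemma integral_mixture_signed (f : T -> R) :
  measurable_fun setT f -> nu.-integrable setT (EFin \o f) ->
  [/\ measurable_fun E (fun w => \int[k w]_x f x),
      {ae mu, forall w, E w -> (k w).-integrable setT (EFin \o f)},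
      mu.-integrable E (fun w => (\int[k w]_x f x)%:E)
    & (\int[nu]_x (f x)%:E = \int[mu]_(w in E) (\int[k w]_x f x)%:E)%E].
Proof.
move=> mf fi; pose g := EFin \o f.
have mg : measurable_fun setT g by exact/measurable_EFinP.
have gp0 x : (0 <= g^\+ x)%E by [].
have gn0 x : (0 <= g^\- x)%E by [].
have mgp := measurable_funepos mg; have mgn := measurable_funeneg mg.
have [mp ep] := integral_mixture mE mk nuE gp0 mgp.
have [mn en] := integral_mixture mE mk nuE gn0 mgn.
set Gp := fun w => _ in mp; set Gn := fun w => _ in mn.
have Gp0 w : (0 <= Gp w)%E by exact: integral_ge0.
have Gn0 w : (0 <= Gn w)%E by exact: integral_ge0.
have ip : mu.-integrable E Gp.
  apply/integrableP; split => //; under eq_integral do rewrite gee0_abs//.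
  by rewrite -ep; exact: integral_funepos_lt_pinfty fi.
have in_ : mu.-integrable E Gn.
  apply/integrableP; split => //; under eq_integral do rewrite gee0_abs//.
  by rewrite -en; exact: integral_funeneg_lt_pinfty fi.
have RE : (fun w => \int[k w]_x f x) = fine \o (Gp \- Gn)%E.
  by apply/funext => w; rewrite /Rintegral/= integralE.
have mR : measurable_fun E (fun w => \int[k w]_x f x).
  rewrite RE; apply: measurableT_comp => //.
  exact: emeasurable_funB.
have aep := integrable_ae mE ip; have aen := integrable_ae mE in_.
have aeE : ae_eq mu E (EFin \o (fun w => \int[k w]_x f x)) (Gp \- Gn)%E.
  apply: filterS2 aep aen => w pw nw Ew; rewrite RE /= fineK//.
  by rewrite fin_numB pw// nw.
have iB := integrableB mE ip in_.
have iR : mu.-integrable E (EFin \o (fun w => \int[k w]_x f x)).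
  apply/integrableP; split; first exact/measurable_EFinP.
  move/integrableP: iB => [mB]; apply: le_lt_trans.
  rewrite le_eqVlt; apply/orP; left; apply/eqP; apply: ge0_ae_eq_integral => //.
  - by apply: measurableT_comp => //; exact/measurable_EFinP.
  - by apply: measurableT_comp.
  - by apply: filterS aeE => w + Ew => ->.
split => //.
- apply: filterS2 aep aen => w pw nw Ew; apply/integrableP; split => //.
  rewrite (eq_integral (fun x => g^\+ x + g^\- x)%E); last first.
    by move=> x _; exact: (congr1 (fun h => h x) (fune_abse g)).
  rewrite ge0_integralD//; apply: lte_add_pinfty.
    by rewrite -ge0_fin_numE ?integral_ge0// -/(Gp w) pw.
  by rewrite -ge0_fin_numE ?integral_ge0// -/(Gn w) nw.
- rewrite integralE ep en -integralB//; apply: ae_eq_integral => //.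
  + exact: measurable_int iB.
  + exact/measurable_EFinP.
  + by apply: filterS aeE => w H Ew; exact/esym/H.
Qed.

End mixture_signed.

Section density_measure.
Context d (T : measurableType d) (R : realType).
Variables (mu : {measure set T -> \bar R}) (D : T -> R).

(** The proofs [D0] and [mD] are arguments because the measure structure declared below is attached
    to the term [densm D0 mD]. *)
Definition densm (D0 : forall x, 0 <= D x) (mD : measurable_fun setT D)
    (A : set T) : \bar R := (\int[mu]_(x in A) (D x)%:E)%E.

Hypotheses (D0 : forall x, 0 <= D x) (mD : measurable_fun setT D).

Let densm0 : densm D0 mD set0 = 0%E. Proof. exact: integral_set0. Qed.

Let densm_ge0 A : (0 <= densm D0 mD A)%E.
Proof. by apply: integral_ge0 => x _; rewrite lee_fin. Qed.

Let densm_sigma : semi_sigma_additive (densm D0 mD).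
Proof.
move=> F mF tF mUF; rewrite /densm ge0_integral_bigcup//.
- by apply: is_cvg_ereal_nneg_natsum => n _; apply: integral_ge0 => x _; rewrite lee_fin.
- exact/measurable_EFinP/measurable_funTS.
- by move=> x _; rewrite lee_fin.
Qed.

HB.instance Definition _ := isMeasure.Build _ _ _ (densm D0 mD)
  densm0 densm_ge0 densm_sigma.

Lemma integral_densm (f : T -> \bar R) :
  (forall x, 0 <= f x)%E -> measurable_fun setT f ->
  (\int[densm D0 mD]_x f x = \int[mu]_x ((D x)%:E * f x))%E.
Proof. by move=> f0 mf; apply: integral_density. Qed.

End density_measure.

Section plaw.
Context d1 d2 (T : measurableType d1) (U : measurableType d2) (R : realType).
Variables (P : probability T R) (f : T -> U).
Hypothesis mf : measurable_fun setT f.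

Definition plaw : probability U R :=
  distribution P (MeasurableFun.Pack (MeasurableFun.Class
    (isMeasurableFun.Build _ _ _ _ _ mf))).

Lemma plawE A : plaw A = P (f @^-1` A). Proof. by []. Qed.

Lemma ge0_integral_plaw (g : U -> \bar R) : measurable_fun setT g ->
  (forall y, 0 <= g y)%E -> (\int[plaw]_y g y = \int[P]_x g (f x))%E.
Proof. exact: (ge0_integral_law P mf). Qed.

Lemma integrable_plaw (g : U -> \bar R) : measurable_fun setT g ->
  P.-integrable setT (g \o f) -> plaw.-integrable setT g.
Proof. exact: (@integrable_law _ _ _ _ _ P f mf). Qed.

Lemma integral_plaw (g : U -> \bar R) : measurable_fun setT g ->
  P.-integrable setT (g \o f) -> (\int[plaw]_y g y = \int[P]_x g (f x))%E.
Proof. exact: (integral_law (m := P) mf). Qed.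

End plaw.

(** * Events of probability tending to one and the law of large numbers *)

Section wp_to_one_theory.
Context (R : realType) (d : measure_display) (Omega : measurableType d).
Variable P : probability Omega R.
Implicit Types E F : nat -> set Omega.

(** [wp_to_one] asks for measurable events included in [E n] at every point, since [E n] itself need
    not be measurable. In this form the inclusion may fail on a null set and for finitely many [n]:
    for the converse the null sets are removed from [G n], and the events are emptied below [N]. *)
Lemma wp_to_oneP E : wp_to_one P E <-> exists G : nat -> set Omega,
  [/\ forall n, measurable (G n), exists N, forall n, (N <= n)%N ->
      {ae P, forall w, G n w -> E n w}
    & forall e : R, 0 < e -> exists N, forall n, (N <= n)%N ->
      (P (~` G n) <= e%:E)%E].
Proof.
split=> [[G [mG GE G1]]|[G [mG [N GE] Gc]]].
  exists G; split => //.
    by exists 0%N => n _; apply/aeW => w; exact: GE.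
  move=> e e0; move/fine_cvgP : G1 => [_ /cvgrPdist_le /(_ e e0)[N _ NG]].
  exists N => n Nn; rewrite probability_setC//.
  have := NG n Nn; rewrite -[P (G n)]fineK ?fin_num_measure//= -EFinB lee_fin.
  by apply: le_trans; rewrite ler_norm.
pose bad n := ~` [set w | G n w -> E n w].
have /choice[B BP] : forall n, exists B, [/\ measurable B, P B = 0%E &
    (N <= n)%N -> bad n `<=` B].
  move=> n; have [Nn|nN] := leqP N n.
    by have [B [mB PB sB]] := GE n Nn; exists B.
  by exists set0; rewrite measure0.
pose H n := if (N <= n)%N then G n `\` B n else set0.
exists H; split.
- move=> n; rewrite /H; case: ifP => // _; apply: measurableD => //.
  by case: (BP n).
- move=> n w; rewrite /H; case: ifP => // Nn [Gw Bw].
  apply: contrapT => nE; apply: Bw; case: (BP n) => _ _ /(_ Nn); apply.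
  by rewrite /bad /= => /(_ Gw).
apply/fine_cvgP; split.
  apply: nearW => n; rewrite fin_num_measure// /H; case: ifP => // _.
  by apply: measurableD => //; case: (BP n).
apply/cvgrPdist_le => e e0; have [N' N'G] := Gc e e0.
exists (maxn N N') => // n /=; rewrite geq_max => /andP[Nn N'n].
have [mB PB _] := BP n.
have PH : P (H n) = P (G n).
  rewrite /H Nn; have -> : G n `\` B n = G n `&` ~` B n by [].
  have := @measureD _ _ _ P (G n) (B n) (mG n) mB.
  rewrite setDE => -> //; last first.
    by rewrite -ge0_fin_numE ?fin_num_measure.
  rewrite [X in (_ - X)%E](_ : _ = 0%E) ?sube0//; apply/eqP.
  rewrite eq_le measure_ge0 andbT -[leRHS]PB le_measure ?inE//.
  exact: measurableI.
have := N'G n N'n; rewrite probability_setC// PH.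
rewrite -[P (G n)]fineK ?fin_num_measure//= -EFinB lee_fin => le1.
rewrite ger0_norm// subr_ge0 -lee_fin fineK ?fin_num_measure//.
exact: probability_le1.
Qed.

Lemma wp_to_one_sub_ae E F : wp_to_one P E ->
  (exists N, forall n, (N <= n)%N -> {ae P, forall w, E n w -> F n w}) ->
  wp_to_one P F.
Proof.
move=> /wp_to_oneP[G [mG [N GE] G1]] [N' EF]; apply/wp_to_oneP.
exists G; split => //; exists (maxn N N') => n.
rewrite geq_max => /andP[Nn N'n].
by apply: filterS2 (GE n Nn) (EF n N'n) => w GEw EFw /GEw /EFw.
Qed.

Lemma wp_to_one_sub E F : wp_to_one P E -> (forall n, E n `<=` F n) ->
  wp_to_one P F.
Proof.
move=> PE EF; apply: wp_to_one_sub_ae PE _.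
by exists 0%N => n _; apply: aeW; exact: EF.
Qed.

Lemma wp_to_one_ae E : (forall n, {ae P, forall w, E n w}) -> wp_to_one P E.
Proof.
move=> aeE; apply/wp_to_oneP; exists (fun=> setT); split => //.
  by exists 0%N => n _; apply: filterS (aeE n).
by move=> e e0; exists 0%N => n _; rewrite setCT measure0 lee_fin ltW.
Qed.

Lemma wp_to_oneI E F : wp_to_one P E -> wp_to_one P F ->
  wp_to_one P (fun n => E n `&` F n).
Proof.
move=> /wp_to_oneP[G [mG [N GE] G1]] /wp_to_oneP[H [mH [N' HF] H1]].
apply/wp_to_oneP; exists (fun n => G n `&` H n); split.
- by move=> n; exact: measurableI.
- exists (maxn N N') => n; rewrite geq_max => /andP[Nn N'n].
  by apply: filterS2 (GE n Nn) (HF n N'n) => w GEw EFw [/GEw ? /EFw].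
move=> e e0; have e20 : 0 < e / 2 by rewrite divr_gt0.
have [n1 Gn] := G1 _ e20; have [n2 Hn] := H1 _ e20.
exists (maxn n1 n2) => n; rewrite geq_max => /andP[n1n n2n].
rewrite setCI (le_trans (@measureU2 _ _ _ P _ _ _ _))//; try exact: measurableC.
by rewrite [e in leRHS]splitr EFinD leeD// ?Gn ?Hn.
Qed.

Lemma wp_to_one_forall (I : finType) (E : I -> nat -> set Omega) :
  (forall i, wp_to_one P (E i)) -> wp_to_one P (fun n => [set w | forall i, E i n w]).
Proof.
move=> PE.
suff : forall s : seq I, wp_to_one P (fun n => [set w | forall i, i \in s -> E i n w]).
  move=> /(_ (enum I)) H; apply: wp_to_one_sub H _ => n w /= wE i.
  by apply: wE; rewrite mem_enum.
elim=> [|j s IH].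
  by apply: wp_to_one_ae => n; exact: aeW.
apply: wp_to_one_sub (wp_to_oneI (PE j) IH) _ => n w [wj ws] i.
by rewrite inE => /predU1P[->//|]; exact: ws.
Qed.

Lemma wp_to_one_cvg0 E F : wp_to_one P E -> (forall n, measurable (F n)) ->
  (exists N, forall n, (N <= n)%N -> {ae P, forall w, E n w -> ~ F n w}) ->
  (fun n => P (F n)) @ \oo --> 0%E.
Proof.
move=> PE mF EF; have /wp_to_oneP[G [mG [N GE] G1]] :=
  wp_to_one_sub_ae (F := fun n => ~` F n) PE EF.
apply/fine_cvgP; split; first by apply: nearW => n; rewrite fin_num_measure.
apply/cvgrPdist_le => e e0; have [N' G1'] := G1 e e0.
exists (maxn N N') => // n /=; rewrite geq_max => /andP[Nn N'n].
rewrite sub0r normrN ger0_norm ?fine_ge0//.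
rewrite -lee_fin fineK ?fin_num_measure//; apply: le_trans (G1' n N'n).
have [B [mB PB sB]] := GE n Nn.
have sFB : F n `<=` ~` G n `|` B.
  move=> w Fw; have [Gw|] := pselect (G n w); last by left.
  by right; apply: sB => /= /(_ Gw).
apply: (@le_trans _ _ (P (~` G n `|` B))).
  by apply: le_measure => //; rewrite inE//; apply: measurableU => //; exact: measurableC.
apply: (le_trans (@measureU2 _ _ _ P _ _ _ _)) => //; first exact: measurableC.
by rewrite [X in (_ + X)%E](_ : _ = 0%E) ?adde0.
Qed.

Lemma wp_to_one_cvg1 E : wp_to_one P E -> (forall n, measurable (E n)) ->
  (fun n => P (E n)) @ \oo --> 1%E.
Proof.
move=> PE mE; have mEC n : measurable (~` E n) by exact: measurableC.
have : (fun n => P (~` E n)) @ \oo --> 0%E.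
  apply: (wp_to_one_cvg0 PE) => //; exists 0%N => n _.
  by apply: aeW => w Ew /(_ Ew).
have -> : (fun n => P (E n)) = (fun n => 1 - P (~` E n))%E.
  by apply/funext => n; rewrite -probability_setC ?setCK.
move=> H; rewrite -[X in _ --> X]sube0; apply: cvgeB H => //.
exact: cvg_cst.
Qed.

End wp_to_one_theory.

Section lln.
Context (R : realType) (d : measure_display) (Omega : measurableType d).
Variable P : probability Omega R.
Context (dU : measure_display) (U : measurableType dU).
Variable zeta : nat -> Omega -> U.
Hypothesis mzeta : forall i, measurable_fun setT (zeta i).
Hypothesis zetaE : forall i C, measurable C ->
  P (zeta i @^-1` C) = P (zeta 0%N @^-1` C).

Implicit Types f g : U -> R.

Definition average (f : U -> R) (n : nat) (w : Omega) : R :=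
  n%:R^-1 * \sum_(i < n) f (zeta i w).

Definition mean0 (f : U -> R) : R := \int[P]_w f (zeta 0%N w).

(** Convergence of the averages in L^1. Convergence in probability would not pass to L^1 limits of
    [f] as directly; see [lln_approx]. *)
Definition lln (f : U -> R) := forall e : R, 0 < e ->
  exists N, forall n, (N <= n)%N ->
  (\int[P]_w `|average f n w - mean0 f|%:E <= e%:E)%E.

Local Notation integ f := (P.-integrable setT (EFin \o (f \o zeta 0%N))).

Lemma ge0_integral_zeta i (f : U -> \bar R) : measurable_fun setT f ->
  (forall x, 0 <= f x)%E ->
  (\int[P]_w f (zeta i w) = \int[P]_w f (zeta 0%N w))%E.
Proof.
move=> mf f0.
rewrite -(ge0_integral_law P (mzeta i))// -(ge0_integral_law P (mzeta 0%N))//.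
apply: eq_measure_integral => A mA _; exact: zetaE.
Qed.

Lemma measurable_average f n : measurable_fun setT f ->
  measurable_fun setT (average f n).
Proof.
move=> mf; apply: measurable_funM => //.
by apply: measurable_sum => i; exact: measurableT_comp.
Qed.

Lemma average_cst c n : (0 < n)%N -> average (fun=> c) n = fun=> c.
Proof.
move=> n0; apply/funext => w; rewrite /average sumr_const card_ord -[c *+ n]mulr_natl.
by rewrite mulrA mulVf ?mul1r// pnatr_eq0 -lt0n.
Qed.

Lemma integral_average_le (f : U -> R) n : measurable_fun setT f ->
  (forall x, 0 <= f x) ->
  (\int[P]_w (average f n w)%:E <= \int[P]_w (f (zeta 0%N w))%:E)%E.
Proof.
move=> mf f0; under eq_integral do rewrite /average EFinM -sumEFin.
have mfz i : measurable_fun setT (fun w => (f (zeta i w))%:E).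
  by apply/measurable_EFinP; exact: measurableT_comp.
rewrite ge0_integralZl//; last 2 first.
- exact: emeasurable_sum.
- by move=> w _; apply: sume_ge0 => i _; rewrite lee_fin.
rewrite ge0_integral_sum//; last by move=> i w _; rewrite lee_fin.
rewrite (eq_bigr (fun=> \int[P]_w (f (zeta 0%N w))%:E)%E); last first.
  move=> i _; apply: (@ge0_integral_zeta i (fun x => (f x)%:E)).
    exact/measurable_EFinP.
  by move=> x; rewrite lee_fin.
rewrite -[X in (_ * \sum_(_ < _) X)%E]mul1e.
rewrite -ge0_sume_distrl//= sumEFin sumr_const card_ord muleA -EFinM.
have [->|n0] := eqVneq n 0%N.
  by rewrite mulr0 mul0e integral_ge0// => w _; rewrite lee_fin.
by rewrite mulVf ?mul1e// pnatr_eq0.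
Qed.

Lemma averageB f g n w : average (f \- g) n w = average f n w - average g n w.
Proof. by rewrite /average sumrB mulrBr. Qed.

Lemma averageD f g n w : average (f \+ g) n w = average f n w + average g n w.
Proof. by rewrite /average big_split mulrDr. Qed.

Lemma averageZ k f n w : average (k \*o f) n w = k * average f n w.
Proof. by rewrite /average mulrCA -mulr_sumr. Qed.

Lemma le_average f g n w : (forall x, f x <= g x) ->
  average f n w <= average g n w.
Proof. by move=> fg; rewrite ler_wpM2l ?invr_ge0// ler_sum. Qed.

Lemma norm_average f n w : `|average f n w| <= average (fun x => `|f x|) n w.
Proof.
rewrite normrM ger0_norm ?invr_ge0// ler_wpM2l ?invr_ge0//.
exact: ler_norm_sum.
Qed.

Lemma mean0D f g : integ f -> integ g -> mean0 (f \+ g) = mean0 f + mean0 g.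
Proof. by move=> fi gi; rewrite /mean0 -RintegralD. Qed.

Lemma mean0B f g : integ f -> integ g -> mean0 (f \- g) = mean0 f - mean0 g.
Proof. by move=> fi gi; rewrite /mean0 -RintegralB. Qed.

Lemma mean0Z k f : integ f -> mean0 (k \*o f) = k * mean0 f.
Proof. by move=> fi; rewrite /mean0 -RintegralZl. Qed.

Lemma norm_mean0 f : integ f ->
  (`|mean0 f|%:E <= \int[P]_w `|f (zeta 0%N w)|%:E)%E.
Proof.
move=> fi; apply: le_trans (_ : (\int[P]_w `|f (zeta 0%N w)|)%:E <= _)%E.
  by rewrite lee_fin; exact: le_normr_Rintegral.
rewrite /Rintegral fineK// integrable_fin_num//.
exact: integrable_norm.
Qed.

Lemma ge0_le_integralT (f g : Omega -> R) :
  measurable_fun setT f -> measurable_fun setT g ->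
  (forall x, 0 <= f x) -> (forall x, f x <= g x) ->
  (\int[P]_w (f w)%:E <= \int[P]_w (g w)%:E)%E.
Proof.
move=> mf mg f0 fg; apply: ge0_le_integral => //; try exact/measurable_EFinP.
- by move=> x _; rewrite lee_fin.
- by move=> x _; rewrite lee_fin.
Qed.

(** The error for [f] is at most the average of [|f - g|], plus the error for [g], plus the
    difference of the means. By stationarity the first has expectation at most that of one term,
    whatever [n] is, so each of the three costs [e / 3]. *)
Lemma lln_approx f : measurable_fun setT f -> integ f ->
  (forall e : R, 0 < e -> exists g, [/\ measurable_fun setT g, integ g, lln g &
    (\int[P]_w `|f (zeta 0%N w) - g (zeta 0%N w)|%:E <= e%:E)%E]) ->
  lln f.
Proof.
move=> mf fi fg e e0.
have e3 : 0 < e / 3 by rewrite divr_gt0.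
have [g [mg gi lg fge]] := fg _ e3.
have [N gN] := lg _ e3; exists (maxn N 1) => n.
rewrite geq_max => /andP[Nn n0].
have mB : measurable_fun setT (f \- g) by exact: measurable_funB.
have mnB : measurable_fun setT (fun x => `|(f \- g) x|).
  exact: measurableT_comp.
have mag : measurable_fun setT (fun w => `|average g n w - mean0 g|).
  apply: measurableT_comp => //; apply: measurable_funB => //.
  exact: measurable_average.
pose c := e / 3.
apply: (@le_trans _ _ (\int[P]_w (average (fun x => `|(f \- g) x|) n w +
    (`|average g n w - mean0 g| + c))%:E)%E).
  apply: ge0_le_integralT => //.
  - apply: measurableT_comp => //; apply: measurable_funB => //.
    exact: measurable_average.
  - apply: measurable_funD; first exact: measurable_average.
    exact: measurable_funD.
  move=> w; have -> : average f n w - mean0 f = average (f \- g) n w +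
      ((average g n w - mean0 g) + - mean0 (f \- g)).
    by rewrite averageB mean0B//; ring.
  apply: (le_trans (ler_normD _ _)); apply: lerD; first exact: norm_average.
  apply: (le_trans (ler_normD _ _)); apply: lerD => //.
  rewrite normrN -lee_fin; apply: le_trans fge.
  by apply: norm_mean0; exact: (integrableB measurableT fi gi).
under eq_integral do rewrite EFinD EFinD.
have av0 h w : 0 <= average (fun x => `|h x|) n w.
  by rewrite mulr_ge0 ?invr_ge0// sumr_ge0.
rewrite ge0_integralD//; last 4 first.
- by move=> w _; rewrite lee_fin.
- by apply/measurable_EFinP; exact: measurable_average.
- by move=> w _; rewrite -EFinD lee_fin addr_ge0// ltW.
- by apply/measurable_EFinP; exact: measurable_funD.
rewrite ge0_integralD//; last 2 first.
- by apply/measurable_EFinP.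
- by move=> w _; rewrite lee_fin ltW.
rewrite integral_prob_cst.
have -> : e = e / 3 + (e / 3 + e / 3) by field.
rewrite !EFinD leeD//; last by rewrite leeD2r// gN.
by apply: le_trans fge; exact: integral_average_le.
Qed.

Lemma llnD f g : measurable_fun setT f -> measurable_fun setT g ->
  integ f -> integ g -> lln f -> lln g -> lln (f \+ g).
Proof.
move=> mf mg fi gi lf lg e e0; have e2 : 0 < e / 2 by rewrite divr_gt0.
have [N fN] := lf _ e2; have [N' gN] := lg _ e2.
exists (maxn N N') => n; rewrite geq_max => /andP[Nn N'n].
have ma h : measurable_fun setT h ->
    measurable_fun setT (fun w => `|average h n w - mean0 h|).
  move=> mh; apply: measurableT_comp => //; apply: measurable_funB => //.
  exact: measurable_average.
apply: (@le_trans _ _ (\int[P]_w (`|average f n w - mean0 f| +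
   `|average g n w - mean0 g|)%:E)%E).
  apply: ge0_le_integralT => //.
  - by apply: ma; exact: measurable_funD.
  - by apply: measurable_funD; exact: ma.
  move=> w; rewrite averageD mean0D// opprD addrACA.
  exact: ler_normD.
under eq_integral do rewrite EFinD.
rewrite ge0_integralD//; try by apply/measurable_EFinP; exact: ma.
have -> : e%:E = ((e / 2)%:E + (e / 2)%:E)%E by rewrite -EFinD -splitr.
by apply: leeD; [exact: fN|exact: gN].
Qed.

Lemma llnZ k f : measurable_fun setT f -> integ f -> lln f -> lln (k \*o f).
Proof.
move=> mf fi lf e e0; have e2 : 0 < e / (`|k| + 1).
  by rewrite divr_gt0// ltr_wpDl.
have [N fN] := lf _ e2; exists N => n Nn.
under eq_integral.
  move=> w _; rewrite averageZ mean0Z// -mulrBr normrM EFinM; over.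
rewrite ge0_integralZl//; last first.
  apply/measurable_EFinP; apply: measurableT_comp => //.
  by apply: measurable_funB => //; exact: measurable_average.
apply: le_trans (_ : `|k|%:E * (e / (`|k| + 1))%:E <= _)%E.
  by rewrite lee_wpmul2l ?lee_fin// fN.
rewrite -EFinM lee_fin mulrCA -[leRHS]mulr1 ler_wpM2l ?(ltW e0)//.
by rewrite ler_pdivrMr ?mul1r ?lerDl// ltr_wpDl.
Qed.

Lemma lln_cst c : lln (fun=> c).
Proof.
move=> e e0; exists 1%N => n n0; rewrite average_cst//.
rewrite /mean0 Rintegral_cst//= probability_setT/= mulr1 subrr normr0.
by rewrite integral0 lee_fin ltW.
Qed.

Lemma lln_sum (I : Type) (f : I -> U -> R) (s : seq I) :
  (forall i, measurable_fun setT (f i)) ->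
  (forall i, integ (f i)) -> (forall i, lln (f i)) ->
  [/\ measurable_fun setT (fun x => \sum_(i <- s) f i x),
   integ (fun x => \sum_(i <- s) f i x) & lln (fun x => \sum_(i <- s) f i x)].
Proof.
move=> mf fi lf; elim: s => [|i s [IHm IHi IHl]].
  have -> : (fun x => \sum_(i <- [::]) f i x) = (fun=> 0).
    by apply/funext => x; rewrite big_nil.
  split => //; last exact: lln_cst.
  exact: finite_measure_integrable_cst.
have -> : (fun x => \sum_(j <- i :: s) f j x) = f i \+ (fun x => \sum_(j <- s) f j x).
  by apply/funext => x; rewrite big_cons.
split; first exact: measurable_funD.
  by have := integrableD measurableT (fi i) IHi.
exact: (llnD (mf i) IHm (fi i) IHi (lf i) IHl).
Qed.

Lemma integ_indic C : measurable C -> integ (\1_C : U -> R).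
Proof.
move=> mC; have -> : (\1_C : U -> R) \o zeta 0%N = \1_(zeta 0%N @^-1` C).
  by [].
apply: integrable_indic => //; rewrite -[X in measurable X]setTI; exact: mzeta.
Qed.

Lemma lln_indic (G : set (set U)) : @measurable _ U = <<s G >> ->
  setI_closed G -> (forall C, G C -> lln \1_C) ->
  forall C, measurable C -> lln \1_C.
Proof.
move=> GE GI lG C mC.
have sC : <<s G >> C by rewrite -GE.
refine (@dynkin_induction _ U G (fun C => lln \1_C) GE GI _ lG _ _ C sC).
- by rewrite indicT; exact: lln_cst.
- move=> S mS lS; have -> : \1_(~` S) = (fun=> 1) \+ ((-1) \*o \1_S) :> (U -> R).
    apply/funext => x; rewrite /= !indicE in_setC.
    by case: (x \in S); rewrite /= ?mulr1 ?mulr0 ?addr0 ?subrr.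
  have iS := integ_indic mS.
  have mS1 : measurable_fun setT ((-1) \*o \1_S : U -> R).
    by apply: measurable_funM.
  have iS1 : integ ((-1) \*o \1_S : U -> R).
    exact: (integrableZl measurableT (-1) iS).
  have i1 : integ (fun=> 1 : R) by exact: finite_measure_integrable_cst.
  by apply: (llnD _ mS1 i1 iS1 (lln_cst 1) (llnZ _ _ iS lS)).
move=> F mF tF lF.
have mU : measurable (\bigcup_k F k) by exact: bigcupT_measurable.
apply: lln_approx => //; first exact: integ_indic.
move=> e e0.
have H n : [/\ measurable_fun setT (fun x => \sum_(i < n) (\1_(F i) x : R)),
   integ (fun x => \sum_(i < n) (\1_(F i) x : R)) & lln (fun x => \sum_(i < n) \1_(F i) x)].
  have mI i : measurable_fun setT (\1_(F i) : U -> R) by exact: measurable_indic.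
  exact: (lln_sum (index_enum 'I_n) (fun i : 'I_n => mI i)
    (fun i => integ_indic (mF i)) (fun i => lF i)).
have sumE n x : \sum_(i < n) (\1_(F i) x) = \1_(\big[setU/set0]_(i < n) F i) x :> R.
  elim: n => [|n IH]; first by rewrite !big_ord0 indic0.
  rewrite !big_ord_recr/= IH !indicE.
  have [xF|xF] := boolP (x \in F n); last by rewrite in_setU (negbTE xF) orbF addr0.
  rewrite in_setU xF orbT [_ \in _](_ : _ = false) ?add0r//.
  apply/negP; rewrite !inE in xF * => xU.
  move: xU; rewrite -bigcup_mkord => -[k /= kn xk].
  have := tF k n I I; rewrite -/(nonempty _) => /(_ (ex_intro _ x (conj xk xF))).
  by move=> kn'; move: kn; rewrite kn' ltnn.
have : forall n, [/\ measurable_fun setT (\1_(\big[setU/set0]_(i < n) F i) : U -> R),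
   integ (\1_(\big[setU/set0]_(i < n) F i) : U -> R) & lln \1_(\big[setU/set0]_(i < n) F i)].
  move=> n; have := H n; have -> : (fun x => \sum_(i < n) (\1_(F i) x)) =
    \1_(\big[setU/set0]_(i < n) F i) :> (U -> R) by apply/funext => x; exact: sumE.
  by apply.
move=> {}H.
(* The part of the union missed by the first [n] sets; these remainders decrease to the empty set,
   so their probability under the law of [zeta 0] tends to 0. *)
pose D n := \bigcup_k F k `\` \big[setU/set0]_(i < n) F i.
have mD n : measurable (zeta 0%N @^-1` D n).
  rewrite -[X in measurable X]setTI; apply: mzeta => //.
  by apply: measurableD => //; exact: bigsetU_measurable.
have : (fun n => P (zeta 0%N @^-1` D n)) @ \oo --> P (\bigcap_n (zeta 0%N @^-1` D n)).
  apply: nonincreasing_cvg_mu => //.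
  - by rewrite (le_lt_trans (probability_le1 _ _)) ?ltry.
  - exact: bigcapT_measurable.
  - move=> m n mn; apply/subsetPset => w /= [Uw Dw]; split => // Dw'; apply: Dw.
    by move: Dw'; rewrite -!bigcup_mkord => -[k /= km Fk]; exists k => //=; exact: leq_trans km mn.
have -> : \bigcap_n (zeta 0%N @^-1` D n) = set0.
  apply/seteqP; split => // w wD.
  have [[k _ Fk] _] := wD 0%N I.
  have [_] := wD k.+1 I; apply; rewrite -bigcup_mkord; exists k => //=.
rewrite measure0 => /fine_cvgP[_ /cvgrPdist_le /(_ e e0)[N _ /(_ N (leqnn N))]] /=.
rewrite sub0r normrN ger0_norm ?fine_ge0// => DN.
exists \1_(\big[setU/set0]_(i < N) F i); have [? ? ?] := H N; split => //.
rewrite [leLHS](_ : _ = \int[P]_w (\1_(zeta 0%N @^-1` D N) w)%:E)%E.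
  rewrite integral_indic// setIT.
  by rewrite -[leLHS]fineK ?lee_fin// fin_num_measure.
apply: eq_integral => w _; congr EFin; rewrite !indicE /D.
have [|] := boolP (_ \in \big[setU/set0]_(i < N) F i) => wU.
  rewrite mem_set; last first.
    by move: wU; rewrite inE -bigcup_mkord => -[k _ Fk]; exists k.
  rewrite memNset ?subrr ?normr0// => -[_] /=; apply; exact/set_mem.
have [|] := boolP (_ \in \bigcup_k F k) => wUU.
  rewrite mem_set ?subr0 ?normr1//; split; first exact/set_mem.
  by move/mem_set; exact/negP.
rewrite memNset ?subrr ?normr0//= => -[+ _] => /mem_set; exact/negP.
Qed.

Import HBSimple.

(** Simple functions are finite combinations of indicators and are dense in L^1 of the law of
    [zeta 0]. *)
Lemma lln_integrable (G : set (set U)) : @measurable _ U = <<s G >> ->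
  setI_closed G -> (forall C, G C -> lln \1_C) ->
  forall f, measurable_fun setT f -> integ f -> lln f.
Proof.
move=> GE GI lG f mf fi; have lC := lln_indic GE GI lG.
apply: lln_approx => // e e0.
pose Q := law P (mzeta 0%N).
have fQ : Q.-integrable setT (EFin \o f).
  by apply: integrable_law => //; exact/measurable_EFinP.
have [g [gf gi cg]] := approximation_sfun_integrable measurableT fQ.
move: cg => /fine_cvgP[[N1 _ gN1] /cvgrPdist_le /(_ e e0)[N2 _ gN2]].
pose n := maxn N1 N2; exists (g n).
have [s gE] : exists s : seq R, forall x,
    g n x = \sum_(r <- s) r * \1_(g n @^-1` [set r]) x.
  by eexists => x; rewrite [LHS]fimfunE fsbig_finite//=.
have mr r : measurable (g n @^-1` [set r]) by [].
have : [/\ measurable_fun setT (g n), integ (g n) & lln (g n)].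
  have -> : (g n : U -> R) = (fun x => \sum_(r <- s) r * \1_(g n @^-1` [set r]) x) by apply/funext => x; exact: gE.
  apply: lln_sum => r.
  - exact: measurable_funM.
  - by have := integrableZl measurableT r (integ_indic (mr r)).
  - apply: llnZ => //; [exact: integ_indic|exact: lC].
move=> [? ? ?]; split => //.
have := gN2 n (leq_maxr _ _); rewrite /= sub0r normrN => gn.
have := gN1 n (leq_maxl _ _) => /= gfin.
rewrite [leLHS](_ : _ = \int[Q]_z `|(f z)%:E - (g n z)%:E|)%E; last first.
  rewrite ge0_integral_law//.
  by apply/measurable_EFinP; apply: measurableT_comp => //; exact: measurable_funB.
by rewrite -[leLHS]fineK// lee_fin (le_trans (ler_norm _)).
Qed.

(** Markov's inequality: an L^1 error of at most [e * k] leaves probability at most [k] to the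
    deviations larger than [e]. *)
Lemma lln_wp f (e : R) : measurable_fun setT f -> lln f -> 0 < e ->
  wp_to_one P (fun n => [set w | `|average f n w - mean0 f| <= e]).
Proof.
move=> mf lf e0; pose X n w : R := `|average f n w - mean0 f|.
have mX n : measurable_fun setT (X n).
  apply: measurableT_comp => //; apply: measurable_funB => //.
  exact: measurable_average.
pose G n := [set w | X n w <= e].
have mG n : measurable (G n).
  rewrite -[X in measurable X]setTI.
  exact: (measurable_fun_le measurableT (mX n) (measurable_cst e)).
apply/wp_to_oneP; exists G; split => //.
  by exists 0%N => n _; apply: aeW.
move=> k k0; have [N lN] := lf _ (mulr_gt0 e0 k0); exists N => n Nn.
have := lN n Nn; rewrite EFinM => H.
rewrite -(@lee_pmul2l _ e%:E)//; apply: le_trans H.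
have mC := measurableC (mG n).
have -> : (P (~` G n) = \int[P]_w (\1_(~` G n) w)%:E)%E.
  by rewrite integral_indic// setIT.
rewrite -ge0_integralZl//; last 2 first.
- by apply/measurable_EFinP; exact: measurable_indic.
- by rewrite lee_fin ltW.
apply: ge0_le_integralT => //.
- by apply: measurable_funM => //; exact: measurable_indic.
- exact: mX.
- by move=> w; rewrite mulr_ge0// ltW.
move=> w; rewrite indicE; have [|_] := boolP (w \in _); last by rewrite mulr0.
by rewrite inE/= mulr1 => /negP; rewrite -ltNge => /ltW.
Qed.

End lln.

(** * Law of large numbers from asymptotically vanishing covariances *)

Section lln_covariance.
Context (R : realType) (d : measure_display) (Omega : measurableType d).
Variable P : probability Omega R.
Context (dU : measure_display) (U : measurableType dU).
Variable zeta : nat -> Omega -> U.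
Hypothesis mzeta : forall i, measurable_fun setT (zeta i).
Hypothesis zetaE : forall i C, measurable C ->
  P (zeta i @^-1` C) = P (zeta 0%N @^-1` C).

(** The indices counted lie in the window of length 2K + 1 that starts at [i - K]; for [i < K] the
    truncated subtraction starts it at 0 and it still reaches [i + K]. *)
Let count_near n K i :
  (\sum_(j < n) ((i <= j + K) && (j <= i + K)) <= (K + K).+1)%N.
Proof.
rewrite -(big_mkord xpredT (fun j => nat_of_bool ((i <= j + K) && (j <= i + K))%N)).
pose Q j := ((i <= j + K) && (j <= i + K))%N.
have -> : (\sum_(0 <= j < n) (Q j : nat) = count Q (iota 0 n))%N.
  rewrite -sum1_count [RHS]big_mkcond /index_iota subn0.
  by apply: eq_bigr => j _; case: (Q j).
rewrite -size_filter -[leqRHS](size_iota (i - K)).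
apply: uniq_leq_size; first by rewrite filter_uniq// iota_uniq.
move=> j; rewrite mem_filter /Q => /andP[/andP[h1 h2] _].
by rewrite mem_iota; apply/andP; lia.
Qed.

(** Second moment of the centred average: pairs of indices at distance more than [K] contribute at
    most [e ^+ 2 / 2] each, and the at most [n * (2K + 1)] others at most 1 more each. After
    division by [n ^+ 2] this is [e ^+ 2 / 2 + c / n], at most [e ^+ 2] for large [n]. The
    hypothesis speaks of [i < j] only; symmetry of the covariance covers the rest. *)
Lemma lln_of_cov (C : set U) : measurable C ->
  (forall e : R, 0 < e -> exists K, forall i j, (i + K < j)%N ->
    `|fine (P (zeta i @^-1` C `&` zeta j @^-1` C)) -
      fine (P (zeta 0%N @^-1` C)) ^+ 2| <= e) ->
  lln P zeta \1_C.
Proof.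
move=> mC cov; set Q := fine (P (zeta 0%N @^-1` C)).
have mzC i : measurable (zeta i @^-1` C).
  by rewrite -[X in measurable X]setTI; exact: mzeta.
have Q0 : 0 <= Q by rewrite fine_ge0.
have Q1 : Q <= 1.
  by rewrite -lee_fin fineK ?fin_num_measure//; exact: probability_le1.
pose x i (w : Omega) : R := \1_C (zeta i w) - Q.
have x1 i w : `|x i w| <= 1.
  rewrite /x indicE ler_norml; case: (_ \in C); rewrite ?mulr1n ?mulr0n; apply/andP; split; lra.
have mx i : measurable_fun setT (x i).
  apply: measurable_funB => //.
  exact: (measurableT_comp (measurable_indic mC) (mzeta i)).
have bint (f : Omega -> R) (c : R) : measurable_fun setT f ->
    (forall w, `|f w| <= c) -> P.-integrable setT (EFin \o f).
  move=> mf fc; apply: (@measurable_bounded_integrable _ _ _ P) => //.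
    by rewrite (le_lt_trans (probability_le1 P measurableT))// ltry.
  exists c; split; first exact: num_real.
  by move=> y cy w _ /=; exact: le_trans (fc w) (ltW cy).
have xij1 i j w : `|x i w * x j w| <= 1.
  by rewrite normrM mulr_ile1.
have mxx i j : measurable_fun setT (fun w => x i w * x j w).
  exact: measurable_funM.
have ixx i j := bint _ _ (mxx i j) (xij1 i j).
pose V i j : R := \int[P]_w (x i w * x j w).
have ind i : measurable_fun setT (\1_(zeta i @^-1` C) : Omega -> R).
  exact: measurable_indic.
have VE i j : V i j = fine (P (zeta i @^-1` C `&` zeta j @^-1` C)) - Q ^+ 2.
  rewrite /V; have -> : (fun w => x i w * x j w) = (fun w =>
     (\1_(zeta i @^-1` C `&` zeta j @^-1` C) w - Q * \1_(zeta i @^-1` C) w)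
      - (Q * \1_(zeta j @^-1` C) w - Q ^+ 2)).
    apply/funext => w; rewrite indicI /= /x.
    have e k : \1_C (zeta k w) = \1_(zeta k @^-1` C) w :> R by [].
    by rewrite !e expr2; ring.
  have i1 A : measurable A -> P.-integrable setT (EFin \o (\1_A : Omega -> R)).
    by move=> mA; exact: integrable_indic.
  have iQ A : measurable A -> P.-integrable setT (EFin \o (fun w => Q * \1_A w)).
    by move=> mA; exact: (integrableZl measurableT Q (i1 A mA)).
  have ic : P.-integrable setT (EFin \o (fun _ : Omega => Q ^+ 2)).
    exact: finite_measure_integrable_cst.
  have mI : measurable (zeta i @^-1` C `&` zeta j @^-1` C) by exact: measurableI.
  have eI A : measurable A -> \int[P]_w \1_A w = fine (P A).
    by move=> mA; rewrite /Rintegral integral_indic// setIT.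
  have PE k : fine (P (zeta k @^-1` C)) = Q by rewrite zetaE.
  rewrite RintegralB//; last 2 first.
  - exact: (integrableB measurableT (i1 _ mI) (iQ _ (mzC i))).
  - exact: (integrableB measurableT (iQ _ (mzC j)) ic).
  rewrite [X in X - _]RintegralB//; [|exact: i1|exact: iQ].
  rewrite [X in _ - X]RintegralB//; last exact: iQ.
  rewrite (RintegralZl Q measurableT (i1 _ (mzC i))).
  rewrite (RintegralZl Q measurableT (i1 _ (mzC j))) !eI//.
  rewrite Rintegral_cst//= probability_setT/= !PE; ring.
have V1 i j : `|V i j| <= 1.
  apply: le_trans (le_normr_Rintegral _ (ixx i j)) _ => //.
  apply: (@le_trans _ _ (\int[P]_w (1 : R))).
    by apply: le_Rintegral => //; [exact: (integrable_norm (ixx i j))|exact: finite_measure_integrable_cst].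
  by rewrite Rintegral_cst//= probability_setT mulr1.
have Vsym i j : V i j = V j i by rewrite !VE setIC.
have m0 : mean0 P zeta \1_C = Q.
  transitivity (\int[P]_w (\1_(zeta 0%N @^-1` C) w : R)) => //.
  by rewrite /Rintegral integral_indic// setIT.
move=> e e0; have ee0 : 0 < e ^+ 2 / 2 by rewrite divr_gt0// exprn_gt0.
have [K HK] := cov _ ee0.
pose c : R := ((K + K).+1)%:R.
exists (Num.truncn (c / (e ^+ 2 / 2))).+1 => n Nn.
have n0 : (0 : R) < n%:R by rewrite ltr0n (leq_trans _ Nn).
have cn : c / n%:R <= e ^+ 2 / 2.
  rewrite ler_pdivrMr// mulrC -ler_pdivrMr//.
  by apply: le_trans (ltW (truncnS_gt _)) _; rewrite ler_nat.
pose a w := average zeta (\1_C : U -> R) n w - Q.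
have aE w : a w = n%:R^-1 * \sum_(i < n) x i w.
  rewrite /a /average /x sumrB sumr_const card_ord mulrBr.
  by rewrite -[Q *+ n]mulr_natl mulKf ?gt_eqF.
have ma : measurable_fun setT a.
  by apply: measurable_funB => //; apply: measurable_average.
have a2E w : a w ^+ 2 = \sum_(i < n) \sum_(j < n) (n%:R^-1 ^+ 2 * (x i w * x j w)).
  rewrite aE exprMn expr2 [X in _ * X]expr2 big_distrlr/= mulr_sumr.
  by apply: eq_bigr => i _; rewrite mulr_sumr.
have int_a2 : \int[P]_w (a w ^+ 2) = n%:R^-1 ^+ 2 * \sum_(i < n) \sum_(j < n) V i j.
  have isum (I : Type) (s : seq I) (f : I -> Omega -> R) :
      (forall i, P.-integrable setT (EFin \o f i)) ->
      P.-integrable setT (EFin \o (fun w => \sum_(i <- s) f i w)) /\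
      \int[P]_w \sum_(i <- s) f i w = \sum_(i <- s) \int[P]_w f i w.
    move=> fi; elim: s => [|i s [IH1 IH2]].
      have -> : (fun w => \sum_(i <- [::]) f i w) = (fun=> 0).
        by apply/funext => w; rewrite big_nil.
      split; first exact: finite_measure_integrable_cst.
      by rewrite big_nil Rintegral_cst//= mul0r.
    have -> : (fun w => \sum_(j <- i :: s) f j w) = (fun w => f i w + \sum_(j <- s) f j w).
      by apply/funext => w; rewrite big_cons.
    split; first exact: (integrableD measurableT (fi i) IH1).
    by rewrite RintegralD// IH2 big_cons.
  have iz i j : P.-integrable setT (EFin \o (fun w => n%:R^-1 ^+ 2 * (x i w * x j w))).
    exact: (integrableZl measurableT _ (ixx i j)).
  under eq_Rintegral do rewrite a2E.
  have [_ ->] := isum _ (index_enum 'I_n) (fun i w => \sum_(j < n) (n%:R^-1 ^+ 2 * (x i w * x j w)))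
    (fun i => (isum _ (index_enum 'I_n) _ (fun j => iz i j)).1).
  rewrite mulr_sumr; apply: eq_bigr => i _.
  have [_ ->] := isum _ (index_enum 'I_n) _ (fun j : 'I_n => iz i j).
  rewrite mulr_sumr; apply: eq_bigr => j _.
  by rewrite RintegralZl.
have Vle i j : V i j <= e ^+ 2 / 2 + ((i <= j + K) && (j <= i + K))%N%:R.
  case: (leqP i (j + K)) => ij /=; last first.
    by rewrite addr0 Vsym VE (le_trans (ler_norm _))// HK.
  case: (leqP j (i + K)) => ji /=; last first.
    by rewrite addr0 VE (le_trans (ler_norm _))// HK.
  by rewrite (le_trans (ler_norm _))// (le_trans (V1 i j))// lerDr ltW.
have int_le : \int[P]_w (a w ^+ 2) <= e ^+ 2.
  rewrite int_a2.
  have : \sum_(i < n) \sum_(j < n) V i j <= n%:R * (n%:R * (e ^+ 2 / 2) + c).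
    apply: (@le_trans _ _ (\sum_(i < n) (n%:R * (e ^+ 2 / 2) + c))).
      apply: ler_sum => i _.
      apply: (@le_trans _ _ (\sum_(j < n) (e ^+ 2 / 2 + ((i <= j + K) && (j <= i + K))%N%:R))).
        by apply: ler_sum => j _; exact: Vle.
      rewrite big_split/= sumr_const card_ord -[_ *+ n]mulr_natl lerD2l.
      by rewrite -natr_sum ler_nat count_near.
    by rewrite sumr_const card_ord -[_ *+ n]mulr_natl.
  move=> H; apply: (@le_trans _ _ (n%:R^-1 ^+ 2 * (n%:R * (n%:R * (e ^+ 2 / 2) + c)))).
    by rewrite ler_wpM2l// sqr_ge0.
  have -> : n%:R^-1 ^+ 2 * (n%:R * (n%:R * (e ^+ 2 / 2) + c)) = e ^+ 2 / 2 + c / n%:R.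
    by field; rewrite gt_eqF.
  by rewrite [leRHS]splitr lerD2l.
have a1 w : `|a w| <= 1.
  rewrite aE normrM ger0_norm ?invr_ge0// mulrC ler_pdivrMr// mul1r.
  apply: (le_trans (ler_norm_sum _ _ _)).
  apply: (@le_trans _ _ (\sum_(i < n) (1 : R))); first by apply: ler_sum => i _.
  by rewrite sumr_const card_ord.
have ia2 : P.-integrable setT (EFin \o (fun w => a w ^+ 2)).
  apply: (bint _ 1); first exact: measurable_funX.
  by move=> w; rewrite normrX expr_le1.
have ia : P.-integrable setT (EFin \o (fun w => `|a w|)).
  apply: (bint _ 1); first exact: measurableT_comp.
  by move=> w; rewrite normr_id.
rewrite m0 -/(a _).
rewrite [leLHS](_ : _ = (\int[P]_w `|a w|)%:E); last first.
  by rewrite /Rintegral fineK//; exact: integrable_fin_num ia.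
rewrite lee_fin.
have ic : P.-integrable setT (EFin \o (fun _ : Omega => e / 2)).
  exact: finite_measure_integrable_cst.
have iz : P.-integrable setT (EFin \o (fun w => (2 * e)^-1 * a w ^+ 2)).
  exact: (integrableZl measurableT _ ia2).
(* Young's inequality [|a| <= a ^+ 2 / (2 * e) + e / 2] turns the bound [e ^+ 2] on the second
   moment into the bound [e] in L^1. *)
apply: (@le_trans _ _ (\int[P]_w ((2 * e)^-1 * a w ^+ 2 + e / 2))).
  apply: le_Rintegral => //.
    exact: (integrableD measurableT iz ic).
  move=> w _; rewrite -(real_normK (num_real (a w))) -subr_ge0.
  rewrite (_ : _ - _ = (2 * e)^-1 * (`|a w| - e) ^+ 2).
    by rewrite mulr_ge0 ?sqr_ge0// invr_ge0 mulr_ge0// ltW.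
  by field; exact: lt0r_neq0.
rewrite (RintegralD measurableT iz ic) (RintegralZl _ measurableT ia2) Rintegral_cst//= probability_setT/= mulr1.
have : (2 * e)^-1 * (\int[P]_x a x ^+ 2) <= (2 * e)^-1 * e ^+ 2.
  by rewrite ler_wpM2l// invr_ge0 mulr_ge0// ltW.
have -> : (2 * e)^-1 * e ^+ 2 = e / 2 by field; exact: lt0r_neq0.
by move=> H; rewrite [leRHS]splitr lerD2r.
Qed.

End lln_covariance.

(** * The diffusion in the eigenfunction basis *)

Section restriction.
Context d (T : measurableType d) (R : realType).
Variables (mu : {measure set T -> \bar R}) (H : set T) (mH : measurable H).

Let ge0_integral_mrestr (g : T -> \bar R) : measurable_fun setT g ->
  (forall x, 0 <= g x)%E ->
  (\int[mrestr mu mH]_x g x = \int[mu]_(x in H) g x)%E.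
Proof.
move=> mg g0; rewrite (@integral_density _ _ _ mu _ \1_H)//.
- rewrite [RHS]integral_mkcond; apply: eq_integral => x _.
  rewrite patchE indicE; case: ifPn => _; first by rewrite mul1e.
  by rewrite mul0e.
- move=> A mA; rewrite /mrestr integral_indic// setIC//.
Qed.

Lemma integral_mrestr (g : T -> \bar R) : measurable_fun setT g ->
  (\int[mrestr mu mH]_x g x = \int[mu]_(x in H) g x)%E.
Proof.
move=> mg; rewrite [LHS]integralE [RHS]integralE; congr (_ - _)%E.
  by apply: ge0_integral_mrestr => //; exact: measurable_funepos.
by apply: ge0_integral_mrestr => //; exact: measurable_funeneg.
Qed.

Lemma integrable_mrestr (g : T -> \bar R) : measurable_fun setT g ->
  mu.-integrable H g -> (mrestr mu mH).-integrable setT g.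
Proof.
move=> mg /integrableP[_ gi]; apply/integrableP; split => //.
by rewrite integral_mrestr//; exact: measurableT_comp.
Qed.

End restriction.

Section process.
Context (R : realType) (d : measure_display) (Omega : measurableType d).
Variable P : probability Omega R.

Lemma sigma_of_measurable (Z : R -> Omega -> R) (I : set R) (A : set Omega) :
  (forall t, I t -> measurable_fun setT (Z t)) -> sigma_of Z I A ->
  measurable A.
Proof.
move=> mZ; apply: smallest_sub; first exact: sigma_algebra_measurable.
move=> _ [u [B [Iu mB ->]]]; rewrite -[X in measurable X]setTI.
exact: mZ.
Qed.

Lemma sigma_ofT (Z : R -> Omega -> R) (I : set R) : sigma_of Z I setT.
Proof.
by have [_ /(_ set0)] := smallest_sigma_algebra setT
  [set A | exists u B, [/\ I u, measurable B & A = Z u @^-1` B]];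
  rewrite setD0 => + _; apply; case: (smallest_sigma_algebra setT
  [set A | exists u B, [/\ I u, measurable B & A = Z u @^-1` B]]).
Qed.

Lemma sigma_of_preimage (Z : R -> Omega -> R) (I : set R) u B :
  I u -> measurable B -> sigma_of Z I (Z u @^-1` B).
Proof. by move=> Iu mB; apply: sub_sigma_algebra; exists u, B. Qed.

Lemma sigma_ofI (Z : R -> Omega -> R) (I : set R) A B :
  sigma_of Z I A -> sigma_of Z I B -> sigma_of Z I (A `&` B).
Proof.
move=> sA sB.
exact: (@measurableI _ (g_sigma_algebraType [set A | exists u B,
  [/\ I u, measurable B & A = Z u @^-1` B]]) A B sA sB).
Qed.

(** By hypothesis the image under [Z2] of [P] restricted to [H] is the mixture of the measures
    [k (Z1 w)] over [w] in [H]. The spaces are abstract so that the same statement serves the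
    diffusion and the subordinated process. *)
Lemma markov_signed d1 d2 (V : measurableType d1) (U : measurableType d2)
    (Z1 : Omega -> V) (Z2 : Omega -> U) (H : set Omega)
    (k : V -> {measure set U -> \bar R}) (f : U -> R) :
  measurable H -> measurable_fun setT Z1 -> measurable_fun setT Z2 ->
  (forall B, measurable B -> measurable_fun setT (k ^~ B)) ->
  (forall B, measurable B ->
     P (H `&` Z2 @^-1` B) = (\int[P]_(w in H) k (Z1 w) B)%E) ->
  measurable_fun setT f -> P.-integrable H (EFin \o (f \o Z2)) ->
  P.-integrable H (fun w => (\int[k (Z1 w)]_y f y)%:E) /\
  (\int[P]_(w in H) (f (Z2 w))%:E =
   \int[P]_(w in H) (\int[k (Z1 w)]_y f y)%:E)%E.
Proof.
move=> mH m1 m2 mk kE mf fi.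
have mf2 : measurable_fun setT (EFin \o (f \o Z2)).
  by apply/measurable_EFinP; exact: measurableT_comp.
pose nu := law (mrestr P mH) m2.
have mk1 A : measurable A -> measurable_fun H (fun w => k (Z1 w) A).
  by move=> mA; apply: measurable_funTS; apply: measurableT_comp (mk A mA) m1.
have nuE A : measurable A -> nu A = (\int[P]_(w in H) k (Z1 w) A)%E.
  by move=> mA; rewrite -kE// /nu/= /law/= /pushforward/= /mrestr setIC.
have mEf : measurable_fun setT (EFin \o f) by exact/measurable_EFinP.
have fnu : nu.-integrable setT (EFin \o f).
  by apply: integrable_law => //; exact: integrable_mrestr.
have [_ _ ki] := integral_mixture_signed mH mk1 nuE mf fnu.
rewrite integral_law//; last exact: integrable_mrestr.
by rewrite integral_mrestr.
Qed.

End process.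

Section open_interval.
Context (R : realType) (l r : \bar R).

Lemma measurable_oitv : measurable (oitv l r).
Proof.
rewrite (_ : oitv l r = [set x : R | (l < x%:E)%E] `&` [set x : R | (x%:E < r)%E]).
  apply: measurableI; rewrite -[X in measurable X]setTI.
    by apply: emeasurable_fun_o_infty => //; exact/measurable_EFinP.
  by apply: emeasurable_fun_infty_o => //; exact/measurable_EFinP.
by apply/seteqP; split => x /=; [move/andP|move=> [? ?]; apply/andP].
Qed.

End open_interval.

(** From [1 - y <= expR (- y)] follows [expR y <= (1 - y)^-1], and
    [(1 - y)^-1 - 1 - y = y ^+ 2 / (1 - y)] is at most [y ^+ 2] when [y <= 0]. *)
Lemma expR_near0_le (R : realType) (y : R) : y <= 0 ->
  `|expR y - 1 - y| <= y ^+ 2.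
Proof.
move=> y0; have h1 := expR_ge1Dx y; have h2 := expR_ge1Dx (- y).
rewrite ger0_norm; last by lra.
have ey := expR_gt0 y.
have : expR y * (1 - y) <= 1.
  by rewrite -[leRHS](expRxMexpNx_1 y) ler_wpM2l// ltW.
move=> h3; have [->|yn0] := eqVneq y 0; first by rewrite expR0; lra.
have y1 : 0 < 1 - y by lra.
have : expR y <= (1 - y)^-1 by rewrite -[leRHS]mul1r ler_pdivlMr.
move=> h4; have : (1 - y)^-1 - 1 - y <= y ^+ 2.
  rewrite -(ler_pM2r y1) !mulrBl mulVf ?gt_eqF// mul1r expr2; nra.
lra.
Qed.

(* One-step errors o(h), uniform in s, telescope: a is not assumed
   differentiable. *)
Lemma exponential_evolution (R : realType) (a : R -> R) (lam : R) :
  lam <= 0 ->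
  (forall e : R, 0 < e -> exists2 del : R, 0 < del &
    forall h s : R, 0 < h -> h < del -> 0 <= s ->
      `|a (s + h) - expR (lam * h) * a s| <= e * h) ->
  forall s : R, 0 <= s -> a s = expR (lam * s) * a 0.
Proof.
move=> lam0 step s s0; apply/eqP; rewrite -subr_eq0 -normr_le0.
apply/ler_addgt0Pl => e e0; rewrite addr0.
move: s0; rewrite le_eqVlt => /predU1P[<-|s0].
  by rewrite mulr0 expR0 mul1r subrr normr0 ltW.
(* An error of [e / s] per unit of time accumulates to [e] over the whole interval; earlier errors
   are not amplified because [expR (lam * h) <= 1]. *)
have [del del0 H] := step (e / s) (divr_gt0 e0 s0).
have [n ns] : exists n : nat, s / del < n.+1%:R.
  by exists (Num.truncn (s / del)); exact: truncnS_gt.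
pose h := s / n.+1%:R.
have h0 : 0 < h by rewrite divr_gt0.
have hd : h < del by rewrite /h ltr_pdivrMr// mulrC -ltr_pdivrMr.
have main k : `|a (h * k%:R) - expR (lam * (h * k%:R)) * a 0| <= e / s * h * k%:R.
  elim: k => [|k IH].
    by rewrite !mulr0 expR0 mul1r subrr normr0.
  have hk : 0 <= h * k%:R by rewrite mulr_ge0// ltW.
  have -> : h * k.+1%:R = h * k%:R + h by rewrite -natr1; ring.
  have -> : a (h * k%:R + h) - expR (lam * (h * k%:R + h)) * a 0 =
     (a (h * k%:R + h) - expR (lam * h) * a (h * k%:R)) +
     expR (lam * h) * (a (h * k%:R) - expR (lam * (h * k%:R)) * a 0).
    by rewrite mulrDr expRD; ring.
  apply: (le_trans (ler_normD _ _)).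
  have -> : e / s * h * k.+1%:R = e / s * h + e / s * h * k%:R.
    by rewrite -[k.+1%:R]natr1; ring.
  rewrite lerD//; first exact: H.
  rewrite normrM gtr0_norm ?expR_gt0//; apply: le_trans IH.
  rewrite ler_piMl// expR_le1 ?mulr_le0_ge0//; exact: ltW.
have := main n.+1; have -> : h * n.+1%:R = s by rewrite /h mulfVK.
by rewrite -mulrA -/h (_ : h * n.+1%:R = s) ?mulfVK ?gt_eqF//; rewrite /h mulfVK.
Qed.

Lemma law_density_integral (R : realType) (d : measure_display)
    (Omega : measurableType d) (P : probability Omega R) (Z : Omega -> R)
    (J : set R) (q : R -> R) :
  measurable J -> measurable_fun setT Z -> law_density P Z J q ->
  (forall x, J x -> 0 <= q x) -> measurable_fun J q ->
  forall g : R -> \bar R, (forall x, 0 <= g x)%E -> measurable_fun setT g ->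
  (\int[P]_w g (Z w) = \int[@lebesgue_measure R]_(x in J) ((q x)%:E * g x))%E.
Proof.
move=> mJ mZ lZ q0 mq g g0 mg.
have mZ' : measurable_fun setT (Z : Omega -> measurableTypeR R) by exact: mZ.
have mg' : measurable_fun setT (g : measurableTypeR R -> \bar R) by exact: mg.
rewrite -(ge0_integral_plaw P mZ')//.
rewrite (@integral_density _ (measurableTypeR R) R (@lebesgue_measure R)
  (plaw P mZ') (q \_ J))//.
- rewrite [RHS]integral_mkcond; apply: eq_integral => x _.
  by rewrite !patchE; case: ifPn => // _; rewrite mul0e.
- by move=> x; rewrite patchE; case: ifPn => // /set_mem; exact: q0.
- exact/(measurable_restrictT _ mJ).
- move=> A mA; transitivity (P (Z @^-1` A)) => //.
  rewrite lZ// [RHS]integral_mkcond [LHS]integral_mkcond.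
  apply: eq_integral => x _; rewrite !patchE in_setI.
  by case: (x \in J); case: (x \in A).
Qed.

Section diffusion_eigenfunctions.
Context (R : realType) (l r : \bar R) (S : set R).
Context (d : measure_display) (Omega : measurableType d).
Variables (P : probability Omega R) (D : diffusion R) (X : R -> Omega -> R).
Hypotheses (HX : diffusion_process P l r S D X)
  (HX0 : law_density P (X 0) (oitv l r) (sdens D))
  (HA : assumption1 l r S D) (HE : eigensystem l r D).
Local Notation J := (oitv l r).
Local Notation q := (sdens D).
Local Notation leb := (@lebesgue_measure R).
Local Notation mJ := (measurable_oitv l r).

Lemma measurable_diffusion t : 0 <= t -> measurable_fun setT (X t).
Proof. by case: HX => + _ _ _ _; apply. Qed.

Lemma measurable_sdens : measurable_fun J q.
Proof.
case: HA => _ _ [G [_ mi qE]] _ _.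
have /measurable_EFinP mm := measurable_int _ mi.
have : measurable_fun J (fun x => (dcoef D x ^+ 2)^-1 * expR (G x) /
    \int[leb]_(y in J) ((dcoef D y ^+ 2)^-1 * expR (G y))).
  by apply: measurable_funM => //.
by apply: eq_measurable_fun => x /set_mem Jx; rewrite qE.
Qed.

Lemma sdens_ge0 x : J x -> 0 <= q x.
Proof.
case: HA => _ _ [G [_ mi qE]] _ _ Jx; rewrite qE// divr_ge0//.
  by rewrite mulr_ge0 ?expR_ge0// invr_ge0 sqr_ge0.
by apply: Rintegral_ge0 => y _; rewrite mulr_ge0 ?expR_ge0// invr_ge0 sqr_ge0.
Qed.

Lemma law_density_diffusion t : 0 <= t -> law_density P (X t) J q.
Proof.
rewrite le_eqVlt => /predU1P[<-//|t0] B mB.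
case: HX => _ _ _ mark _; case: HA => _ stat _ _ _.
rewrite -[X in P X]setTI (mark 0 t setT B)//; last exact: sigma_ofT.
rewrite subr0 -(stat t B (ltW t0) mB).
rewrite (law_density_integral mJ _ HX0 sdens_ge0 measurable_sdens
  (g := fun x => kern D t x B))//.
- by apply: eq_integral => x _; rewrite muleC.
- exact: measurable_diffusion.
- exact: measurable_kernel.
Qed.

(** Extended by 0: the eigenfunctions are specified on the open interval only, while the process and
    its kernels live on the whole line. Values off [J] do not matter almost surely, because the
    stationary law is carried by [J]. *)
Definition eigfunJ m : R -> R := eigfun D m \_ J.

Lemma measurable_eigfunJ m : measurable_fun setT (eigfunJ m).
Proof.
apply/(measurable_restrictT _ mJ).
by case: HE => _ _ _ /(_ m)[_ [[mf _] _ _] _] _.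
Qed.

Lemma eigval_le0 m : eigval D m <= 0.
Proof.
case: HE => l0 lS _ _ _; elim: m => [|m IH]; first by rewrite l0.
exact: le_trans (ltW (lS m)) IH.
Qed.

Lemma eigvalS_lt0 m : eigval D m.+1 < 0.
Proof. by case: HE => _ lS _ _ _; exact: lt_le_trans (lS m) (eigval_le0 m). Qed.

Section stationary_variable.
Variable Z : Omega -> R.
Hypotheses (mZ : measurable_fun setT Z) (lZ : law_density P Z J q).

Lemma expect_stationary (g : R -> \bar R) : (forall x, 0 <= g x)%E ->
  measurable_fun setT g ->
  (\int[P]_w g (Z w) = \int[leb]_(x in J) ((q x)%:E * g x))%E.
Proof.
exact: (law_density_integral mJ mZ lZ sdens_ge0 measurable_sdens).
Qed.

Lemma ae_stationary : {ae P, forall w, J (Z w)}.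
Proof.
exists (Z @^-1` (~` J)); split => //.
- by rewrite -[X in measurable X]setTI; apply: mZ => //; exact: measurableC mJ.
- by rewrite lZ ?setICr ?integral_set0//; exact: measurableC mJ.
Qed.

Lemma L2_stationary (g : R -> R) : inL2 l r D g ->
  (\int[P]_w ((g \_ J) (Z w) ^+ 2)%:E < +oo)%E.
Proof.
move=> [mg]; rewrite (expect_stationary (g := fun x => ((g \_ J) x ^+ 2)%:E)).
- apply: le_lt_trans; rewrite le_eqVlt; apply/orP; left; apply/eqP.
  by apply: eq_integral => x xJ; rewrite patchE xJ -EFinM mulrC.
- by move=> x; rewrite lee_fin sqr_ge0.
- apply/measurable_EFinP/measurable_funX.
  exact/(measurable_restrictT _ mJ).
Qed.

Lemma integrable_sqr (g : R -> R) : measurable_fun setT g ->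
  (\int[P]_w (g (Z w) ^+ 2)%:E < +oo)%E ->
  P.-integrable setT (EFin \o (g \o Z)).
Proof.
move=> mg g2.
have mgZ : measurable_fun setT (g \o Z) by exact: measurableT_comp.
apply: (@le_integrable _ _ _ P _ measurableT _
  (fun w => (1 + g (Z w) ^+ 2)%:E)).
- exact/measurable_EFinP.
- move=> w _; rewrite /= lee_fin [leRHS]ger0_norm ?addr_ge0 ?sqr_ge0//.
  rewrite -(real_normK (num_real (g (Z w)))).
  by have := sqr_ge0 (`|g (Z w)| - 1); rewrite sqrrB1; have := normr_ge0 (g (Z w)); nra.
- have -> : (fun w => (1 + g (Z w) ^+ 2)%:E) =
     (cst 1%E \+ (fun w => (g (Z w) ^+ 2)%:E))%E by apply/funext => w; rewrite EFinD.
  apply: integrableD => //; first exact: finite_measure_integrable_cst.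
  apply/integrableP; split; first exact/measurable_EFinP/measurable_funX.
  by under eq_integral do rewrite gee0_abs ?lee_fin ?sqr_ge0//.
Qed.

Lemma inL2_eigfun m : inL2 l r D (eigfun D m).
Proof. by case: HE => _ _ _ /(_ m)[_ [+ _ _] _] _. Qed.

Lemma integrable_eigfunJ m : P.-integrable setT (EFin \o (eigfunJ m \o Z)).
Proof.
apply: integrable_sqr; first exact: measurable_eigfunJ.
exact/L2_stationary/inL2_eigfun.
Qed.

End stationary_variable.

Lemma semigroupE t m x :
  semigroup l r D t (eigfun D m) x = \int[kern D t x]_y eigfunJ m y.
Proof. by rewrite /semigroup Rintegral_mkcond. Qed.

Lemma markov_eigfunJ m s h H : 0 <= s -> 0 < h ->
  sigma_of X [set u | 0 <= u <= s] H ->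
  measurable_fun setT (semigroup l r D h (eigfun D m)) /\
  (\int[P]_(w in H) (eigfunJ m (X (s + h) w))%:E =
   \int[P]_(w in H) (semigroup l r D h (eigfun D m) (X s w))%:E)%E /\
  P.-integrable H (fun w => (semigroup l r D h (eigfun D m) (X s w))%:E).
Proof.
move=> s0 h0 sH.
have sh0 : 0 <= s + h by rewrite addr_ge0// ltW.
have mXs := measurable_diffusion s0; have mXh := measurable_diffusion sh0.
have sh : s < s + h by rewrite ltrDl.
have mH : measurable H.
  by apply: sigma_of_measurable sH => t /andP[t0 _]; exact: measurable_diffusion.
have mark B : measurable B ->
    P (H `&` X (s + h) @^-1` B) = (\int[P]_(w in H) kern D h (X s w) B)%E.
  case: HX => _ _ _ mark _ mB; rewrite (mark s (s + h) H B)//.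
  by rewrite addrAC subrr add0r.
have mk B : measurable B -> measurable_fun setT (kern D h ^~ B).
  by move=> mB; exact: measurable_kernel.
have iph := integrable_eigfunJ mXh (law_density_diffusion sh0) m.
have iphH : P.-integrable H (EFin \o (eigfunJ m \o X (s + h))).
  exact: integrableS iph.
have [iK eK] := markov_signed mH mXs mXh mk mark (measurable_eigfunJ m) iphH.
have KE x : semigroup l r D h (eigfun D m) x = \int[kern D h x]_y eigfunJ m y.
  exact: semigroupE.
have -> : semigroup l r D h (eigfun D m) =
    fun x => \int[kern D h x]_y eigfunJ m y by apply/funext.
split; last by split.
(* Measurability of the kernel integral in [x] is a by-product of mixing the kernels over the law of
   [X s], which yields the law of [X (s + h)]. *)
have nuE B : measurable B ->
    plaw P mXh B = (\int[plaw P mXs]_(x in setT) kern D h x B)%E.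
  move=> mB; rewrite ge0_integral_plaw//; last exact: measurable_kernel.
  rewrite plawE -[X in P X]setTI; case: HX => _ _ _ mark' _.
  rewrite (mark' s (s + h) setT B)//; last exact: sigma_ofT.
  by rewrite addrAC subrr add0r.
have mphi := measurable_eigfunJ m.
have ipl : (plaw P mXh).-integrable setT (EFin \o eigfunJ m).
  by apply: integrable_plaw => //; exact/measurable_EFinP.
by have [] := integral_mixture_signed measurableT mk nuE mphi ipl.
Qed.

Definition gen_error m h x : R :=
  (semigroup l r D h (eigfun D m) x - eigfun D m x) / h -
    eigval D m * eigfun D m x.

Lemma gen_error_small m (e : R) : 0 < e -> exists2 del : R, 0 < del &
  forall h, 0 < h -> h < del -> (L2norm2 l r D (gen_error m h) <= e%:E)%E.
Proof.
move=> e0; case: HE => _ _ _ /(_ m)[_ [_ _ cv] _] _.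
have cv0 : L2norm2 l r D (gen_error m t) @[t --> 0^'+] --> 0%E by exact: cv.
have /fine_cvgP[fin /cvgrPdist_le /(_ e e0) near1] := cv0.
have near2 : \forall t \near 0^'+, (L2norm2 l r D (gen_error m t) <= e%:E)%E.
  near=> t.
  have finN : L2norm2 l r D (gen_error m t) \is a fin_num by near: t.
  rewrite -[leLHS]fineK// lee_fin.
  have : `|0 - fine (L2norm2 l r D (gen_error m t))| <= e by near: t.
  by rewrite sub0r normrN; exact: le_trans (ler_norm _).
have [del /= del0 H] := near2.
exists del => // h h0 hd; apply: (H h) => //.
by rewrite /ball_/= sub0r normrN gtr0_norm.
Unshelve. all: by end_near.
Qed.

(** Conditioning at time [s] reduces the difference to the expectation of [G (X s)], where [G] is
    [h] times the generator error minus [(expR (lam * h) - 1 - lam * h)] times the eigenfunction. By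
    stationarity its moments do not depend on [s], which gives the uniformity in [s] needed by
    [exponential_evolution]. *)
Lemma eigfun_step m A (e : R) : measurable A -> 0 < e ->
  exists2 del : R, 0 < del & forall h s : R, 0 < h -> h < del -> 0 <= s ->
    `|\int[P]_(w in X 0 @^-1` A) eigfunJ m (X (s + h) w) -
      expR (eigval D m * h) * \int[P]_(w in X 0 @^-1` A) eigfunJ m (X s w)|
    <= e * h.
Proof.
move=> mA e0; set lam := eigval D m; set H := X 0 @^-1` A.
have mX0 := measurable_diffusion (lexx 0).
pose c : R := fine (\int[P]_w `|eigfunJ m (X 0 w)|%:E)%E.
have mphi := measurable_eigfunJ m.
have cE s : 0 <= s -> (\int[P]_w `|eigfunJ m (X s w)|%:E = c%:E)%E.
  move=> s0; have mXs := measurable_diffusion s0.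
  have lXs := law_density_diffusion s0.
  have mn : measurable_fun setT (fun x => `|eigfunJ m x|%:E).
    by apply/measurable_EFinP; exact: measurableT_comp.
  have n0 x : (0 <= `|eigfunJ m x|%:E)%E by [].
  rewrite (expect_stationary mXs lXs n0 mn) -(expect_stationary mX0 HX0 n0 mn).
  rewrite fineK//; apply: integrable_fin_num => //.
  exact: (integrable_norm (integrable_eigfunJ mX0 HX0 m)).
have c0 : 0 <= c by rewrite fine_ge0// integral_ge0.
pose eta := e / 2; have eta0 : 0 < eta by rewrite divr_gt0.
have [d1 d10 Hd1] := gen_error_small m (exprn_gt0 2 eta0).
(* Below [d2] the second-order term [lam ^+ 2 * h ^+ 2 * c] is at most [h * eta]; the summand 1
   keeps the denominator positive. *)
pose d2 := eta / (lam ^+ 2 * c + 1).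
have D0 : 0 < lam ^+ 2 * c + 1 by rewrite ltr_wpDl// mulr_ge0// sqr_ge0.
exists (Num.min d1 d2); first by rewrite lt_min d10 divr_gt0.
move=> h s h0; rewrite lt_min => /andP[hd1 hd2] s0.
have mXs := measurable_diffusion s0; have lXs := law_density_diffusion s0.
have sH : sigma_of X [set u | 0 <= u <= s] H.
  by apply: sigma_of_preimage => //=; rewrite lexx s0.
have mH : measurable H by rewrite -[X in measurable X]setTI; exact: mX0.
have [mK [eK iK]] := markov_eigfunJ m s0 h0 sH.
set K := semigroup l r D h (eigfun D m) in mK eK iK.
have ips := integrable_eigfunJ mXs lXs m.
have ipsH : P.-integrable H (EFin \o (eigfunJ m \o X s)) by exact: integrableS ips.
pose G x := K x - expR (lam * h) * eigfunJ m x.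
have -> : \int[P]_(w in H) eigfunJ m (X (s + h) w) -
    expR (lam * h) * \int[P]_(w in H) eigfunJ m (X s w) =
    \int[P]_(w in H) G (X s w).
  rewrite -RintegralZl//; rewrite [X in X - _](_ : _ = \int[P]_(w in H) K (X s w)).
    rewrite -RintegralB//; exact: (integrableZl mH (expR (lam * h)) ipsH).
  by rewrite /Rintegral eK.
have mG : measurable_fun setT G.
  by apply: measurable_funB => //; exact: measurable_funM.
have mGX : measurable_fun setT (G \o X s) by exact: measurableT_comp.
have iG : P.-integrable H (EFin \o (G \o X s)).
  exact: (integrableB mH iK (integrableZl mH (expR (lam * h)) ipsH)).
apply: (le_trans (le_normr_Rintegral _ _)) => //.
rewrite -lee_fin /Rintegral fineK; last first.
  by apply: integrable_fin_num => //; exact: (integrable_norm iG).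
apply: (@le_trans _ _ (\int[P]_w `|G (X s w)|%:E)%E).
  apply: ge0_subset_integral => //.
  by apply/measurable_EFinP; exact: measurableT_comp.
rewrite (expect_stationary mXs lXs (g := fun x => `|G x|%:E))//; last first.
  by apply/measurable_EFinP; exact: measurableT_comp.
pose u := gen_error m h.
have mu2 : measurable_fun J (fun x => u x ^+ 2 * q x).
  apply: measurable_funM; last exact: measurable_sdens.
  have mphiJ : measurable_fun J (eigfun D m).
    by have [] := inL2_eigfun m.
  apply: measurable_funX; apply: measurable_funB.
    apply: measurable_funM => //; apply: measurable_funB => //.
    exact: measurable_funTS.
  exact: measurable_funM.
have mq := measurable_sdens.
have mqn : measurable_fun J (fun x => `|eigfunJ m x| * q x).
  by apply: measurable_funM => //; apply: measurable_funTS; exact: measurableT_comp.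
(* The generator error [u] is small in L^2(q) only; Young's inequality with weight [eta] converts
   this to L^1, at a total cost of [h * eta]. The remaining half of [e * h] pays for the term
   bounded through [expR_near0_le]. *)
apply: (@le_trans _ _ (\int[leb]_(x in J) ((h / (2 * eta))%:E * (u x ^+ 2 * q x)%:E
   + ((h * eta / 2)%:E * (q x)%:E + (lam ^+ 2 * h ^+ 2)%:E * (`|eigfunJ m x| * q x)%:E)))%E).
  apply: ge0_le_integral => //; first exact: mJ.
  - by move=> x Jx; rewrite -EFinM lee_fin mulr_ge0// sdens_ge0.
  - apply/measurable_EFinP/measurable_funM => //.
    by apply: measurable_funTS; exact: measurableT_comp.
  - by apply/measurable_EFinP; apply: measurable_funD;
      [|apply: measurable_funD]; exact: measurable_funM.
  move=> x Jx; rewrite -!EFinM -!EFinD lee_fin.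
  have qx := sdens_ge0 Jx.
  have pE : eigfunJ m x = eigfun D m x by rewrite /eigfunJ patchE mem_set.
  have -> : G x = h * u x - (expR (lam * h) - 1 - lam * h) * eigfunJ m x.
    rewrite /G /u /gen_error -/K -/lam pE; field; exact: lt0r_neq0.
  have Hx : `|h * u x - (expR (lam * h) - 1 - lam * h) * eigfunJ m x| <=
      h / (2 * eta) * u x ^+ 2 + (h * eta / 2 + lam ^+ 2 * h ^+ 2 * `|eigfunJ m x|).
    apply: (le_trans (ler_normB _ _)); rewrite addrA lerD//.
      rewrite normrM (gtr0_norm h0) -(real_normK (num_real (u x))).
      set v := `|u x|; rewrite -subr_ge0.
      rewrite (_ : _ - _ = h / (2 * eta) * (v - eta) ^+ 2).
        by rewrite mulr_ge0 ?sqr_ge0// divr_ge0 ?mulr_ge0// ltW.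
      by field; exact: lt0r_neq0.
    rewrite normrM ler_wpM2r// -exprMn expR_near0_le// mulr_le0_ge0 ?(ltW h0)//.
    exact: eigval_le0.
  apply: (le_trans (ler_wpM2l qx Hx)); rewrite le_eqVlt; apply/orP; left.
  by apply/eqP; ring.
have qJ1 : (\int[leb]_(x in J) (q x)%:E = 1)%E.
  by rewrite -[J]setIT -HX0// preimage_setT probability_setT.
have phiJ1 : (\int[leb]_(x in J) (`|eigfunJ m x| * q x)%:E = c%:E)%E.
  rewrite -(cE s s0) (expect_stationary mXs lXs (g := fun x => `|eigfunJ m x|%:E))//.
    by apply: eq_integral => x _; rewrite -EFinM mulrC.
  by apply/measurable_EFinP; exact: measurableT_comp.
have hh0 := ltW h0; have e00 := ltW eta0.
have k1 : 0 <= h / (2 * eta) by rewrite divr_ge0// mulr_ge0.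
have k2 : 0 <= h * eta / 2 by rewrite divr_ge0// mulr_ge0.
have k3 : 0 <= lam ^+ 2 * h ^+ 2 by rewrite mulr_ge0 ?sqr_ge0.
have f1 x : J x -> 0 <= u x ^+ 2 * q x by move=> Jx; rewrite mulr_ge0 ?sqr_ge0 ?sdens_ge0.
have f3 x : J x -> 0 <= `|eigfunJ m x| * q x by move=> Jx; rewrite mulr_ge0 ?sdens_ge0.
rewrite ge0_integralD//; last 5 first.
- exact: mJ.
- by move=> x Jx; rewrite -EFinM lee_fin mulr_ge0 ?f1.
- by apply/measurable_EFinP; exact: measurable_funM.
- by move=> x Jx; rewrite -!EFinM -EFinD lee_fin addr_ge0// mulr_ge0 ?f3 ?sdens_ge0.
- by apply/measurable_EFinP; apply: measurable_funD; exact: measurable_funM.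
rewrite [X in (_ + X)%E]ge0_integralD//; last 5 first.
- exact: mJ.
- by move=> x Jx; rewrite -EFinM lee_fin mulr_ge0 ?sdens_ge0.
- by apply/measurable_EFinP; exact: measurable_funM.
- by move=> x Jx; rewrite -EFinM lee_fin mulr_ge0 ?f3.
- by apply/measurable_EFinP; exact: measurable_funM.
have fq x : J x -> (0 <= (q x)%:E)%E by move=> Jx; rewrite lee_fin sdens_ge0.
have ff1 x : J x -> (0 <= (u x ^+ 2 * q x)%:E)%E by move=> Jx; rewrite lee_fin f1.
have ff3 x : J x -> (0 <= (`|eigfunJ m x| * q x)%:E)%E by move=> Jx; rewrite lee_fin f3.
have mJ' : @measurable _ (measurableTypeR R) J := mJ.
rewrite (ge0_integralZl _ mJ' _ ff1)//; last exact/measurable_EFinP.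
rewrite (ge0_integralZl _ mJ' _ fq)//; last exact/measurable_EFinP.
rewrite (ge0_integralZl _ mJ' _ ff3)//; last exact/measurable_EFinP.
rewrite qJ1 phiJ1 mule1 -EFinM.
apply: (@le_trans _ _ ((h / (2 * eta))%:E * (eta ^+ 2)%:E +
   ((h * eta / 2)%:E + (lam ^+ 2 * h ^+ 2 * c)%:E))%E).
  rewrite leeD2r// lee_wpmul2l ?lee_fin//.
  exact: Hd1.
rewrite -EFinM -!EFinD lee_fin.
have : h * (lam ^+ 2 * c + 1) <= eta by rewrite -ler_pdivlMr// ltW.
move=> hle; have -> : h / (2 * eta) * eta ^+ 2 = h * eta / 2.
  by field; exact: lt0r_neq0.
have : h * (h * (lam ^+ 2 * c)) <= h * eta.
  by rewrite ler_wpM2l//; apply: le_trans hle; rewrite ler_wpM2l// lerDl.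
rewrite (_ : e = 2 * eta); first by lra.
by rewrite /eta; field.
Qed.

Lemma eigfun_evolution m A s : measurable A -> 0 <= s ->
  \int[P]_(w in X 0 @^-1` A) eigfunJ m (X s w) =
  expR (eigval D m * s) * \int[P]_(w in X 0 @^-1` A) eigfunJ m (X 0 w).
Proof.
move=> mA s0; apply: (@exponential_evolution _
  (fun s => \int[P]_(w in X 0 @^-1` A) eigfunJ m (X s w))) => //.
- exact: eigval_le0.
- by move=> e e0; exact: eigfun_step.
Qed.

End diffusion_eigenfunctions.

(** * Subordination *)

Section subordination.
Context (R : realType) (l r : \bar R) (S : set R).
Context (d : measure_display) (Omega : measurableType d).
Variables (P : probability Omega R) (D : diffusion R) (phi : R -> R)
  (X T : R -> Omega -> R).
Hypotheses (HX : diffusion_process P l r S D X)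
  (HT : subordinator P phi T)
  (HXT : indep P (sigma_of X [set u | 0 <= u]) (sigma_of T [set u | 0 <= u])).
Local Notation J := (oitv l r).
Local Notation q := (sdens D).
Local Notation Y := (subordinated X T).

(** The sigma-algebra generated by [X] alone. On [Omega] with this structure the identity map
    carries the whole path of [X], and independence of [X] and [T] says that the law of [(T t, id)]
    is a product measure. *)
Let GX := [set A | exists u B, [/\ [set u | 0 <= u] u, measurable B & A = X u @^-1` B]].
Let OX := g_sigma_algebraType GX.

Let mX t : 0 <= t -> measurable_fun setT (X t).
Proof. by case: HX => + _ _ _ _; apply. Qed.

Let mT t : 0 <= t -> measurable_fun setT (T t).
Proof. by case: HT => + _ _ _ _; apply. Qed.

Lemma subordinator_ge0 t w : 0 <= t -> 0 <= T t w.
Proof.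
by move=> t0; case: HT => _ /(_ w)[T0 mono _] _ _ _; rewrite -T0; exact: mono.
Qed.

Lemma subordinated0 : Y 0 = X 0.
Proof.
apply/funext => w; rewrite /subordinated.
by case: HT => _ /(_ w)[-> _ _] _ _ _.
Qed.

(** Rounds [s] down to the grid of mesh [1 / n.+1]. Since [truncn] sends negative numbers to 0, the
    grid times stay nonnegative, where the paths are continuous, and the limit is [Num.max s 0]. *)
Let tau n (s : R) : R := (Num.truncn (s * n.+1%:R))%:R / n.+1%:R.

Let tau_ge0 n s : 0 <= tau n s. Proof. by rewrite divr_ge0. Qed.

Let tau_cvg s : tau n s @[n --> \oo] --> Num.max s 0.
Proof.
have [s0|s0] := leP s 0.
  rewrite (_ : (fun n => tau n s) = cst 0); first exact: cvg_cst.
  apply/funext => n; rewrite /tau [Num.truncn _](_ : _ = 0%N) ?mul0r//.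
  by apply/truncn0Pn; rewrite -ltNge (le_lt_trans _ ltr01)// mulr_le0_ge0.
apply/cvgrPdist_le => e e0.
have := near_infty_natSinv_lt (PosNum e0); apply: filterS => n /= ne.
have sn : 0 <= s * n.+1%:R by rewrite mulr_ge0// ltW.
have n0 : (0 : R) < n.+1%:R by [].
have /andP[h1 h2] := truncn_itv sn.
have -> : s - tau n s = (s * n.+1%:R - (Num.truncn (s * n.+1%:R))%:R) / n.+1%:R.
  by rewrite mulrBl mulfK ?gt_eqF.
rewrite ger0_norm ?divr_ge0 ?subr_ge0//.
apply: le_trans (ltW ne); rewrite ler_pdivrMr// mulVf ?gt_eqF//.
by rewrite lerBlDr addrC natr1 ltW.
Qed.

Let mtau n : measurable_fun setT (tau n).
Proof.
apply: measurable_funM => //.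
apply: nondecreasing_measurable => // x y xy /=.
by rewrite ler_nat le_truncn// ler_wpM2r.
Qed.

(* Jointly measurable as the limit of X (tau n t), by continuity of the paths. *)
Definition path_eval (z : R * OX) : R := X (Num.max z.1 0) z.2.

Lemma measurable_path_eval : measurable_fun setT path_eval.
Proof.
apply: (measurable_fun_cvg (h := fun n (z : R * OX) => X (tau n z.1) z.2)).
  move=> n _ B mB; rewrite setTI.
  (* For fixed [n] the rounded time takes countably many values, so the preimage is a countable
     union of measurable rectangles. *)
  have -> : (fun z : R * OX => X (tau n z.1) z.2) @^-1` B =
    \bigcup_k ((tau n @^-1` [set k%:R / n.+1%:R]) `*`
               (X (k%:R / n.+1%:R) @^-1` B)).
    apply/seteqP; split => [[s w]/= Bw|[s w] [k _ /= [-> //]]].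
    by exists (Num.truncn (s * n.+1%:R)).
  apply: bigcup_measurable => k _; apply: measurableX.
    by rewrite -[X in measurable X]setTI; exact: mtau.
  by apply: sub_sigma_algebra; exists (k%:R / n.+1%:R), B; split => //=.
move=> [s w] _ /=; rewrite /path_eval /=.
case: HX => _ /(_ w)[+ _] _ _ _.
move/subspace_continuousP => /(_ (Num.max s 0)).
rewrite /= in_itv/= andbT le_max lexx orbT => /(_ isT) cX.
apply: (cvg_comp _ _ _ cX) => V /=; rewrite /within/= => nV.
have : (fun n => tau n s) @ \oo --> Num.max s 0 by exact: tau_cvg.
move=> /(_ _ nV); apply: (@filterS _ (nbhs \oo) _
  (fun n => `[0, +oo[%classic (tau n s) -> V (tau n s))) => n /= Vn.
by apply: Vn; rewrite /= in_itv/= andbT.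
Qed.

Let midX : measurable_fun setT (id : Omega -> OX).
Proof.
move=> _ B mB; rewrite setTI preimage_id.
by apply: (sigma_of_measurable (Z := X) (I := [set u | 0 <= u])).
Qed.

Let mjoint t (t0 : 0 <= t) : measurable_fun setT (fun w => (T t w, w) : R * OX).
Proof. by apply/measurable_fun_pairP; split; [exact: mT|exact: midX]. Qed.

(** On rectangles this is the independence of [X] and [T]; a measure that factors on rectangles is
    the product measure, whose value is the integral of the sections. *)
Let joint_law t (t0 : 0 <= t) (C : set (R * OX)) : measurable C ->
  P ((fun w => (T t w, w) : R * OX) @^-1` C) =
  (\int[plaw P (mT t0)]_s P (xsection C s))%E.
Proof.
move=> mC; have rect A B : measurable A -> measurable B ->
    plaw P (mjoint t0) (A `*` B) = (plaw P (mT t0) A * plaw P midX B)%E.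
  move=> mA mB; transitivity (P (B `&` T t @^-1` A)).
    transitivity (P ((fun w => (T t w, w)) @^-1` (A `*` B))) => //.
    by congr (P _); apply/seteqP; split => w /= [].
  rewrite (HXT (A := B) (B := T t @^-1` A))//; last exact: sigma_of_preimage.
  by rewrite muleC.
transitivity (plaw P (mjoint t0) C) => //.
by rewrite -(product_measure_unique (m1 := plaw P (mT t0)) (m2 := plaw P midX) rect mC).
Qed.

Lemma measurable_subordinated t : 0 <= t -> measurable_fun setT (Y t).
Proof.
move=> t0; have -> : Y t = path_eval \o (fun w => (T t w, w) : R * OX).
  apply/funext => w; rewrite /path_eval /subordinated /=.
  by rewrite (max_idPl _)// subordinator_ge0.
by apply: (measurableT_comp measurable_path_eval); exact: mjoint.
Qed.

Let mpair (s : R) : measurable_fun setT (fun w => (X 0 w, X (Num.max s 0) w)).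
Proof.
apply/measurable_fun_pairP; split; apply: mX => //.
by rewrite le_max lexx orbT.
Qed.

Let mpairY t (t0 : 0 <= t) : measurable_fun setT (fun w => (X 0 w, Y t w)).
Proof.
by apply/measurable_fun_pairP; split; [exact: mX|exact: measurable_subordinated].
Qed.

(** The law of [(X 0, Y t)] is the mixture, over the law of [T t], of the laws of [(X 0, X s)].
    Negative [s] are replaced by 0 in [mpair]; they have probability 0, since [T t] is
    nonnegative. *)
Let mixing t (t0 : 0 <= t) (C : set (R * R)) : measurable C ->
  measurable_fun setT (fun s => plaw P (mpair s) C) /\
  plaw P (mpairY t0) C =
  (\int[plaw P (mT t0)]_s plaw P (mpair s) C)%E.
Proof.
move=> mC; pose C' := (fun z : R * OX => (X 0 z.2, path_eval z)) @^-1` C.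
have mC' : measurable C'.
  rewrite -[X in measurable X]setTI.
  suff : measurable_fun setT (fun z : R * OX => (X 0 z.2, path_eval z)) by apply.
  apply/measurable_fun_pairP; split; last exact: measurable_path_eval.
  have mX0 : measurable_fun setT (X 0 : OX -> R).
    move=> _ B mB; rewrite setTI; apply: sub_sigma_algebra.
    by exists 0, B; split => //=.
  exact: (measurableT_comp mX0 measurable_snd).
have sE s : plaw P (mpair s) C = plaw P midX (xsection C' s).
  transitivity (P [set w | C (X 0 w, X (Num.max s 0) w)]) => //.
  transitivity (P (xsection C' s)) => //; congr (P _).
  by apply/seteqP; split => w; rewrite /xsection /= inE.
split.
  have := measurable_fun_xsection (plaw P midX) mC'.
  by apply: eq_measurable_fun => s _; rewrite sE.
transitivity (\int[plaw P (mT t0)]_s P (xsection C' s))%E.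
  rewrite -(joint_law t0 mC').
  transitivity (P [set w | C (X 0 w, Y t w)]) => //; congr (P _).
  apply/seteqP; split => w; rewrite /= /C' /path_eval /subordinated /=;
    by rewrite (max_idPl _)// subordinator_ge0.
by apply: eq_integral => s _; rewrite sE.
Qed.

Hypotheses (HX0 : law_density P (X 0) J q)
  (HA : assumption1 l r S D) (HE : eigensystem l r D)
  (HY : forall t, 0 <= t -> law_density P (Y t) J q).

(** In the mixture over the clock, the component at time [s] contributes [expR (eigval D m * s)]
    times a constant by [eigfun_evolution]; averaging this factor over the law of [T t] is the
    Laplace transform at [- eigval D m], which is nonnegative. *)
Lemma subordinated_evolution m A t : measurable A -> 0 <= t ->
  \int[P]_(w in Y 0 @^-1` A) eigfunJ l r D m (Y t w) =
  expR (- phi (- eigval D m) * t) *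
  \int[P]_(w in Y 0 @^-1` A) eigfunJ l r D m (Y 0 w).
Proof.
move=> mA t0; rewrite subordinated0.
have mphi := measurable_eigfunJ HE m.
pose f (z : R * R) : R := \1_A z.1 * eigfunJ l r D m z.2.
have mf : measurable_fun setT f.
  apply: measurable_funM; last exact: (measurableT_comp mphi measurable_snd).
  exact: (measurableT_comp (measurable_indic mA) measurable_fst).
have mYt := measurable_subordinated t0.
have fE (Z : Omega -> R) : (fun w => f (X 0 w, Z w)) =
    (eigfunJ l r D m \o Z) \_ (X 0 @^-1` A).
  apply/funext => w; rewrite /f patchE /= indicE.
  have -> : (w \in X 0 @^-1` A) = (X 0 w \in A) by apply/idP/idP; rewrite !inE.
  by case: (_ \in A); rewrite ?mul1r ?mul0r.
have mH : measurable (X 0 @^-1` A).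
  by rewrite -[X in measurable X]setTI; exact: mX.
have iY := integrable_eigfunJ HA HE mYt (HY t0) m.
have fi : P.-integrable setT (EFin \o (f \o (fun w => (X 0 w, Y t w)))).
  have -> : f \o (fun w => (X 0 w, Y t w)) =
    (eigfunJ l r D m \o Y t) \_ (X 0 @^-1` A) by exact: fE.
  by rewrite -restrict_EFin; apply/(integrable_mkcond _ mH); exact: integrableS iY.
have mEf : measurable_fun setT (EFin \o f) by exact/measurable_EFinP.
have nu_f : (plaw P (mpairY t0)).-integrable setT (EFin \o f).
  exact: integrable_plaw.
have mk C : measurable C -> measurable_fun setT (fun s => plaw P (mpair s) C).
  by move=> mC; have [] := mixing t0 mC.
have nuE C : measurable C -> plaw P (mpairY t0) C =
    (\int[plaw P (mT t0)]_s plaw P (mpair s) C)%E.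
  by move=> mC; have [] := mixing t0 mC.
have [mF _ iF eF] := integral_mixture_signed measurableT mk nuE mf nu_f.
have RE (Z : Omega -> R) : (fun w => f (X 0 w, Z w)) = (eigfunJ l r D m \o Z) \_ (X 0 @^-1` A) ->
   (\int[P]_w (f (X 0 w, Z w))%:E = \int[P]_(w in X 0 @^-1` A) (eigfunJ l r D m (Z w))%:E)%E.
  move=> fz; rewrite [RHS]integral_mkcond; apply: eq_integral => w _.
  have := congr1 (fun h => h w) fz => /= ->.
  by rewrite !patchE; case: ifP.
set c := \int[P]_(w in X 0 @^-1` A) eigfunJ l r D m (X 0 w).
have FE s : \int[plaw P (mpair s)]_x f x = expR (eigval D m * Num.max s 0) * c.
  have s0 : 0 <= Num.max s 0 by rewrite le_max lexx orbT.
  rewrite -(eigfun_evolution HX HX0 HA HE m mA s0) /Rintegral; congr fine.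
  rewrite integral_plaw//; first exact/RE/fE.
  have -> : (EFin \o f) \o (fun w => (X 0 w, X (Num.max s 0) w)) =
    EFin \o ((eigfunJ l r D m \o X (Num.max s 0)) \_ (X 0 @^-1` A)).
    by rewrite -fE.
  have lX := law_density_diffusion HX HX0 HA s0.
  have iX := integrable_eigfunJ HA HE (mX s0) lX m.
  by rewrite -restrict_EFin; apply/(integrable_mkcond _ mH); exact: integrableS iX.
rewrite [in LHS]/Rintegral -RE; last exact: fE.
have <- : (\int[plaw P (mpairY t0)]_x (f x)%:E = \int[P]_w (f (X 0 w, Y t w))%:E)%E.
  by rewrite integral_plaw.
rewrite eF; under eq_integral do rewrite FE.
have mexp : measurable_fun setT (fun s : R => expR (eigval D m * Num.max s 0)).
  apply: measurableT_comp => //; apply: measurable_funM => //.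
  exact: measurable_maxr.
have expE : (\int[plaw P (mT t0)]_s (expR (eigval D m * Num.max s 0))%:E =
    (expR (- phi (- eigval D m) * t))%:E)%E.
  rewrite ge0_integral_plaw//; last exact/measurable_EFinP.
  have [_ _ _ _ [laplace _]] := HT.
  have a0 : 0 <= - eigval D m by rewrite oppr_ge0 (eigval_le0 HE).
  have := laplace (- eigval D m) t a0 t0; rewrite unlock => <-.
  apply: eq_integral => w _; rewrite opprK (max_idPl _)//.
  exact: subordinator_ge0.
under eq_integral do rewrite EFinM muleC.
have iexp : (plaw P (mT t0)).-integrable setT
    (fun s : R => (expR (eigval D m * Num.max s 0))%:E).
  apply/integrableP; split; first exact/measurable_EFinP.
  by under eq_integral do rewrite gee0_abs ?lee_fin ?expR_ge0//; rewrite expE ltry.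
by rewrite integralZl// expE -EFinM/= mulrC.
Qed.

(** If [phi a <= 0], the variable [expR (- a * T t)], which never exceeds 1, has expectation at
    least 1. It is then 1 almost surely, so that [T t] vanishes almost surely, for the very [t] at
    which the subordinator is known not to vanish. *)
Lemma laplace_exponent_gt0 a : 0 < a -> 0 < phi a.
Proof.
move=> a0; have [_ _ _ _ [laplace [t t0 PT]]] := HT.
have mTt := mT t0.
have Tge0 w := subordinator_ge0 w t0.
have := laplace a t (ltW a0) t0; rewrite unlock => eL.
have mexp : measurable_fun setT (fun w => expR (- a * T t w)).
  by apply: measurableT_comp => //; exact: measurable_funM.
rewrite ltNge; apply/negP => phi0; move/eqP: PT; apply.
have ge1 : (1 <= \int[P]_w (expR (- a * T t w))%:E)%E.
  by rewrite eL lee_fin -expR0 ler_expR mulr_ge0// oppr_ge0.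
have le1 w : expR (- a * T t w) <= 1.
  by rewrite expR_le1 mulNr oppr_le0 mulr_ge0// ltW.
have ig : P.-integrable setT (fun w => (expR (- a * T t w))%:E).
  apply/integrableP; split; first exact/measurable_EFinP.
  by under eq_integral do rewrite gee0_abs ?lee_fin ?expR_ge0//; rewrite eL ltry.
have i0 : (\int[P]_w (1 - expR (- a * T t w))%:E = 0)%E.
  apply/eqP; rewrite eq_le; apply/andP; split; last first.
    by apply: integral_ge0 => w _; rewrite lee_fin subr_ge0.
  under eq_integral do rewrite EFinB.
  rewrite integralB_EFin//; last exact: finite_measure_integrable_cst.
  by rewrite integral_prob_cst sube_le0.
have : ae_eq P setT (fun w => (1 - expR (- a * T t w))%:E) (cst 0%E).
  apply/ae_eq_integral_abs => //.
    by apply/measurable_EFinP; exact: measurable_funB.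
  by rewrite -[RHS]i0; apply: eq_integral => w _; rewrite gee0_abs// lee_fin subr_ge0.
move=> [N [mN N0 sN]]; apply/eqP; rewrite eq_le measure_ge0 andbT.
rewrite -[leRHS]N0; apply: le_measure; rewrite ?inE//.
  rewrite (_ : [set w | _] = T t @^-1` ~` [set 0]).
    by rewrite -[X in measurable X]setTI; apply: mTt => //; exact: measurableC.
  by apply/seteqP; split => w /= /eqP.
move=> w /= Tw; apply: sN => /= /(_ I) [] /eqP.
rewrite subr_eq0 eq_sym -expR0 => /eqP/expR_inj/eqP.
by rewrite mulNr oppr_eq0 mulf_eq0 (gt_eqF a0) (negbTE Tw).
Qed.

End subordination.

(** * Mixing of the observed process *)

Section observed_process.
Context (R : realType) (l r : \bar R) (S : set R).
Context (d : measure_display) (Omega : measurableType d).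
Variables (P : probability Omega R) (D : diffusion R) (phi : R -> R)
  (p : R -> R -> R -> R) (X T : R -> Omega -> R).
Hypothesis HM : subordinate_model P l r S D phi p X T.
Local Notation J := (oitv l r).
Local Notation q := (sdens D).
Local Notation leb := (@lebesgue_measure R).
Local Notation Y := (subordinated X T).
Local Notation mR := (measurableTypeR R).
Local Notation mJ := (measurable_oitv l r).

Lemma measurable_Y t : 0 <= t -> measurable_fun setT (Y t).
Proof. by case: HM => -[HX _] _ HT _ _; exact: (measurable_subordinated HX HT). Qed.

Lemma law_density_Y t : 0 <= t -> law_density P (Y t) J q.
Proof. by case: HM => _ _ _ _ [_ +]; exact. Qed.

Lemma sdens_ge0' x : J x -> 0 <= q x.
Proof. by case: HM => _ [HA _] _ _ _; exact: (sdens_ge0 HA). Qed.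

Lemma measurable_sdens' : measurable_fun J q.
Proof. by case: HM => _ [HA _] _ _ _; exact: (measurable_sdens HA). Qed.

Definition qJ : R -> R := q \_ J.

Lemma qJ_ge0 x : 0 <= qJ x.
Proof. by rewrite /qJ patchE; case: ifPn => // /set_mem; exact: sdens_ge0'. Qed.

Lemma measurable_qJ : measurable_fun setT qJ.
Proof. exact: (measurable_restrictT _ mJ).1 measurable_sdens'. Qed.

Lemma ae_Y t : 0 <= t -> {ae P, forall w, J (Y t w)}.
Proof.
move=> t0; exact: (ae_stationary (measurable_Y t0) (law_density_Y t0)).
Qed.

Lemma expect_Y t (g : R -> \bar R) : 0 <= t -> (forall x, 0 <= g x)%E ->
  measurable_fun setT g ->
  (\int[P]_w g (Y t w) = \int[leb]_x ((qJ x)%:E * g x))%E.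
Proof.
move=> t0 g0 mg; have [_ [HA _] _ _ _] := HM.
rewrite (expect_stationary HA (measurable_Y t0) (law_density_Y t0) g0 mg).
rewrite [LHS]integral_mkcond; apply: eq_integral => x _.
by rewrite /qJ !patchE; case: ifP => //; rewrite mul0e.
Qed.

Lemma stationary_Y t A : 0 <= t -> measurable A ->
  P (Y t @^-1` A) = P (Y 0 @^-1` A).
Proof. by move=> t0 mA; rewrite !law_density_Y. Qed.

(** The values of [p] are constrained only for positive times and inside [J]; the extension by 0 is
    nonnegative and measurable everywhere. *)
Definition pJ (t : R) (z : mR * mR) : R :=
  if 0 < t then ((fun z : R * R => p t z.1 z.2) \_ (J `*` J)) z else 0.

Lemma pJ_ge0 t z : 0 <= pJ t z.
Proof.
rewrite /pJ; case: ifP => // t0; rewrite patchE; case: ifPn => // /set_mem[/= Jx Jy].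
by have [_ _ _ _ [[Htr _] _]] := HM; have [_] := Htr t t0; exact.
Qed.

Lemma measurable_pJ t : measurable_fun setT (pJ t).
Proof.
have [t0|t0] := boolP (0 < t); last first.
  rewrite (_ : pJ t = cst 0); first exact: measurable_cst.
  by apply/funext => z; rewrite /pJ (negbTE t0).
rewrite (_ : pJ t = (fun z : R * R => p t z.1 z.2) \_ (J `*` J)); last first.
  by apply/funext => z; rewrite /pJ t0.
have [_ _ _ _ [[Htr _] _]] := HM; have [mp _] := Htr t t0.
have mJJ : measurable (J `*` J) by apply: measurableX; exact: mJ.
exact: (measurable_restrictT _ mJJ).1 mp.
Qed.

Let measurable_pJ2 t (x : mR) : measurable_fun setT (fun y : mR => pJ t (x, y)).
Proof. exact: (measurableT_comp (measurable_pJ t) (measurable_pair1 x)). Qed.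

(** Transition kernel of [Y]. Its total mass is 1 only for almost every starting point
    ([kappa_total]), hence a plain measure. *)
Definition kappa (t : R) (x : mR) : {measure set mR -> \bar R} :=
  densm leb (fun y => pJ_ge0 t (x, y)) (measurable_pJ2 t x).

Lemma kappaE t x B : kappa t x B = (\int[leb]_(y in B) (pJ t (x, y))%:E)%E.
Proof. by []. Qed.

Let kappa_indic t x B : measurable B ->
  kappa t x B = (\int[leb]_y (pJ t (x, y) * \1_B y)%:E)%E.
Proof.
move=> mB; rewrite kappaE integral_mkcond; apply: eq_integral => y _.
by rewrite patchE indicE; case: ifP; rewrite ?mulr1 ?mulr0.
Qed.

Lemma measurable_kappa t (B : set mR) : measurable B ->
  measurable_fun setT (kappa t ^~ B).
Proof.
move=> mB.
pose f (z : mR * mR) := (pJ t z * \1_B z.2)%:E.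
have mf : measurable_fun setT f.
  apply/measurable_EFinP; apply: measurable_funM; first exact: measurable_pJ.
  exact: (measurableT_comp (measurable_indic mB) measurable_snd).
have f0 z : (0 <= f z)%E by rewrite lee_fin mulr_ge0// pJ_ge0.
have := @measurable_fun_fubini_tonelli_F _ _ mR mR R (@lebesgue_measure R) f mf f0.
by apply: eq_measurable_fun => x _; rewrite kappa_indic.
Qed.

Lemma sigma_of_Y_measurable s H : 0 <= s ->
  sigma_of Y [set u | 0 <= u <= s] H -> measurable H.
Proof.
by move=> s0; apply: sigma_of_measurable => t /andP[t0 _]; exact: measurable_Y.
Qed.

(** The assumed Markov property integrates [p], whose values are uncontrolled at starting points off
    [J]. The event is therefore intersected with [Y s] in [J], where [p] and [pJ] agree; the
    discarded part is null. *)
Lemma markov_Y s t H B : 0 <= s -> s < t -> measurable B ->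
  sigma_of Y [set u | 0 <= u <= s] H ->
  P (H `&` Y t @^-1` B) = (\int[P]_(w in H) kappa (t - s)%R (Y s w) B)%E.
Proof.
move=> s0 st mB sH.
have [_ _ _ _ [[_ mark] _]] := HM.
have mH := sigma_of_Y_measurable s0 sH.
have t0 : 0 <= t by exact: le_trans s0 (ltW st).
have mYs := measurable_Y s0; have mYt := measurable_Y t0.
pose H' := H `&` Y s @^-1` J.
have mYsJ : measurable (Y s @^-1` J).
  by rewrite -[X in measurable X]setTI; apply: mYs => //; exact: mJ.
have mH' : measurable H' by exact: measurableI.
have sH' : sigma_of Y [set u | 0 <= u <= s] H'.
  apply: sigma_ofI => //; apply: sigma_of_preimage; last exact: mJ.
  by rewrite /= lexx s0.
have N0 : P (H `\` H') = 0%E.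
  apply/eqP; rewrite eq_le measure_ge0 andbT.
  have mC : measurable (~` J : set R) by apply: measurableC; exact: mJ.
  have : P (Y s @^-1` (~` J)) = 0%E by rewrite law_density_Y// setICr integral_set0.
  move=> <-; apply: le_measure; rewrite ?inE//; first exact: measurableD.
    by rewrite -[X in measurable X]setTI; apply: mYs.
  by move=> w [Hw nH'] Jw; apply: nH'.
have HE : H = H' `|` (H `\` H') by rewrite setDUK// => w [].
have dj : [disjoint H' & H `\` H'].
  by apply/disj_set2P; apply/seteqP; split => w //= -[? []].
have mk := measurable_kappa (t - s) mB.
have mk' : measurable_fun setT (fun w => kappa (t - s) (Y s w) B).
  exact: (measurableT_comp mk mYs).
have -> : P (H `&` Y t @^-1` B) = P (H' `&` Y t @^-1` B).
  have mYB : measurable (Y t @^-1` B) by rewrite -[X in measurable X]setTI; exact: mYt.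
  apply/eqP; rewrite eq_le; apply/andP; split; last first.
    apply: le_measure; rewrite ?inE//; try exact: measurableI.
    by move=> w [[? ?] ?].
  apply: (@le_trans _ _ (P ((H' `&` Y t @^-1` B) `|` (H `\` H')))).
    apply: le_measure; rewrite ?inE//; first exact: measurableI.
      by apply: measurableU; [exact: measurableI|exact: measurableD].
    move=> w [Hw Bw]; have [Jw|nJw] := pselect (J (Y s w)); first by left.
    by right; split => // -[].
  apply: (le_trans (@measureU2 _ _ _ P _ _ _ _)) => //; first exact: measurableI.
    exact: measurableD.
  by rewrite [X in (_ + X)%E](_ : _ = 0%E) ?adde0.
rewrite (mark s t H' B s0 st sH' mB).
rewrite [in RHS]HE ge0_integral_setU//; last 2 first.
- exact: measurableD.
- by apply: measurable_funTS.
rewrite [X in (_ + X)%E](_ : _ = 0%E) ?adde0; last first.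
  apply: (null_set_integral (measurableD mH mH') _ N0).
  exact: measurable_funTS.
apply: eq_integral => w /set_mem[Hw Jw].
rewrite kappaE [LHS]integral_mkcond [RHS]integral_mkcond.
apply: eq_integral => y _; rewrite !patchE in_setI /pJ subr_gt0 st patchE.
have Jw' : J (Y s w) by exact: Jw.
by rewrite in_setX (mem_set Jw')/=; case: (y \in J); case: (y \in B).
Qed.

Let phiJ m := eigfunJ l r D m.
Definition rho m u : R := expR (- phi (- eigval D m) * u).

Let mphiJ m : measurable_fun setT (phiJ m).
Proof. by case: HM => _ [_ HE] _ _ _; exact: (measurable_eigfunJ HE). Qed.

Let iphiJ m t : 0 <= t -> P.-integrable setT (EFin \o (phiJ m \o Y t)).
Proof.
move=> t0; case: HM => _ [HA HE] _ _ _.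
exact: (integrable_eigfunJ HA HE (measurable_Y t0) (law_density_Y t0)).
Qed.

Let mYR t (t0 : 0 <= t) : measurable_fun setT (Y t : Omega -> mR) := measurable_Y t0.

Lemma markov_signed_Y s t H (f : R -> R) : 0 <= s -> s < t ->
  sigma_of Y [set u | 0 <= u <= s] H -> measurable_fun setT f ->
  P.-integrable H (EFin \o (f \o Y t)) ->
  P.-integrable H (fun w => (\int[kappa (t - s) (Y s w)]_y f y)%:E) /\
  (\int[P]_(w in H) (f (Y t w))%:E =
   \int[P]_(w in H) (\int[kappa (t - s)%R (Y s w)]_y f y)%:E)%E.
Proof.
move=> s0 st sH mf fi.
have mYs : measurable_fun setT (Y s : Omega -> mR) by exact: measurable_Y.
have t0 : 0 <= t by exact: le_trans s0 (ltW st).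
have mYt : measurable_fun setT (Y t : Omega -> mR) by exact: measurable_Y.
have mf' : measurable_fun setT (f : mR -> R) by exact: mf.
have mH := sigma_of_Y_measurable s0 sH.
apply: (markov_signed mH mYs mYt (fun B => @measurable_kappa (t - s) B) _ mf' fi).
by move=> B mB; exact: markov_Y.
Qed.

(** Both sides have the same integral over every measurable set of starting points, by the Markov
    property and [subordinated_evolution]; they therefore agree almost everywhere for the stationary
    law. *)
Lemma kappa_eigfun m u : 0 < u ->
  {ae plaw P (mYR (lexx 0)), forall x,
     (kappa u x).-integrable setT (EFin \o phiJ m) /\
     \int[kappa u x]_y phiJ m y = rho m u * phiJ m x}.
Proof.
move=> u0; have mYu := measurable_Y (ltW u0).
have mphi : measurable_fun setT (phiJ m : mR -> R) by exact: mphiJ.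
have mY0 := mYR (lexx 0).
have mYu' : measurable_fun setT (Y u : Omega -> mR) by exact: mYu.
have nuE B : measurable B ->
    plaw P mYu' B = (\int[plaw P mY0]_x kappa u x B)%E.
  move=> mB; rewrite ge0_integral_plaw//; last exact: measurable_kappa.
  transitivity (P (setT `&` Y u @^-1` B)); first by rewrite setTI.
  have sT : sigma_of Y [set v | 0 <= v <= 0] setT by exact: sigma_ofT.
  by rewrite (markov_Y (lexx 0) u0 mB sT) subr0.
have ipl : (plaw P mYu').-integrable setT (EFin \o (phiJ m : mR -> R)).
  apply: integrable_plaw; first exact/measurable_EFinP.
  exact: iphiJ (ltW u0).
have [mK aeK iK _] := integral_mixture_signed measurableT
  (fun B => @measurable_kappa u B) nuE mphi ipl.
have eqK : ae_eq (plaw P mY0) setT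
    (fun x => (\int[kappa u x]_y phiJ m y)%:E) (fun x => (rho m u * phiJ m x)%:E).
  apply: integral_ae_eq => //.
    apply/measurable_EFinP; apply: measurable_funM => //.
  move=> E _ mE.
  have mH : measurable (Y 0 @^-1` E) by rewrite -[X in measurable X]setTI; exact: (mYR (lexx 0)).
  have sH : sigma_of Y [set v | 0 <= v <= 0] (Y 0 @^-1` E).
    by apply: sigma_of_preimage => //=; rewrite lexx.
  have iu := integrableS measurableT mH (@subsetT _ _) (iphiJ m (ltW u0)).
  have i0 := integrableS measurableT mH (@subsetT _ _) (iphiJ m (lexx 0)).
  have [iKH eKH] := markov_signed_Y (lexx 0) u0 sH (mphiJ m) iu.
  rewrite subr0 in iKH eKH.
  rewrite (integral_pushforward mY0 (_ : measurable_fun setT _) iKH mE); last first.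
    exact/measurable_EFinP.
  have i0' : P.-integrable (Y 0 @^-1` E) ((fun x => (rho m u * phiJ m x)%:E) \o Y 0).
    exact: (integrableZl mH (rho m u) i0).
  rewrite (integral_pushforward mY0 (_ : measurable_fun setT _) i0' mE); last first.
    by apply/measurable_EFinP; exact: measurable_funM.
  rewrite [LHS](_ : _ = \int[P]_(w in Y 0 @^-1` E) (phiJ m (Y u w))%:E)%E; last first.
    by rewrite eKH.
  have [[HX HX0] [HA HE] HT HXT [_ HY]] := HM.
  have ev := subordinated_evolution HX HT HXT HX0 HA HE HY m mE (ltW u0).
  rewrite -[LHS]fineK; last exact: integrable_fin_num iu.
  rewrite -[RHS]fineK; last exact: integrable_fin_num i0'.
  congr EFin; transitivity (rho m u * \int[P]_(w in Y 0 @^-1` E) phiJ m (Y 0 w)).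
    exact: ev.
  by rewrite -RintegralZl.
apply: filterS2 aeK eqK => x /(_ I) h1 /(_ I) [h2]; split => //.
Qed.

Lemma ae_plaw_Y s (Q : R -> Prop) : 0 <= s ->
  {ae plaw P (mYR (lexx 0)), forall x, Q x} ->
  {ae P, forall w, Q (Y s w)}.
Proof.
move=> s0 [N [mN N0 sN]]; exists (Y s @^-1` N); split.
- by rewrite -[X in measurable X]setTI; exact: measurable_Y.
- by rewrite stationary_Y.
- by move=> w nQ; exact: sN.
Qed.

(** [subordinated_evolution] concerns events of the initial time only. Having the relation for the
    kernel itself extends it to every event of the past up to [s]. *)
Lemma eigfun_markov m s t H : 0 <= s -> s < t ->
  sigma_of Y [set u | 0 <= u <= s] H ->
  \int[P]_(w in H) phiJ m (Y t w) =
  rho m (t - s) * \int[P]_(w in H) phiJ m (Y s w).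
Proof.
move=> s0 st sH; have mH := sigma_of_Y_measurable s0 sH.
have t0 : 0 <= t by exact: le_trans s0 (ltW st).
have it := integrableS measurableT mH (@subsetT _ _) (iphiJ m t0).
have is_ := integrableS measurableT mH (@subsetT _ _) (iphiJ m s0).
have [iK eK] := markov_signed_Y s0 st sH (mphiJ m) it.
rewrite -RintegralZl// /Rintegral eK; congr fine.
have ts : 0 < t - s by rewrite subr_gt0.
have := ae_plaw_Y s0 (kappa_eigfun m ts) => aeE.
apply: ae_eq_integral => //.
- exact: measurable_int iK.
- apply/measurable_EFinP; apply: measurable_funM => //; apply: measurable_funTS.
  by apply: (measurableT_comp (mphiJ m)); exact: measurable_Y.
- by apply: filterS aeE => w [_ ->] _.
Qed.

Lemma kappa_total u : 0 < u ->
  {ae plaw P (mYR (lexx 0)), forall x, kappa u x setT = 1%E}.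
Proof.
move=> u0; have mY0 := mYR (lexx 0).
have mk : measurable_fun setT (kappa u ^~ setT) by exact: measurable_kappa.
have : ae_eq (plaw P mY0) setT (cst 1%E) (kappa u ^~ setT).
  apply: integral_ae_eq => //; first exact: finite_measure_integrable_cst.
  move=> E _ mE; have mH : measurable (Y 0 @^-1` E).
    by rewrite -[X in measurable X]setTI; exact: (mYR (lexx 0)).
  have sH : sigma_of Y [set v | 0 <= v <= 0] (Y 0 @^-1` E).
    by apply: sigma_of_preimage => //=; rewrite lexx.
  rewrite integral_cst// mul1e.
  transitivity (P (Y 0 @^-1` E `&` Y u @^-1` setT)); first by rewrite preimage_setT setIT.
  rewrite (markov_Y (lexx 0) u0 (@measurableT _ R) sH) subr0.
  by rewrite [RHS](ge0_integral_pushforward mY0)//; exact: measurable_funTS.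
by apply: filterS => x /(_ I) /= <-.
Qed.

(* Joint density of (Y_0, Y_u), extended by 0. *)
Definition Qf u (z : mR * mR) : R := qJ z.1 * pJ u z.

Lemma Qf_ge0 u z : 0 <= Qf u z.
Proof. by rewrite mulr_ge0 ?qJ_ge0 ?pJ_ge0. Qed.

Lemma measurable_Qf u : measurable_fun setT (Qf u).
Proof.
have mq : measurable_fun setT (qJ : mR -> R) by exact: measurable_qJ.
apply: measurable_funM; last exact: measurable_pJ.
exact: (measurableT_comp mq measurable_fst).
Qed.

Definition Qm u : {measure set (mR * mR) -> \bar R} :=
  densm (leb \x leb)%E (Qf_ge0 u) (measurable_Qf u).

Let mpairR s u (s0 : 0 <= s) (u0 : 0 < u) :
  measurable_fun setT (fun w => (Y s w, Y (s + u) w) : mR * mR).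
Proof.
apply/measurable_fun_pairP; split; first exact: measurable_Y.
by apply: measurable_Y; rewrite addr_ge0// ltW.
Qed.

Let Qm_fubini u (C : set (mR * mR)) : measurable C ->
  Qm u C = (\int[leb]_x ((qJ x)%:E * kappa u x (xsection C x)))%E.
Proof.
move=> mC; transitivity (\int[leb \x leb]_(z in C) (Qf u z)%:E)%E => //.
rewrite integral_mkcond.
pose f (z : mR * mR) := (Qf u z * \1_C z)%:E.
have mf : measurable_fun setT f.
  by apply/measurable_EFinP; apply: measurable_funM => //; exact: measurable_Qf.
have f0 z : (0 <= f z)%E by rewrite lee_fin mulr_ge0// Qf_ge0.
rewrite (_ : (fun x => (Qf u x)%:E) \_ C = f); last first.
  by apply/funext => z; rewrite /f patchE indicE; case: ifP; rewrite ?mulr1 ?mulr0.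
rewrite (@fubini_tonelli1 _ _ mR mR R (@lebesgue_measure R) (@lebesgue_measure R) f mf f0).
apply: eq_integral => x _; rewrite /fubini_F kappaE.
rewrite [in RHS]integral_mkcond.
have mpx : measurable_fun setT (fun y : mR => pJ u (x, y)).
  exact: (measurableT_comp (measurable_pJ u) (measurable_pair1 x)).
rewrite -ge0_integralZl//.
- apply: eq_integral => y _; rewrite /f /Qf/= patchE indicE.
  have -> : (y \in xsection C x) = ((x, y) \in C) by rewrite mem_xsection.
  by case: ifP => _; rewrite ?mulr1 ?mulr0 ?mule0// EFinM.
- apply: (measurable_restrictT _ (measurable_xsection x mC)).1.
  by apply/measurable_EFinP; exact: measurable_funTS.
- move=> y _; rewrite patchE; case: ifP => // _; rewrite lee_fin pJ_ge0//.
- by rewrite lee_fin qJ_ge0.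
Qed.

(** Rectangles form a class stable under intersection, so it suffices to compare there: the Markov
    property produces the kernel, and stationarity integrates it against [qJ]. *)
Lemma pair_law s u (C : set (mR * mR)) : 0 <= s -> 0 < u -> measurable C ->
  P [set w | C (Y s w, Y (s + u) w)] = Qm u C.
Proof.
move=> s0 u0 mC.
transitivity (plaw P (mpairR s0 u0) C) => //.
apply: (measure_unique [set A `*` B | A in measurable & B in measurable]
  (fun=> setT)) => //.
- exact: measurable_prod_measurableType.
- move=> _ _ [A1 mA1 [B1 mB1 <-]] [A2 mA2 [B2 mB2 <-]].
  exists (A1 `&` A2); first exact: measurableI.
  exists (B1 `&` B2); first exact: measurableI.
  by rewrite setXI.
- by move=> _; exists setT => //; exists setT => //; rewrite setXTT.
- by rewrite bigcup_const//; exists 0%N.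
- move=> _ [A mA [B mB <-]].
  transitivity (P (Y s @^-1` A `&` Y (s + u) @^-1` B)) => //.
  have sH : sigma_of Y [set v | 0 <= v <= s] (Y s @^-1` A).
    by apply: sigma_of_preimage => //=; rewrite lexx s0.
  have su : s < s + u by rewrite ltrDl.
  have mYs := mYR s0.
  have mk := measurable_kappa u mB.
  have mA' : measurable_fun setT (fun x : mR => (\1_A x)%:E : \bar R).
    by apply/measurable_EFinP; exact: measurable_indic.
  rewrite (markov_Y s0 su mB sH) addrAC subrr add0r.
  rewrite integral_mkcond; pose g x := ((\1_A x)%:E * kappa u x B)%E.
  have mg : measurable_fun setT (g : R -> \bar R) by exact: emeasurable_funM mA' mk.
  transitivity (\int[P]_w g (Y s w))%E.
    apply: eq_integral => w _; rewrite /g patchE indicE.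
    have -> : (w \in Y s @^-1` A) = (Y s w \in A) by apply/idP/idP; rewrite !inE.
    by case: ifP => _; rewrite ?mul1e ?mul0e.
  rewrite expect_Y//; last by move=> x; rewrite mule_ge0// lee_fin.
  have mX : measurable (A `*` B : set (mR * mR)) by exact: measurableX.
  rewrite (Qm_fubini u mX).
  apply: eq_integral => x _; congr (_ * _)%E; rewrite /g indicE xsectionE/=.
  have [xA|xA] := boolP (x \in A).
    rewrite mul1e; congr (kappa u x _); apply/seteqP; split => y /=; last by case.
    by move=> By; split => //; exact/set_mem.
  rewrite mul0e; transitivity (kappa u x set0); first by rewrite measure0.
  congr (kappa u x _); apply/seteqP; split => y //= -[/mem_set].
  by rewrite (negbTE xA).
- move=> _; transitivity (plaw P (mpairR s0 u0) setT < +oo)%E => //.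
  by rewrite probability_setT ltry.
Qed.

Lemma pair_stationary s u (C : set (mR * mR)) : 0 <= s -> 0 < u -> measurable C ->
  P [set w | C (Y s w, Y (s + u) w)] = P [set w | C (Y 0 w, Y u w)].
Proof.
by move=> s0 u0 mC; rewrite pair_law// -(pair_law (lexx 0) u0 mC) add0r.
Qed.

Lemma expect_pair u (g : mR * mR -> \bar R) : 0 < u ->
  measurable_fun setT g -> (forall z, 0 <= g z)%E ->
  (\int[P]_w g (Y 0 w, Y u w) = \int[leb \x leb]_z ((Qf u z)%:E * g z))%E.
Proof.
move=> u0 mg g0.
have mp : measurable_fun setT (fun w => (Y 0 w, Y u w) : mR * mR).
  by apply/measurable_fun_pairP; split; apply: measurable_Y => //; exact: ltW.
rewrite -(integral_densm _ (Qf_ge0 u) (measurable_Qf u))//.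
rewrite -(ge0_integral_plaw P mp)//; apply: eq_measure_integral => C mC _.
transitivity (P [set w | C (Y 0 w, Y (0 + u) w)]); last exact: pair_law.
by rewrite add0r.
Qed.

(** The law of the pair is the mixture of the images of [kappa u x] under [y |-> (x, y)]; if almost
    all of them give integral 0 to [g], so does the pair. *)
Lemma conditional_mean0 u (g : mR * mR -> R) : 0 < u ->
  measurable_fun setT g ->
  P.-integrable setT (fun w => (g (Y 0 w, Y u w))%:E) ->
  {ae plaw P (mYR (lexx 0)), forall x, \int[kappa u x]_y g (x, y) = 0} ->
  (\int[P]_w (g (Y 0 w, Y u w))%:E = 0)%E.
Proof.
move=> u0 mg gi g0.
have mp : measurable_fun setT (fun w => (Y 0 w, Y u w) : mR * mR).
  by apply/measurable_fun_pairP; split; apply: measurable_Y => //; exact: ltW.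
pose k (x : mR) : {measure set (mR * mR) -> \bar R} :=
  law (kappa u x) (measurable_pair1 x).
have kE x C : measurable C -> k x C = kappa u x (xsection C x).
  by move=> mC; transitivity (kappa u x ((pair x) @^-1` C)); rewrite ?xsectionE.
have mk C : measurable C -> measurable_fun setT (k ^~ C).
  move=> mC; pose f (z : mR * mR) := (pJ u z * \1_C z)%:E.
  have mf : measurable_fun setT f.
    by apply/measurable_EFinP; apply: measurable_funM => //; exact: measurable_pJ.
  have f0 z : (0 <= f z)%E by rewrite lee_fin mulr_ge0// pJ_ge0.
  have := @measurable_fun_fubini_tonelli_F _ _ mR mR R (@lebesgue_measure R) f mf f0.
  apply: eq_measurable_fun => x _.
  rewrite kE// kappa_indic; last exact: measurable_xsection.
  by apply: eq_integral => y _; rewrite /f !indicE mem_xsection.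
have nuE C : measurable C -> plaw P mp C =
    (\int[plaw P (mYR (lexx 0))]_x k x C)%E.
  move=> mC; rewrite ge0_integral_plaw//; last exact: mk.
  rewrite (expect_Y (g := fun x => k x C))//; last exact: mk.
  transitivity (P [set w | C (Y 0 w, Y (0 + u) w)]); first by rewrite add0r.
  rewrite (pair_law (lexx 0) u0 mC) (Qm_fubini u mC).
  by apply: eq_integral => x _; rewrite kE.
have mEg : measurable_fun setT (EFin \o g) by exact/measurable_EFinP.
have gpl : (plaw P mp).-integrable setT (EFin \o g) by exact: integrable_plaw.
have [_ aei iK eK] := integral_mixture_signed measurableT mk nuE mg gpl.
rewrite -(integral_plaw mp mEg gi) eK.
rewrite (ae_eq_integral (cst 0%E))//; first by rewrite integral0.
  exact: measurable_int iK.
apply: filterS2 g0 aei => x g0 /(_ I) ix _; congr EFin; rewrite -g0.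
have := ix; move=> /integrableP[_ fin].
rewrite /Rintegral; congr fine.
rewrite [LHS](_ : _ = \int[law (kappa u x) (measurable_pair1 x)]_z (g z)%:E)%E//.
rewrite integral_law//.
apply/integrableP; split.
  exact: (measurableT_comp mEg (measurable_pair1 x)).
rewrite -(ge0_integral_law (kappa u x) (measurable_pair1 x) (g := fun z => `|(g z)%:E|%E))//.
exact: measurableT_comp.
Qed.

Lemma rho_lt1 m u : 0 < u -> rho m.+1 u < 1.
Proof.
move=> u0; have [[HX _] [HA HE] HT _ _] := HM.
rewrite /rho expR_lt1 mulNr oppr_lt0 mulr_gt0//.
apply: (laplace_exponent_gt0 HT); rewrite oppr_gt0; exact: eigvalS_lt0 HE m.
Qed.

Lemma rhoX m u k : rho m (k%:R * u) = rho m u ^+ k.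
Proof. by rewrite /rho -expRM_natl; congr expR; ring. Qed.

Let geometric_sum_small (a b : nat -> R) n (e : R) : 0 < e ->
  (forall m, 0 <= b m) -> (forall m, b m < 1) ->
  exists K, forall k, (K <= k)%N -> \sum_(m < n) (a m * b m ^+ k) <= e.
Proof.
move=> e0 b0 b1; elim: n e e0 => [|n IH] e e0.
  by exists 0%N => k _; rewrite big_ord0 ltW.
have e2 : 0 < e / 2 by rewrite divr_gt0.
have [K HK] := IH _ e2.
have : a n * b n ^+ k @[k --> \oo] --> a n * 0.
  by apply: cvgMr; apply: cvg_expr; rewrite ger0_norm.
rewrite mulr0 => /cvgrPdist_le /(_ _ e2)[K' _ HK'].
exists (maxn K K') => k; rewrite geq_max => /andP[Kk K'k].
rewrite big_ord_recr/= [leRHS]splitr lerD ?HK//.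
have := HK' k K'k; rewrite sub0r normrN; exact: le_trans (ler_norm _).
Qed.

Lemma eigfunJ0 x : J x -> phiJ 0%N x = 1.
Proof.
move=> Jx; rewrite /phiJ /eigfunJ patchE mem_set//.
by have [_ [_ [_ _ H _ _]] _ _ _] := HM; exact: H.
Qed.

Let integralJ (g : R -> \bar R) : (forall x, 0 <= g x)%E ->
  measurable_fun setT g ->
  (\int[P]_w g (Y 0 w) = \int[leb]_(x in J) ((q x)%:E * g x))%E.
Proof.
have [_ [HA _] _ _ _] := HM.
exact: (expect_stationary HA (measurable_Y (lexx 0)) (law_density_Y (lexx 0))).
Qed.

(** * Decorrelation of the events that successive pairs fall in a rectangle *)

Section rectangles.
Variables (Delta : R) (Delta0 : 0 < Delta).
Variables (A B : set R) (mA : measurable A) (mB : measurable B).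

Let tm (i : nat) : R := i%:R * Delta.
Let tm0 i : 0 <= tm i. Proof. by rewrite mulr_ge0// ltW. Qed.
Let tmS i : tm i.+1 = tm i + Delta.
Proof. by rewrite /tm -natr1 mulrDl mul1r. Qed.
Let tm_le i j : (i <= j)%N -> tm i <= tm j.
Proof. by move=> ij; rewrite ler_wpM2r ?ler_nat// ltW. Qed.
Let tm_lt i j : (i < j)%N -> tm i < tm j.
Proof. by move=> ij; rewrite ltr_pM2r ?ltr_nat. Qed.

Let H i := Y (tm i) @^-1` A `&` Y (tm i.+1) @^-1` B.

Let sH i t : tm i.+1 <= t -> sigma_of Y [set u | 0 <= u <= t] (H i).
Proof.
move=> it; apply: sigma_ofI; apply: sigma_of_preimage => //=; rewrite tm0//=.
by apply: le_trans it; exact: tm_le.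
Qed.

Let mHi i : measurable (H i).
Proof. exact: sigma_of_Y_measurable (tm0 i.+1) (sH (lexx _)). Qed.

(** Conditional probability, given the present state [x], that the pair starting there falls in the
    rectangle. The minimum with 1 makes it bounded everywhere, the kernel having mass 1 only almost
    everywhere. *)
Let ut (x : R) : R := \1_A x * Num.min 1 (fine (kappa Delta x B)).

Let ut01 x : 0 <= ut x <= 1.
Proof.
rewrite /ut indicE; case: (x \in A); rewrite ?mul1r ?mul0r ?lexx ?ler01//.
by rewrite le_min ler01 fine_ge0//= ge_min lexx.
Qed.

Let mut : measurable_fun setT ut.
Proof.
apply: measurable_funM; first exact: measurable_indic.
apply: measurable_minr => //; apply: (measurableT_comp (@fine_measurable R setT measurableT)).
exact: (measurable_kappa Delta mB).
Qed.

Let utE : {ae plaw P (mYR (lexx 0)), forall x,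
  ((\1_A x)%:E * kappa Delta x B)%E = (ut x)%:E}.
Proof.
apply: filterS (kappa_total Delta0) => x k1.
have kB1 : (kappa Delta x B <= 1)%E.
  by rewrite -k1; apply: le_measure; rewrite ?inE//.
have kBf : kappa Delta x B \is a fin_num.
  by rewrite ge0_fin_numE// (le_lt_trans kB1)// ltry.
rewrite /ut EFinM; congr (_ * _)%E; rewrite (min_idPr _) ?fineK//.
by rewrite -lee_fin fineK.
Qed.

Let P_next i j : (i < j)%N -> P (H i `&` H j) = (\int[P]_(w in H i) (ut (Y (tm j) w))%:E)%E.
Proof.
move=> ij; have tij : tm i.+1 <= tm j by exact: tm_le.
have tj : tm j < tm j.+1 by exact: tm_lt.
pose H' := H i `&` Y (tm j) @^-1` A.
have mYj : measurable (Y (tm j) @^-1` A).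
  by rewrite -[X in measurable X]setTI; exact: measurable_Y.
have sH' : sigma_of Y [set u | 0 <= u <= tm j] H'.
  apply: sigma_ofI; first exact: sH.
  by apply: sigma_of_preimage => //=; rewrite tm0 lexx.
rewrite /H -/(H i) setIA (markov_Y (tm0 j) tj mB sH') tmS addrAC subrr add0r.
have mk : measurable_fun setT (fun w => kappa Delta (Y (tm j) w) B).
  exact: (measurableT_comp (measurable_kappa Delta mB) (mYR (tm0 j))).
rewrite /H' integral_mkcondr.
apply: ae_eq_integral => //.
- by apply/(measurable_restrict _ mYj (mHi i)); exact: measurable_funTS.
- apply/measurable_EFinP/measurable_funTS.
  exact: (measurableT_comp mut (measurable_Y (tm0 j))).
apply: filterS (ae_plaw_Y (tm0 j) utE) => w <- _.
rewrite patchE indicE.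
have -> : (w \in Y (tm j) @^-1` A) = (Y (tm j) w \in A) by apply/idP/idP; rewrite !inE.
by case: (_ \in A); rewrite ?mul1e ?mul0e.
Qed.

Let Q : R := fine (P (H 0%N)).

Let PH i : P (H i) = P (H 0%N).
Proof.
have mC : measurable (A `*` B : set (mR * mR)) by exact: measurableX.
have := pair_stationary (tm0 i) Delta0 mC; rewrite -tmS => ->.
have := pair_stationary (tm0 0%N) Delta0 mC; rewrite -tmS => -> //.
Qed.

Let int_ut : (\int[P]_w (ut (Y 0 w))%:E = Q%:E)%E.
Proof.
rewrite fineK ?fin_num_measure// /H.
have tj : tm 0 < tm 1 by exact: tm_lt.
have sA : sigma_of Y [set u | 0 <= u <= tm 0] (Y (tm 0) @^-1` A).
  by apply: sigma_of_preimage => //=; rewrite tm0 lexx.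
rewrite (markov_Y (tm0 0%N) tj mB sA) tmS addrAC subrr add0r.
have t0 : tm 0 = 0 by rewrite /tm mul0r.
rewrite t0 [RHS]integral_mkcond; apply: ae_eq_integral => //.
- apply/measurable_EFinP.
  exact: (measurableT_comp mut (measurable_Y (lexx 0))).
- have mY0 : measurable (Y 0 @^-1` A).
    by rewrite -[X in measurable X]setTI; exact: measurable_Y.
  apply: (measurable_restrictT _ mY0).1; apply: measurable_funTS.
  exact: (measurableT_comp (measurable_kappa Delta mB) (mYR (lexx 0))).
apply: filterS (ae_plaw_Y (lexx 0) utE) => w <- _.
rewrite patchE indicE.
have -> : (w \in Y 0 @^-1` A) = (Y 0 w \in A) by apply/idP/idP; rewrite !inE.
by case: (_ \in A); rewrite ?mul1e ?mul0e.
Qed.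

Let c m := L2dot l r D ut (eigfun D m).

Let c0 : c 0%N = Q.
Proof.
have [_ [_ [_ _ e1 _ _]] _ _ _] := HM.
rewrite /c /L2dot /Rintegral -[RHS]/(fine Q%:E) -int_ut.
rewrite (integralJ (g := fun x => (ut x)%:E)).
- congr fine; apply: eq_integral => x /set_mem Jx.
  by rewrite e1// mulr1 -EFinM mulrC.
- by move=> x; rewrite lee_fin; case/andP: (ut01 x).
- exact/measurable_EFinP.
Qed.

Let inL2_ut : inL2 l r D ut.
Proof.
split; first exact: measurable_funTS.
have HA : assumption1 l r S D by case: HM => _ [].
apply: (@le_lt_trans _ _ (\int[leb]_(x in J) (q x)%:E)%E).
  apply: ge0_le_integral => //; first exact: mJ.
  - by move=> x Jx; rewrite lee_fin mulr_ge0 ?sqr_ge0// sdens_ge0'.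
  - apply/measurable_EFinP/measurable_funM; last exact: measurable_sdens'.
    exact/measurable_funTS/measurable_funX.
  - by apply/measurable_EFinP; exact: measurable_sdens'.
  move=> x Jx; rewrite lee_fin ler_piMl ?sdens_ge0'//.
  by have /andP[? ?] := ut01 x; rewrite expr_le1.
rewrite -[J]setIT -(law_density_Y (lexx 0))// preimage_setT probability_setT.
exact: ltry.
Qed.

Let vN N (x : R) : R := ut x - \sum_(m < N) c m * phiJ m x.

Let mvN N : measurable_fun setT (vN N).
Proof.
apply: measurable_funB => //; apply: measurable_sum => m.
exact: measurable_funM.
Qed.

(** Completeness of the eigenfunctions in L^2(q), uniform in [t] by stationarity. The order of
    truncation is written [N.+1] so that the constant eigenfunction can always be split off. *)
Let vN_small (e : R) : 0 < e -> exists N, forall t, 0 <= t ->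
  (\int[P]_w (vN N.+1 (Y t w) ^+ 2)%:E <= e%:E)%E.
Proof.
move=> e0; have [_ [HA [_ _ _ _ [_ compl]]] _ _ _] := HM.
have /fine_cvgP[[N1 _ fin1] /cvgrPdist_le /(_ e e0)[N2 _ small]] := compl ut inL2_ut.
exists (maxn N1 N2) => t t0; set N := (maxn N1 N2).+1.
have N1N : (N1 <= N)%N by rewrite leqW// leq_maxl.
have N2N : (N2 <= N)%N by rewrite leqW// leq_maxr.
rewrite (expect_stationary HA (measurable_Y t0) (law_density_Y t0)
  (g := fun x => (vN N x ^+ 2)%:E)); last 2 first.
- by move=> x; rewrite lee_fin sqr_ge0.
- by apply/measurable_EFinP/measurable_funX.
rewrite [leLHS](_ : _ = L2norm2 l r D (fun x => ut x -
    \sum_(m < N) L2dot l r D ut (eigfun D m) * eigfun D m x)); last first.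
  apply: eq_integral => x xJ; rewrite -EFinM mulrC /vN; congr (((_ - _) ^+ 2 * _)%:E).
  by apply: eq_bigr => m _; rewrite /phiJ /eigfunJ patchE xJ.
have := small N N2N; have := fin1 N N1N => /= fN.
by rewrite sub0r normrN -{2}[L2norm2 _ _ _ _]fineK// lee_fin; exact: le_trans (ler_norm _).
Qed.

(* By the Markov property P (H i `&` H j) is the integral over H i of ut (Y_j),
   where ut is the conditional probability of Y_(j+1) in B.  In the expansion of
   ut the coefficient of index m is damped by rho m ^ (j - i - 1), and only the
   constant term survives. *)
Lemma rectangle_decorrelation (e : R) : 0 < e -> exists K, forall i j,
  (i + K < j)%N -> `|fine (P (H i `&` H j)) - Q ^+ 2| <= e.
Proof.
move=> e0; pose del := e / 2; have del0 : 0 < del by rewrite divr_gt0.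
have [N HN] := vN_small (exprn_gt0 2 del0).
pose bm m := fine (\int[P]_w `|phiJ m (Y 0 w)|%:E)%E.
have [K HK] := @geometric_sum_small (fun m => `|c m.+1| * bm m.+1)
  (fun m => rho m.+1 Delta) N _ del0 (fun m => expR_ge0 _) (fun m => rho_lt1 m Delta0).
(* The event [H i] is settled only at index [i.+1]; the extra unit guarantees that at least [K]
   steps remain until [j]. *)
exists K.+1 => i j ij.
have ij' : (i < j)%N by lia.
have iSj : (i.+1 < j)%N by lia.
rewrite (P_next ij').
set t := tm j; have t0 : 0 <= t := tm0 j.
have mv := measurableT_comp (mvN N.+1) (measurable_Y t0).
have iut : P.-integrable setT (EFin \o (ut \o Y t)).
  apply: (@measurable_bounded_integrable _ _ _ P) => //.
  - by rewrite (le_lt_trans (probability_le1 P measurableT))// ltry.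
  - exact: (measurableT_comp mut (measurable_Y t0)).
  exists 1; split; first exact: num_real.
  move=> y y1 w _ /=; apply: le_trans (ltW y1).
  by have /andP[? ?] := ut01 (Y t w); rewrite ger0_norm.
have iphi m : P.-integrable setT (EFin \o (fun w => c m * phiJ m (Y t w))).
  exact: (integrableZl measurableT (c m) (iphiJ m t0)).
have isum n : P.-integrable setT (EFin \o (fun w => \sum_(m < n) c m * phiJ m (Y t w))) /\
    \int[P]_(w in H i) (\sum_(m < n) c m * phiJ m (Y t w)) =
    \sum_(m < n) c m * \int[P]_(w in H i) phiJ m (Y t w).
  elim: n => [|n [IH1 IH2]].
    have -> : (fun w => \sum_(m < 0) c m * phiJ m (Y t w)) = (fun=> 0).
      by apply/funext => w; rewrite big_ord0.
    split; first exact: finite_measure_integrable_cst.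
    by rewrite Rintegral_cst//= mul0r big_ord0.
  have -> : (fun w => \sum_(m < n.+1) c m * phiJ m (Y t w)) =
     (fun w => (\sum_(m < n) c m * phiJ m (Y t w)) + c n * phiJ n (Y t w)).
    by apply/funext => w; rewrite big_ord_recr.
  split; first exact: (integrableD measurableT IH1 (iphi n)).
  rewrite RintegralD//; last 2 first.
  - exact: integrableS IH1.
  - exact: integrableS (iphi n).
  rewrite IH2 big_ord_recr/= RintegralZl//; exact: integrableS (iphiJ n t0).
have [is1 is2] := isum N.+1.
have iv : P.-integrable setT (EFin \o (fun w => vN N.+1 (Y t w))).
  exact: (integrableB measurableT iut is1).
have E1 : \int[P]_(w in H i) ut (Y t w) = \int[P]_(w in H i) vN N.+1 (Y t w) +
    \sum_(m < N.+1) c m * \int[P]_(w in H i) phiJ m (Y t w).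
  rewrite -is2 -RintegralD//.
  - by apply: eq_Rintegral => w _; rewrite /vN subrK.
  - exact: integrableS iv.
  - exact: integrableS is1.
have E2 : fine (\int[P]_(w in H i) (ut (Y t w))%:E)%E =
  \int[P]_(w in H i) ut (Y t w) by [].
rewrite E2 E1 big_ord_recl/= c0.
have -> : \int[P]_(w in H i) phiJ 0%N (Y t w) = Q.
  rewrite /Q -(PH i) /Rintegral; congr fine.
  rewrite -[RHS]mul1e -integral_cst//; apply: ae_eq_integral => //.
  - exact: measurable_int (integrableS measurableT (mHi i) (@subsetT _ _) (iphiJ 0%N t0)).
  - by apply: filterS (ae_Y t0) => w Jw _; rewrite eigfunJ0.
rewrite (_ : _ - Q ^+ 2 = \int[P]_(w in H i) vN N.+1 (Y t w) +
   \sum_(m < N) c m.+1 * \int[P]_(w in H i) phiJ m.+1 (Y t w)); last first.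
  by rewrite /bump/= expr2; under eq_bigr do rewrite add1n; ring.
rewrite [leRHS]splitr; apply: (le_trans (ler_normD _ _)); apply: lerD.
  apply: (le_trans (le_normr_Rintegral _ _)) => //; first exact: integrableS iv.
  rewrite -lee_fin /Rintegral fineK; last first.
    apply: integrable_fin_num => //.
    exact: (integrable_norm (integrableS measurableT (mHi i) (@subsetT _ _) iv)).
  apply: (@le_trans _ _ (\int[P]_w `|vN N.+1 (Y t w)|%:E)%E).
    by apply: ge0_subset_integral => //; apply/measurable_EFinP; exact: measurableT_comp.
  (* Young's inequality again: an L^2 remainder of square at most [del ^+ 2] has L^1 norm at most
     [del]. *)
  apply: (@le_trans _ _ (\int[P]_w ((2 * del)^-1%:E * (vN N.+1 (Y t w) ^+ 2)%:E + (del / 2)%:E))%E).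
    apply: ge0_le_integral => //.
    - by apply/measurable_EFinP; exact: measurableT_comp.
    - apply/measurable_EFinP; apply: measurable_funD => //.
      by apply: measurable_funM => //; exact: measurable_funX.
    move=> w _; rewrite -EFinM -EFinD lee_fin.
    rewrite -(real_normK (num_real (vN N.+1 (Y t w)))) -subr_ge0.
    rewrite (_ : _ - _ = (2 * del)^-1 * (`|vN N.+1 (Y t w)| - del) ^+ 2).
      by rewrite mulr_ge0 ?sqr_ge0// invr_ge0 mulr_ge0// ltW.
    by field; exact: lt0r_neq0.
  have k0 : 0 <= (2 * del)^-1 by rewrite invr_ge0 mulr_ge0// ltW.
  rewrite ge0_integralD//; last 3 first.
  - by move=> w _; rewrite -EFinM lee_fin mulr_ge0 ?sqr_ge0.
  - apply/measurable_EFinP.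
    by apply: measurable_funM => //; exact: measurable_funX.
  - by move=> w _; rewrite lee_fin divr_ge0// ltW.
  rewrite integral_prob_cst ge0_integralZl//; last 2 first.
  - by apply/measurable_EFinP; exact: measurable_funX.
  - by move=> w _; rewrite lee_fin sqr_ge0.
  apply: (@le_trans _ _ ((2 * del)^-1%:E * (del ^+ 2)%:E + (del / 2)%:E)%E).
    by rewrite leeD2r// lee_wpmul2l ?lee_fin// HN.
  rewrite -EFinM -EFinD lee_fin -/del.
  rewrite (_ : _ + _ = del)//; field; exact: lt0r_neq0.
have jk : tm j - tm i.+1 = (j - i.+1)%:R * Delta.
  by rewrite /tm -mulrBl natrB// ltnW.
have Kk : (K <= j - i.+1)%N by lia.
apply: le_trans (HK _ Kk).
apply: (le_trans (ler_norm_sum _ _ _)); apply: ler_sum => m _.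
rewrite (eigfun_markov m.+1 (tm0 i.+1) (tm_lt iSj) (sH (lexx _))).
rewrite jk rhoX mulrCA normrM (ger0_norm (exprn_ge0 _ (expR_ge0 _))) mulrC.
rewrite ler_wpM2r ?exprn_ge0 ?expR_ge0// normrM ler_wpM2l//.
have ti := tm0 i.+1.
have ip := iphiJ m.+1 ti.
have ipH := integrableS measurableT (mHi i) (@subsetT _ _) ip.
apply: (le_trans (le_normr_Rintegral _ _)) => //.
rewrite -lee_fin /Rintegral fineK; last first.
  by apply: integrable_fin_num => //; exact: (integrable_norm ipH).
have mn : measurable_fun setT (fun x => `|phiJ m.+1 x|%:E).
  by apply/measurable_EFinP; exact: measurableT_comp.
rewrite /bm fineK; last first.
  by apply: integrable_fin_num => //; exact: (integrable_norm (iphiJ m.+1 (lexx 0))).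
rewrite (_ : (\int[P]_w `|phiJ m.+1 (Y 0 w)|%:E = \int[P]_w `|phiJ m.+1 (Y (tm i.+1) w)|%:E)%E); last first.
  rewrite (expect_Y (g := fun x => `|phiJ m.+1 x|%:E))//.
  by rewrite (expect_Y (g := fun x => `|phiJ m.+1 x|%:E)).
apply: ge0_subset_integral => //.
exact: (measurableT_comp mn (measurable_Y ti)).
Qed.

End rectangles.

Section law_of_large_numbers.
Variables (Delta : R) (Delta0 : 0 < Delta).

Definition obs_pair (i : nat) (w : Omega) : mR * mR :=
  (Y (i%:R * Delta) w, Y (i.+1%:R * Delta) w).

Let tm0 i : 0 <= i%:R * Delta. Proof. by rewrite mulr_ge0// ltW. Qed.

Lemma measurable_obs_pair i : measurable_fun setT (obs_pair i).
Proof. by apply/measurable_fun_pairP; split; exact: measurable_Y. Qed.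

Lemma obs_pair_stationary i C : measurable C ->
  P (obs_pair i @^-1` C) = P (obs_pair 0%N @^-1` C).
Proof.
move=> mC.
have e k : obs_pair k @^-1` C =
    [set w | C (Y (k%:R * Delta) w, Y (k%:R * Delta + Delta) w)].
  by rewrite /obs_pair -natr1 mulrDl mul1r.
by rewrite !e (pair_stationary (tm0 i) Delta0 mC) (pair_stationary (tm0 0%N) Delta0 mC).
Qed.

Lemma obs_pair0 : obs_pair 0%N = (fun w => (Y 0 w, Y Delta w)).
Proof. by rewrite /obs_pair mul0r mul1r. Qed.

Theorem lln_obs_pair (f : mR * mR -> R) : measurable_fun setT f ->
  P.-integrable setT (EFin \o (f \o obs_pair 0%N)) -> lln P obs_pair f.
Proof.
apply: (lln_integrable measurable_obs_pair obs_pair_stationary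
  (G := [set A `*` B | A in measurable & B in measurable])).
- exact: measurable_prod_measurableType.
- move=> _ _ [A1 mA1 [B1 mB1 <-]] [A2 mA2 [B2 mB2 <-]].
  exists (A1 `&` A2); first exact: measurableI.
  exists (B1 `&` B2); first exact: measurableI.
  by rewrite setXI.
move=> _ [A mA [B mB <-]].
apply: (lln_of_cov measurable_obs_pair obs_pair_stationary).
  exact: measurableX.
exact: (rectangle_decorrelation Delta0 mA mB).
Qed.

End law_of_large_numbers.

End observed_process.

(** * Zeros of contracting maps *)

Section row_vectors.
Context (R : realType).

Lemma row_entry_le n (v : 'rV[R]_n) j : `|v 0 j| <= `|v|.
Proof.
rewrite [leRHS]/Num.Def.normr/= mx_normrE.
exact: (le_bigmax _ (fun ij : 'I_1 * 'I_n => `|v ij.1 ij.2|) (0, j)).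
Qed.

Lemma row_norm_le n (v : 'rV[R]_n) (e : R) : 0 <= e ->
  (forall j, `|v 0 j| <= e) -> `|v| <= e.
Proof.
move=> e0 ve; rewrite [leLHS]/Num.Def.normr/= mx_normrE.
by apply: bigmax_le => // -[i j] _ /=; rewrite ord1.
Qed.

Lemma rsubmx_norm_le m n (v : 'rV[R]_(m + n)) : `|rsubmx v| <= `|v|.
Proof. by apply: row_norm_le => // j; rewrite mxE; exact: row_entry_le. Qed.

Lemma mulmx_norm_le n m (N : 'M[R]_(n, m)) :
  exists2 c : R, 0 < c & forall v : 'rV[R]_n, `|v *m N| <= c * `|v|.
Proof.
pose c : R := 1 + \sum_i \sum_j `|N i j|.
have s0 : 0 <= \sum_i \sum_j `|N i j| by do 2 (apply: sumr_ge0 => ? _).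
exists c; first by rewrite /c; lra.
move=> v; apply: row_norm_le => [|j].
  by rewrite mulr_ge0// /c; lra.
rewrite mxE; apply: (le_trans (ler_norm_sum _ _ _)).
apply: (@le_trans _ _ (\sum_i `|N i j| * `|v|)).
  by apply: ler_sum => i _; rewrite normrM mulrC ler_wpM2l// row_entry_le.
rewrite -mulr_suml ler_wpM2r// /c.
apply: (@le_trans _ _ (\sum_i \sum_j `|N i j|)); last lra.
apply: ler_sum => i _; rewrite (bigD1 j)//= lerDl.
by apply: sumr_ge0.
Qed.

Lemma enorm_le n (v : 'rV[R]_n) : enorm v <= n%:R * `|v|.
Proof.
rewrite /enorm -[leRHS]ger0_norm ?mulr_ge0// -sqrtr_sqr ler_wsqrtr//.
apply: (@le_trans _ _ (\sum_(j < n) `|v| ^+ 2)).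
  apply: ler_sum => j _; rewrite -(real_normK (num_real (v 0 j))).
  by rewrite ler_pXn2r ?nnegrE// row_entry_le.
rewrite sumr_const card_ord -[_ ^+ 2 *+ n]mulr_natl exprMn ler_wpM2r ?sqr_ge0//.
by rewrite -natrX ler_nat; case: n v => // n _; rewrite leq_pmulr.
Qed.

Lemma entry_le_enorm n (v : 'rV[R]_n) j : `|v 0 j| <= enorm v.
Proof.
rewrite /enorm -sqrtr_sqr ler_wsqrtr// (bigD1 j)//= lerDl.
by apply: sumr_ge0 => i _; exact: sqr_ge0.
Qed.

Lemma ball_rowP n (c : 'rV[R]_n) (e : R) u : ball c e u <-> `|c - u| < e.
Proof. by rewrite -ball_normE. Qed.

Section mean_value.
Context (n : nat) (F : 'rV[R]_n -> R) (c : 'rV[R]_n) (r : R).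
Hypothesis dF : forall u : 'rV[R]_n, ball c r u -> differentiable F u.

Let segment_ball (u v : 'rV[R]_n) (s : R) : ball c r u -> ball c r v -> 0 <= s <= 1 ->
  ball c r (v + s *: (u - v)).
Proof.
rewrite !ball_rowP => cu cv /andP[s0 s1].
have -> : c - (v + s *: (u - v)) = (1 - s) *: (c - v) + s *: (c - u).
  by apply/rowP => j; rewrite !mxE; ring.
have [->|sn1] := eqVneq s 1; first by rewrite subrr scale0r add0r scale1r.
apply: (le_lt_trans (ler_normD _ _)); rewrite !normrZ.
rewrite (ger0_norm s0) ger0_norm ?subr_ge0//.
have -> : r = (1 - s) * r + s * r by ring.
apply: ltr_leD; last by rewrite ler_wpM2l// ltW.
by rewrite ltr_pM2l// subr_gt0 lt_neqAle sn1.
Qed.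

Lemma derive_row u (v : 'rV[R]_n) : differentiable F u ->
  'D_v F u = \sum_j v 0 j * 'D_(delta_mx 0 j) F u.
Proof.
move=> dFu; rewrite deriveE// [in LHS](row_sum_delta v) linear_sum.
by apply: eq_bigr => j _; rewrite linearZ/= deriveE.
Qed.

(** The mean value theorem on the segment from [v] to [u], for a scalar function. This is enough for
    maps too, because the norm of row vectors is the maximum of the entries. *)
Lemma mean_value_le (a : 'I_n -> R) (e : R) :
  (forall (u : 'rV[R]_n) j, ball c r u -> `|'D_(delta_mx 0 j) F u - a j| <= e) ->
  forall u v : 'rV[R]_n, ball c r u -> ball c r v ->
  `|F u - F v - \sum_j (u - v) 0 j * a j| <= n%:R * e * `|u - v|.
Proof.
move=> Da u v cu cv.
pose g (s : R) := F (v + s *: (u - v)).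
have gD (s : R) : s \in `[0, 1] -> is_derive s 1 g ('D_(u - v) F (v + s *: (u - v))).
  rewrite in_itv/= => s01; have du := dF (segment_ball cu cv s01).
  have E : (fun h : R => h^-1 *: ((g \o shift s) (h *: 1) - g s)) =
      (fun h : R => h^-1 *: ((F \o shift (v + s *: (u - v))) (h *: (u - v)) - F (v + s *: (u - v)))).
    apply/funext => h; congr (_ *: (F _ - _)).
    rewrite /shift /= (_ : h%:A = h :> R); last by rewrite [LHS]mulr1.
    by apply/rowP => j; rewrite !mxE; ring.
  split; first by rewrite /derivable E; exact: diff_derivable.
  by rewrite /derive E.
have cg : {within `[0, 1], continuous g}.
  by apply: derivable_within_continuous => s s01; have [] := gD s s01.
have gDo (s : R) : s \in `]0, 1[ -> is_derive s 1 g ('D_(u - v) F (v + s *: (u - v))).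
  by rewrite in_itv/= => /andP[s0 s1]; apply: gD; rewrite in_itv/= !ltW.
have [s s01] := MVT_segment ler01 gDo cg.
have g1 : g 1 = F u by rewrite /g scale1r addrC subrK.
have g0 : g 0 = F v by rewrite /g scale0r addr0.
rewrite subr0 mulr1 g1 g0 => ->.
have sb := segment_ball cu cv; move: s01; rewrite in_itv/= => /sb {}sb.
rewrite derive_row; last exact: dF.
rewrite -sumrB; apply: (le_trans (ler_norm_sum _ _ _)).
apply: (@le_trans _ _ (\sum_(j < n) `|u - v| * e)).
  apply: ler_sum => j _; rewrite -mulrBr normrM ler_pM//; last exact: Da.
  exact: row_entry_le.
by rewrite sumr_const card_ord -[_ * _ *+ n]mulr_natl mulrCA mulrC.
Qed.

End mean_value.

Section contraction_zero.
Context (n : nat) (G : 'rV[R]_n -> 'rV[R]_n) (c : 'rV[R]_n) (r : R).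
Hypothesis r0 : 0 < r.
Hypothesis contr : forall u v : 'rV[R]_n, ball c r u -> ball c r v ->
  `|G u - G v - (u - v)| <= `|u - v| / 2.

Lemma contraction_dist_le (u v : 'rV[R]_n) : ball c r u -> ball c r v ->
  `|u - v| <= 2 * `|G u - G v|.
Proof.
move=> cu cv; have := contr cu cv; rewrite distrC.
have := ler_normB (u - v) (u - v - (G u - G v)); rewrite subKr => h1 h2.
have : `|u - v| <= `|u - v - (G u - G v)| + `|G u - G v|.
  by have := ler_normD (u - v - (G u - G v)) (G u - G v); rewrite subrK.
lra.
Qed.

(** The step from [u] to [u - G u] at least halves [|G|] and preserves the closed ball of radius
    [r / 2], where [r / 4] comes from the contraction and [r / 4] from [G c]. By compactness [|G|]
    has a minimiser there; since the step cannot decrease its value, that value is 0. *)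
Lemma contraction_zero_exists : `|G c| <= r / 4 ->
  exists2 u, ball c r u & G u = 0.
Proof.
move=> Gc; pose U := closed_ball c (r / 2).
have r20 : 0 < r / 2 by rewrite divr_gt0.
have UE u : U u <-> `|c - u| <= r / 2.
  by rewrite /U closed_ballE.
have Ub u : U u -> ball c r u.
  move=> /UE cu; apply/ball_rowP; apply: le_lt_trans cu _; lra.
pose f u := u - G u.
have fU : {homo f : x / U x >-> U x}.
  move=> u Uu; apply/UE.
  have bc : ball c r c by apply: ballxx.
  have h := contr (Ub u Uu) bc.
  have -> : c - f u = (G u - G c - (u - c)) + G c.
    by rewrite /f; apply/rowP => j; rewrite !mxE; ring.
  apply: (le_trans (ler_normD _ _)).
  by move/UE: Uu; rewrite distrC => Uu; lra.
have UG (u : 'rV[R]_n) : U u -> `|G v| @[v --> u] --> `|G u|.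
  move=> /Ub cu; apply/(@cvgrPdist_le R R^o _ (nbhs u) (nbhs_filter u)) => e e0.
  have e3 : 0 < e / 2 by rewrite divr_gt0.
  near=> v.
  have cv : ball c r v by near: v; exact: (open_nbhs_nbhs (conj (ball_open c r) cu)).
  have uv : `|u - v| <= e / 2.
    by rewrite ltW//; apply/ball_rowP; near: v; exact: nbhsx_ballx.
  have := contr cu cv; have := ler_normD (G u - G v - (u - v)) (u - v).
  rewrite subrK; have := ler_dist_dist (G u) (G v); lra.
have cU : compact U.
  apply: bounded_closed_compact; last exact: closed_ball_closed.
  exists (`|c| + r / 2); split; first exact: num_real.
  move=> M HM u /UE; have := ler_normB c (c - u); rewrite subKr.
  by move=> h1 h2; rewrite /= (le_trans h1)// (le_trans _ (ltW HM))// lerD2l.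
have [|u /set_mem Uu umin] :=
    EVT_min_rV (f := fun u => `|G u|) _ cU
      (continuous_in_subspaceT (fun u Uu => UG u (set_mem Uu))).
  by exists c; apply/UE; rewrite subrr normr0 ltW.
exists u; first exact: Ub.
have := umin (f u) (mem_set (fU _ Uu)).
have := contr (Ub _ (fU _ Uu)) (Ub _ Uu).
rewrite /f [u - _ - u]addrAC subrr add0r opprK subrK normrN => h1 h2.
by apply/eqP; rewrite -normr_le0; lra.
Unshelve. all: by end_near. Qed.

End contraction_zero.

Section partial_derivatives.
Context (n m : nat).
Implicit Types F G : 'rV[R]_n -> 'rV[R]_m.

Lemma differentiable_entry F t i : differentiable F t ->
  differentiable (fun u => F u 0 i) t.
Proof.
move=> dF; apply: (@differentiable_comp _ _ _ _ F (fun v : 'rV[R]_m => v 0 i)) => //.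
exact: differentiable_coord.
Qed.

Lemma differentiable_row F t : (forall i, differentiable (fun u => F u 0 i) t) ->
  differentiable F t.
Proof.
move=> dF; have -> : F = \sum_i (fun u => F u 0 i *: delta_mx 0 i).
  by apply/funext => u; rewrite fct_sumE [LHS]row_sum_delta.
apply: differentiable_sum => i; exact: differentiableZl.
Qed.

Lemma pderivE F t i j : differentiable F t ->
  pderiv F t i j = 'D_(delta_mx 0 j) (fun u => F u 0 i) t.
Proof.
move=> dF; rewrite /pderiv mxE.
have -> : 'J F t j i = ('D_(delta_mx 0 j) F t) 0 i.
  by rewrite deriveEjacobian// -rowE [RHS]mxE.
by rewrite derive_mx ?mxE//; exact: diff_derivable.
Qed.

Lemma eq_entry_pderiv F G t i j : differentiable F t -> differentiable G t ->
  (forall u, F u 0 i = G u 0 i) -> pderiv F t i j = pderiv G t i j.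
Proof.
move=> dF dG /funext FG; apply: (etrans (pderivE i j dF)).
apply: (etrans _ (esym (pderivE i j dG))).
exact: (congr1 (fun g => 'D_(delta_mx 0 j) g t) FG).
Qed.

End partial_derivatives.

End row_vectors.

(** * Countable dense sets of parameters and measurable zeros *)

Section dense_points.
Context (R : realType) (n : nat) (c : 'rV[R]_n) (r : R).

(** Enumerates the rational points of the ball. Indices that encode no rational point of the ball
    are sent to the centre, unless they decode by default to the origin inside it; every index thus
    gives a point of the ball, and suprema run over plain sequences. *)
Definition dense_pt (i : nat) : 'rV[R]_n :=
  let v := map_mx ratr (odflt 0 (unpickle i) : 'rV[rat]_n) in
  if `[< ball c r v >] then v else c.

Lemma dense_pt_ball i : 0 < r -> ball c r (dense_pt i).
Proof.
by rewrite /dense_pt; case: asboolP => // _ r0; exact: ballxx.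
Qed.

Lemma dense_ptP (u : 'rV[R]_n) (e : R) : ball c r u -> 0 < e ->
  exists i, ball u e (dense_pt i).
Proof.
move=> cu e0; have /nbhs_ballP[d/= d0 ud] : nbhs u (ball c r).
  exact: (open_nbhs_nbhs (conj (ball_open c r) cu)).
have m0 : 0 < Num.min d e by rewrite lt_min d0.
have /choice[q qu] : forall j, exists q : rat,
    ratr q \in `]u 0 j, u 0 j + Num.min d e[.
  by move=> j; apply: rat_in_itvoo; rewrite ltrDl.
have uv (e' : R) : Num.min d e <= e' -> ball u e' (map_mx ratr (\row_j q j)).
  move=> me'; split; first exact: lt_le_trans me'.
  move=> i j; rewrite ord1 /ball/= !mxE; have := qu j; rewrite in_itv/=.
  by rewrite distrC ltr_distl => /andP[? ?]; apply/andP; split; lra.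
exists (pickle (\row_j q j)); rewrite /dense_pt pickleK/=.
by case: asboolP => [_|[]]; [|apply: ud]; apply: uv; rewrite ge_min lexx ?orbT.
Qed.

End dense_points.

Section supremum.
Context (R : realType).

Lemma sups0 (u : nat -> R) : sups u 0%N = sup (range u).
Proof. by congr sup; apply/seteqP; split=> [_ [k _ <-]|_ [k _ <-]]; exists k. Qed.

Lemma infs0 (u : nat -> R) : infs u 0%N = inf (range u).
Proof. by congr inf; apply/seteqP; split=> [_ [k _ <-]|_ [k _ <-]]; exists k. Qed.

End supremum.

Section zero_of_contraction.
Context (R : realType) (n : nat) (c : 'rV[R]_n) (r : R).
Hypothesis r0 : 0 < r.
Implicit Types G : 'rV[R]_n -> 'rV[R]_n.
Local Notation v := (dense_pt c r).

Definition contracting G := forall u w : 'rV[R]_n, ball c r u -> ball c r w ->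
  `|G u - G w - (u - w)| <= `|u - w| / 2.

(** Countably many inequalities, hence a measurable condition on the data; for continuous [G] it is
    equivalent to [contracting]. *)
Definition dense_contracting G := forall i k,
  `|G (v i) - G (v k) - (v i - v k)| <= `|v i - v k| / 2.

Lemma contracting_dense G : contracting G -> dense_contracting G.
Proof. by move=> GG i k; apply: GG; exact: dense_pt_ball. Qed.

(** Moving the two values changes their difference by at most [2 * e / 5], moving the two points
    does the same, and the latter enters once more, halved, through the right-hand side: in all
    [e]. *)
Let defect_perturb (a b s t a' b' s' t' : 'rV[R]_n) (e : R) :
  `|a' - b' - (s' - t')| <= `|s' - t'| / 2 ->
  `|a - a'| <= e / 5 -> `|b' - b| <= e / 5 ->
  `|s - s'| <= e / 5 -> `|t' - t| <= e / 5 ->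
  `|a - b - (s - t)| <= `|s - t| / 2 + e.
Proof.
move=> h aa bb ss tt.
have E (x y x' y' : 'rV[R]_n) : x - y = (x' - y') + ((x - x') + (y' - y)).
  by rewrite addrCA !subrKA.
have N (x y x' y' : 'rV[R]_n) : `|x - x'| <= e / 5 -> `|y' - y| <= e / 5 ->
    `|x - y - (x' - y')| <= e / 5 + e / 5.
  move=> h1 h2; rewrite (E x y x' y') addrAC subrr add0r.
  by apply: (le_trans (ler_normD _ _)); exact: lerD.
have h1 := N a b a' b' aa bb.
have h3 := N s' t' s t; rewrite ![`|s' - _|]distrC ![`|t - _|]distrC in h3.
have {}h3 := h3 ss tt.
have h4 : `|a - b - (s - t)| <= `|a' - b' - (s' - t')| +
    (`|a - b - (a' - b')| + `|s' - t' - (s - t)|).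
  rewrite [X in `|X|](E _ _ (a' - b') (s' - t')).
  by apply: (le_trans (ler_normD _ _)); rewrite lerD2l ler_normD.
have h5 : `|s' - t'| <= `|s - t| + `|s' - t' - (s - t)|.
  by rewrite -[X in `|X| <= _](subrKC (s - t)) ler_normD.
move: h h1 h3 h4 h5; move: (`|s' - t' - (s - t)|) (`|a - b - (a' - _)|).
move: (`|s - t|) (`|s' - t'|) (`|a' - b' - _|) (`|a - b - (s - t)|).
by move=> *; lra.
Qed.

Lemma dense_contracting_ball G :
  (forall u : 'rV[R]_n, ball c r u -> {for u, continuous G}) ->
  dense_contracting G -> contracting G.
Proof.
move=> cG GG u w cu cw; apply/ler_addgt0Pr => e e0.
have e5 : 0 < e / 5 by rewrite divr_gt0.
have near_pt (s : 'rV[R]_n) : ball c r s ->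
    exists i, `|s - v i| <= e / 5 /\ `|G s - G (v i)| <= e / 5.
  move=> cs; have := cG s cs.
  move=> /(@cvgrPdist_le R _ _ (nbhs s) (nbhs_filter s))/(_ _ e5).
  move=> /nbhs_ballP[x /= x0 sx].
  have m0 : 0 < Num.min x (e / 5) by rewrite lt_min x0.
  have [i si] := dense_ptP cs m0.
  exists i; split; last by apply: sx; apply: le_ball si; rewrite ge_min lexx.
  move/ball_rowP : si => /ltW si; apply: (le_trans si).
  by rewrite ge_min lexx orbT.
have [i [ui Gui]] := near_pt u cu; have [k [wk Gwk]] := near_pt w cw.
rewrite distrC in wk; rewrite distrC in Gwk.
exact: (@defect_perturb _ _ _ _ _ _ _ _ e (GG i k) Gui Gwk ui wk).
Qed.

(* On a contraction the zero z satisfies z_j <= u_j + 2 |G u| for all u, with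
   equality at u = z: it is an infimum over countably many u, hence measurable
   in the data. *)
Definition zero_est G : 'rV[R]_n := \row_j
  inf (range (fun i => v i 0 j + 2 * `|G (v i)|)).

Lemma zero_estP G : contracting G -> `|G c| <= r / 4 ->
  ball c r (zero_est G) /\ G (zero_est G) = 0.
Proof.
move=> GG Gc; have [z cz Gz] := contraction_zero_exists r0 GG Gc.
suff -> : zero_est G = z by [].
apply/rowP => j; rewrite mxE.
have lb i : z 0 j <= v i 0 j + 2 * `|G (v i)|.
  have := contraction_dist_le GG cz (dense_pt_ball c i r0).
  rewrite Gz sub0r normrN; have := row_entry_le (z - v i) j.
  by rewrite !mxE; have := ler_norm (z 0 j - v i 0 j); lra.
apply/eqP; rewrite eq_le; apply/andP; split.
  (* At a point [v i] within [e / 4] of the zero, the contraction gives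
     [|G (v i)| <= 3 / 2 * (e / 4)], so that the expression under the infimum exceeds [z 0 j] by at
     most [e / 4 + 3 * e / 4]. *)
  apply/ler_addgt0Pr => e e0; have e4 : 0 < e / 4 by rewrite divr_gt0.
  have [i zi] := dense_ptP cz e4; move/ball_rowP/ltW : zi => zi.
  apply: (@le_trans _ _ (v i 0 j + 2 * `|G (v i)|)).
    by apply: ge_inf; [exists (z 0 j) => _ [k _ <-]; exact: lb|exists i].
  have := GG z (v i) cz (dense_pt_ball c i r0).
  rewrite Gz sub0r; have := ler_normD (- G (v i) - (z - v i)) (z - v i).
  rewrite subrK normrN; have := row_entry_le (z - v i) j.
  rewrite !mxE; have := ler_norm (- (z 0 j - v i 0 j)); rewrite normrN; lra.
apply: lb_le_inf; first by exists (v 0 0 j + 2 * `|G (v 0)|), 0%N.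
by move=> _ [i _ <-]; exact: lb.
Qed.

Lemma contraction_zero_unique G u w : contracting G ->
  ball c r u -> ball c r w -> G u = 0 -> G w = 0 -> u = w.
Proof.
move=> GG cu cw Gu Gw; have := contraction_dist_le GG cu cw.
by rewrite Gu Gw subrr normr0 mulr0 normr_le0 subr_eq0 => /eqP.
Qed.

Section measurability.
Context (d : measure_display) (T : measurableType d).
Variable (G : T -> 'rV[R]_n -> 'rV[R]_n).
Hypothesis mG : forall (u : 'rV[R]_n) j, ball c r u ->
  measurable_fun setT (fun y => G y u 0 j).

Lemma measurable_row_norm (H : T -> 'rV[R]_n) :
  (forall j, measurable_fun setT (fun y => H y 0 j)) ->
  measurable_fun setT (fun y => `|H y|).
Proof.
move=> mH; rewrite (_ : (fun y => _) = fun y =>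
  \big[Num.max/0]_(ij : 'I_1 * 'I_n) `|H y ij.1 ij.2|); last first.
  by apply/funext => y; rewrite [LHS]/Num.Def.normr/= mx_normrE.
elim: (index_enum _) => [|ij s IH].
  by under eq_fun do rewrite big_nil; exact: measurable_cst.
under eq_fun do rewrite big_cons; apply: measurable_maxr => //.
by apply: measurableT_comp => //; rewrite ord1.
Qed.

Let mGv i j : measurable_fun setT (fun y => G y (v i) 0 j).
Proof. by apply: mG; exact: dense_pt_ball. Qed.

Lemma measurable_zero_est j : measurable_fun setT (fun y => zero_est (G y) 0 j).
Proof.
under eq_fun do rewrite mxE -infs0.
apply: (@measurable_fun_infs _ _ _ _ (fun i y => v i 0 j + 2 * `|G y (v i)|)) => [y _|i].
  exists (c 0 j - r) => _ [i _ <-]; have /ball_rowP := dense_pt_ball c i r0.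
  have := row_entry_le (c - v i) j; rewrite !mxE => h1 h2.
  have := ler_norm (c 0 j - v i 0 j); have := normr_ge0 (G y (v i)).
  by move: h1 h2; set x := `|c - _|; lra.
apply: measurable_funD => //; apply: measurable_funM => //.
by apply: measurable_row_norm => j'; exact: mGv.
Qed.

Lemma measurable_dense_contracting :
  measurable [set y | dense_contracting (G y) /\ `|G y c| <= r / 4].
Proof.
have mle (f : T -> R) (x : R) : measurable_fun setT f -> measurable [set y | f y <= x].
  move=> mf; rewrite -[X in measurable X]setTI.
  rewrite (_ : [set y | f y <= x] = f @^-1` [set` `]-oo, x]]).
    by apply: mf => //; exact: measurable_itv.
  by apply/seteqP; split => y /=; rewrite in_itv.
apply: measurableI; last first.
  apply: mle; apply: measurable_row_norm => j; apply: mG; exact: ballxx.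
rewrite (_ : (fun y => dense_contracting (G y)) = \bigcap_i \bigcap_k
  [set y | `|G y (v i) - G y (v k) - (v i - v k)| <= `|v i - v k| / 2]); last first.
  apply/seteqP; split => y /=; first by move=> Gy i _ k _; exact: Gy.
  by move=> Gy i k; exact: Gy.
do 2 (apply: bigcapT_measurable => ?); apply: mle.
apply: measurable_row_norm => j; under eq_fun do rewrite !mxE.
by apply: measurable_funB => //; apply: measurable_funB; exact: mGv.
Qed.

End measurability.

End zero_of_contraction.

(** By the mean value bound, [k *: F] differs from the linear map [A^T] by at most [n * e] times the
    distance; multiplying by [N], the inverse of [A^T], costs a factor [b], and
    [b * n * e <= 1 / 2]. The tolerance [e] depends on [A] and [N] alone, so it can be fixed before
    the ball and the sample size. [n.+1] avoids a zero denominator in dimension 0. *)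
Lemma jacobian_contracting (R : realType) n (A N : 'M[R]_n) : A^T *m N = 1%:M ->
  exists2 e : R, 0 < e & forall (F : 'rV[R]_n -> 'rV[R]_n) (k : R) (c : 'rV[R]_n) r,
    (forall u : 'rV[R]_n, ball c r u -> differentiable F u) ->
    (forall (u : 'rV[R]_n) i j, ball c r u -> `|k * pderiv F u i j - A i j| <= e) ->
    contracting c r (fun u => (k *: F u) *m N).
Proof.
move=> AN; have [b b0 bN] := mulmx_norm_le N.
have nb : 0 < 2 * b * n.+1%:R by rewrite !mulr_gt0.
exists (2 * b * n.+1%:R)^-1; first by rewrite invr_gt0.
set e := _^-1 => F k c r dF HF u w cu cw.
have e0 : 0 <= e by rewrite invr_ge0 ltW.
pose v := k *: F u - k *: F w - (u - w) *m A^T.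
have -> : (k *: F u) *m N - (k *: F w) *m N - (u - w) = v *m N.
  by rewrite /v mulmxBl -mulmxA AN mulmx1 mulmxBl.
apply: (le_trans (bN v)).
have vle : `|v| <= n%:R * e * `|u - w|.
  apply: row_norm_le => [|i]; first by rewrite !mulr_ge0.
  have dFi (s : 'rV[R]_n) : ball c r s -> differentiable (fun t => F t 0 i) s.
    by move=> cs; apply: differentiable_entry; exact: dF.
  have dkF (s : 'rV[R]_n) : ball c r s -> differentiable (fun t => k *: F t 0 i) s.
    by move=> cs; apply: differentiableZ; exact: dFi.
  have := mean_value_le dkF (a := A i) (e := e) _ cu cw.
  rewrite /v !mxE; under eq_bigr do rewrite !mxE.
  under [X in _ -> `|_ - X| <= _]eq_bigr do rewrite !mxE.
  apply=> s j cs; have := HF s i j cs; rewrite pderivE; last exact: dF.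
  rewrite deriveZ//; apply: diff_derivable; exact: dFi.
apply: (@le_trans _ _ (b * (n%:R * e * `|u - w|))); first by rewrite ler_pM2l.
rewrite !mulrA [leRHS]mulrC ler_wpM2r//.
rewrite /e !invfM.
have -> : b * n%:R * (2^-1 * b^-1 * n.+1%:R^-1) = 2^-1 * (n%:R / n.+1%:R) * (b / b) by ring.
rewrite divff ?gt_eqF// mulr1 ler_piMr// ler_pdivrMr// mul1r ler_nat.
exact: leqnSn.
Qed.

(** * Uniform law of large numbers *)

Section uniform_lln.
Context (R : realType) (d : measure_display) (Omega : measurableType d).
Variable P : probability Omega R.
Context (dU : measure_display) (U : measurableType dU).
Variable zeta : nat -> Omega -> U.
Hypothesis mzeta : forall i, measurable_fun setT (zeta i).
Hypothesis llnP : forall f : U -> R, measurable_fun setT f ->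
  P.-integrable setT (EFin \o (f \o zeta 0%N)) -> lln P zeta f.
Variables (n : nat) (g : 'rV[R]_n -> U -> R) (k : U -> R).
Variables (c : 'rV[R]_n) (r : R).
Hypothesis r0 : 0 < r.
Hypothesis mg : forall u : 'rV[R]_n, ball c r u -> measurable_fun setT (g u).
Hypothesis cg : forall (z : U) (u : 'rV[R]_n), ball c r u ->
  {for u, continuous (g ^~ z)}.
Hypothesis gk : forall (u : 'rV[R]_n) z, ball c r u -> `|g u z| <= k z.
Hypothesis ik : P.-integrable setT (EFin \o (k \o zeta 0%N)).

Let bc : ball c r c. Proof. exact: ballxx. Qed.

(* The oscillation of g on a ball is a supremum over countably many parameters,
   hence measurable. *)
Let devs (e : R) z i := `|g (dense_pt c e i) z - g c z|.
Let osc (e : R) (z : U) : R := sup (range (devs e z)).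

Let k0 z : 0 <= k z. Proof. exact: le_trans (gk z bc). Qed.

Let dev_le e z i : 0 < e -> e <= r -> devs e z i <= 2 * k z.
Proof.
move=> e0 er; have b := le_ball er (dense_pt_ball c i e0).
by apply: (le_trans (ler_normB _ _)); rewrite mulr2n mulrDl !mul1r lerD// gk.
Qed.

Let dev_ub e z : 0 < e -> e <= r -> has_ubound (range (devs e z)).
Proof. by move=> e0 er; exists (2 * k z) => _ [i _ <-]; exact: dev_le. Qed.

Let osc_ge0 e z : 0 < e -> e <= r -> 0 <= osc e z.
Proof.
move=> e0 er; apply: (@le_trans _ _ (devs e z 0%N)); first exact: normr_ge0.
by apply: ub_le_sup; [exact: dev_ub|exists 0%N].
Qed.

Let osc_le e z x : 0 < e -> e <= r -> (forall u : 'rV[R]_n, ball c e u -> `|g u z - g c z| <= x) ->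
  osc e z <= x.
Proof.
move=> e0 er ux; apply: ge_sup; first by exists (devs e z 0%N), 0%N.
by move=> _ [i _ <-]; apply: ux; exact: dense_pt_ball.
Qed.

Let le_osc e z (u : 'rV[R]_n) : 0 < e -> e <= r -> ball c e u -> `|g u z - g c z| <= osc e z.
Proof.
move=> e0 er cu; apply/ler_addgt0Pr => x x0.
have := @cg z u (le_ball er cu); move=> /(@cvgrPdist_le R R^o _ (nbhs u) (nbhs_filter u)).
move=> /(_ x x0)/nbhs_ballP[x' /= x'0 ux'].
have [i ui] := dense_ptP cu x'0.
have := ler_normD (g u z - g (dense_pt c e i) z) (g (dense_pt c e i) z - g c z).
rewrite addrA subrK => /le_trans; apply; rewrite addrC lerD//; last exact: ux'.
by apply: ub_le_sup; [exact: dev_ub|exists i].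
Qed.

Let measurable_osc e : 0 < e -> e <= r -> measurable_fun setT (osc e).
Proof.
move=> e0 er; have -> : osc e = (fun z => sups (devs e z) 0%N).
  by apply/funext => z; rewrite sups0.
apply: (@measurable_fun_sups _ _ _ _ (fun i z => devs e z i)) => [z _|i].
  exact: dev_ub.
apply: measurableT_comp => //; apply: measurable_funB; apply: mg => //.
exact: le_ball er _ (dense_pt_ball c i e0).
Qed.

Let dl (m : nat) : R := r / m.+1%:R.
Let dl0 m : 0 < dl m. Proof. by rewrite divr_gt0. Qed.
Let dlr m : dl m <= r.
Proof. by rewrite ler_pdivrMr// ler_peMr ?ler1n// ltW. Qed.

Let osc_cvg z : osc (dl m) z @[m --> \oo] --> (0 : R).
Proof.
apply/cvgrPdist_le => e e0.
have := @cg z c bc; move=> /(@cvgrPdist_le R R^o _ (nbhs c) (nbhs_filter c)).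
move=> /(_ e e0)/nbhs_ballP[x /= x0 cx].
have [N _ HN] := near_infty_natSinv_lt (PosNum (divr_gt0 x0 r0)).
exists N => // m /= Nm; rewrite sub0r normrN ger0_norm; last exact: osc_ge0.
apply: osc_le => // u cu; rewrite distrC; apply: cx; apply: le_ball cu.
have := HN m Nm; rewrite /= ltr_pdivlMr// => /ltW.
by rewrite mulrC.
Qed.

Let ig (f : U -> R) x : measurable_fun setT f -> (forall z, `|f z| <= x * k z) ->
  P.-integrable setT (EFin \o (f \o zeta 0%N)).
Proof.
move=> mf fk; apply: (@le_integrable _ _ _ P setT measurableT _
    (fun w => x%:E * (k (zeta 0%N w))%:E)%E).
- by apply/measurable_EFinP; exact: measurableT_comp.
- move=> w _ /=; rewrite lee_fin; apply: le_trans (fk _) _; exact: ler_norm.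
- exact: integrableZl.
Qed.

(** As the radius shrinks, the oscillation tends to 0 pointwise and is dominated by [2 * k], so some
    radius makes its mean at most [e / 3]. Fluctuations of the averages of the oscillation and of
    [g c] take the other two thirds: on that ball the average of [g u] differs from that of [g c] by
    at most the average oscillation. *)
Lemma uniform_lln (e : R) : 0 < e -> exists2 dlt : R, 0 < dlt <= r &
  wp_to_one P (fun m => [set w | forall u : 'rV[R]_n, ball c dlt u ->
    `|average zeta (g u) m w - mean0 P zeta (g c)| <= e]).
Proof.
move=> e0; have mosc m : measurable_fun setT (osc (dl m)) by exact: measurable_osc.
have iosc m : P.-integrable setT (EFin \o (osc (dl m) \o zeta 0%N)).
  apply: (@ig _ 2) => // z; rewrite ger0_norm; last exact: osc_ge0.
  by apply: osc_le => // u cu; have := ler_normB (g u z) (g c z);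
     have := gk z (le_ball (dlr m) cu); have := gk z bc; lra.
have : mean0 P zeta (osc (dl m)) @[m --> \oo] --> (0 : R).
  have : (\int[P]_w (osc (dl m) (zeta 0%N w))%:E)%E @[m --> \oo] -->
      (\int[P]_w (cst 0 w))%E.
    apply: (@dominated_cvg _ _ _ P setT measurableT _ _
        (fun w => 2%:E * (k (zeta 0%N w))%:E)%E).
    - by move=> m; apply/measurable_EFinP; exact: measurableT_comp.
    - move=> w _; apply: cvg_EFin; first by apply: nearW.
      exact: osc_cvg.
    - by [].
    - exact: integrableZl.
    - move=> m w _ /=; rewrite lee_fin ger0_norm; last exact: osc_ge0.
      apply: osc_le => // u cu; have := ler_normB (g u (zeta 0%N w)) (g c (zeta 0%N w)).
      by have := gk (zeta 0%N w) (le_ball (dlr m) cu); have := gk (zeta 0%N w) bc; lra.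
  rewrite integral0 => /fine_cvgP[_]; exact.
move=> /cvgrPdist_le/(_ (e / 3)); rewrite divr_gt0// => /(_ isT)[N _ /(_ N (leqnn N))].
rewrite sub0r normrN => oscN.
exists (dl N); first by rewrite dl0 dlr.
have e3 : 0 < e / 3 by rewrite divr_gt0.
have mgc := mg bc.
have igc : P.-integrable setT (EFin \o (g c \o zeta 0%N)).
  by apply: (@ig _ 1) => // z; rewrite mul1r gk.
apply: wp_to_one_sub (wp_to_oneI (lln_wp mzeta (mosc N) (llnP (mosc N) (iosc N)) e3)
   (lln_wp mzeta mgc (llnP mgc igc) e3)) _ => m w [/= h1 h2] u cu.
have h3 : average zeta (g u \- g c) m w <= average zeta (osc (dl N)) m w.
  by apply: le_average => z; apply: le_trans (ler_norm _) _; exact: le_osc.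
have h4 : average zeta (g c \- g u) m w <= average zeta (osc (dl N)) m w.
  by apply: le_average => z; apply: le_trans (ler_norm _) _; rewrite distrC; exact: le_osc.
move: h1 h2 h3 h4 oscN; rewrite !averageB !ler_norml.
by move=> /andP[? ?] /andP[? ?] ? ? /andP[? ?]; apply/andP; split; lra.
Qed.

End uniform_lln.

Section integral_ae.
Context d (T : measurableType d) (R : realType).
Variable mu : {measure set T -> \bar R}.
Local Open Scope ereal_scope.
Import HBNNSimple.

Let nnintegral (f : T -> \bar R) := ereal_sup [set sintegral mu h |
  h in [set h : {nnsfun T >-> R} | forall x, (h x)%:E <= f x]].

(** A simple function below [f], multiplied by the indicator of the complement of the null set, lies
    below [g] everywhere and keeps its integral. *)
Let nnintegral_ae_le (f g : T -> \bar R) : (forall x, 0 <= g x) ->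
  {ae mu, forall x, f x <= g x} -> nnintegral f <= nnintegral g.
Proof.
move=> g0 [N [mN N0 sN]]; apply: ge_ereal_sup => _ [h hf <-].
have mNC : measurable (~` N) by exact: measurableC.
pose h' := proj_nnsfun h mNC.
have -> : sintegral mu h = sintegral mu h'.
  rewrite -!integralT_nnsfun; apply: ae_eq_integral => //.
  - by apply/measurable_EFinP.
  - by apply/measurable_EFinP.
  exists N; split => // x /= nh; apply: contrapT => Nx; apply: nh => _.
  by rewrite mindicE mem_set// mulr1.
apply: ereal_sup_ubound; exists h' => // x /=.
rewrite mindicE; have [xN|xN] := boolP (x \in ~` N); last by rewrite mulr0.
rewrite mulr1; apply: (le_trans (hf x)); apply: contrapT => nfg.
by move/set_mem : xN; apply; exact: sN.
Qed.

(* The library's [ae_eq_integral] asks for measurable functions. *)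
Lemma integral_ae_congr (f g : T -> \bar R) : {ae mu, forall x, f x = g x} ->
  \int[mu]_x f x = \int[mu]_x g x.
Proof.
move=> fg; rewrite /integral !patch_setT.
rewrite -/(nnintegral f^\+) -/(nnintegral f^\-) -/(nnintegral g^\+) -/(nnintegral g^\-).
congr (_ - _); apply/eqP; rewrite eq_le.
  apply/andP; split; apply: nnintegral_ae_le => //; apply: filterS fg => x fgx;
    by rewrite !funeposE fgx.
apply/andP; split; apply: nnintegral_ae_le => //; apply: filterS fg => x fgx;
  by rewrite !funenegE fgx.
Qed.

End integral_ae.

(** * Moments and averages of functions of the observed pairs *)

Section pair_moments.
Context (R : realType) (l r : \bar R) (S : set R).
Context (d : measure_display) (Omega : measurableType d).
Variables (P : probability Omega R) (D : diffusion R) (phi : R -> R)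
  (p : R -> R -> R -> R) (X T : R -> Omega -> R).
Hypothesis HM : subordinate_model P l r S D phi p X T.
Variables (Delta : R) (Delta0 : 0 < Delta).
Local Notation J := (oitv l r).
Local Notation leb := (@lebesgue_measure R).
Local Notation Y := (subordinated X T).
Local Notation mR := (measurableTypeR R).
Local Notation zeta := (obs_pair X T Delta).
Local Notation obs := (observations Y Delta).
Local Notation Q := (fun x y => sdens D x * p Delta x y).
Implicit Types g : R -> R -> R.

(** The estimating functions are measurable on [J]*[J] only. Almost surely all observations lie in
    [J], so the extension by 0 alters neither averages nor expectations. *)
Definition kerJ g : mR * mR -> R := (fun z : R * R => g z.1 z.2) \_ (J `*` J).

Lemma kerJE g x y : J x -> J y -> kerJ g (x, y) = g x y.
Proof. by move=> Jx Jy; rewrite /kerJ patchE mem_set. Qed.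

Lemma kerJ_notin g z : ~ (J `*` J) z -> kerJ g z = 0.
Proof. by move=> Jz; rewrite /kerJ patchE memNset. Qed.

Let mJJ : measurable (J `*` J : set (R * R)).
Proof. by apply: measurableX; exact: measurable_oitv. Qed.

Lemma measurable_kerJ g : measurable_fun (J `*` J) (fun z : R * R => g z.1 z.2) ->
  measurable_fun setT (kerJ g).
Proof. by move=> mg; exact: (measurable_restrictT _ mJJ).1 mg. Qed.

Lemma ae_obs_J : {ae P, forall w, forall i : nat, J (Y (i%:R * Delta) w)}.
Proof.
by apply: ae_foralln => i; apply: (ae_Y HM); rewrite mulr_ge0// ltW.
Qed.

Lemma nth_obs n w i : (i <= n)%N -> (obs n w)`_i = Y (i%:R * Delta) w.
Proof.
move=> i_n; have im : (i < n.+1)%N by [].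
by rewrite -[i in LHS]/(nat_of_ord (Ordinal im)) -tnth_nth tnth_mktuple.
Qed.

Lemma measurable_obs n : measurable_fun setT (obs n).
Proof.
apply/measurable_fun_tnthP => i.
rewrite (_ : _ \o _ = Y (i%:R * Delta)); last first.
  by apply/funext => w; rewrite /= tnth_mktuple.
by apply: (measurable_Y HM); rewrite mulr_ge0// ltW.
Qed.

Lemma average_kerJ g n w : (forall i : nat, J (Y (i%:R * Delta) w)) ->
  average zeta (kerJ g) n w = n%:R^-1 * \sum_(i < n) g (obs n w)`_i (obs n w)`_i.+1.
Proof.
move=> wJ; congr (_ * _); apply: eq_bigr => i _.
by rewrite kerJE// !nth_obs// ltnW.
Qed.

Lemma ae_kerJ g : {ae P, forall w, g (Y 0 w) (Y Delta w) = kerJ g (zeta 0%N w)}.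
Proof.
apply: filterS ae_obs_J => w wJ; have := wJ 0%N; have := wJ 1%N.
by rewrite mul0r mul1r => J1 J0; rewrite obs_pair0 kerJE.
Qed.

(** The left-hand integrand may fail to be measurable, since [g] is arbitrary off [J]; this is why
    the almost sure equality goes through [integral_ae_congr]. *)
Lemma expectation_kerJ g :
  ('E_P[fun w => g (Y 0 w) (Y Delta w)] = \int[P]_w (kerJ g (zeta 0%N w))%:E)%E.
Proof.
rewrite unlock; apply: integral_ae_congr.
by apply: filterS (ae_kerJ g) => w ->.
Qed.

Lemma Epair_kerJ g : Epair Delta P Y g = mean0 P zeta (kerJ g).
Proof. by rewrite /Epair expectation_kerJ. Qed.

Lemma integrable_kerJ g : Qintegrable l r Q g ->
  P.-integrable setT (EFin \o (kerJ g \o zeta 0%N)).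
Proof.
move=> [mg ig]; have mk := measurable_kerJ mg.
apply/integrableP; split.
  apply/measurable_EFinP.
  exact: (measurableT_comp mk (measurable_obs_pair HM Delta0 0%N)).
under eq_integral => w _ do rewrite obs_pair0.
rewrite (expect_pair HM (g := fun z => `|(kerJ g z)%:E|%E) Delta0)//; last first.
  by apply: measurableT_comp => //; exact/measurable_EFinP.
move/integrableP : ig => [_]; rewrite integral_mkcond; apply: le_lt_trans.
rewrite le_eqVlt; apply/orP; left; apply/eqP; apply: eq_integral => z _.
rewrite patchE; case: ifPn => [/set_mem[Jx Jy]|].
  have Qz : Qf l r D p Delta z = sdens D z.1 * p Delta z.1 z.2.
    by rewrite /Qf /qJ /pJ Delta0 !patchE !mem_set.
  have Q0 := Qf_ge0 HM Delta z; have gz : kerJ g z = g z.1 z.2.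
    by rewrite /kerJ patchE mem_set.
  by rewrite gz -Qz !abse_EFin -EFinM normrM (ger0_norm Q0) mulrC.
by move=> Jz; rewrite kerJ_notin ?abse0 ?mule0// => /mem_set; exact/negP.
Qed.

Lemma integrable_kerJ_sqr g : measurable_fun (J `*` J) (fun z : R * R => g z.1 z.2) ->
  Qintegrable l r Q (fun x y => g x y ^+ 2) ->
  P.-integrable setT (EFin \o (kerJ g \o zeta 0%N)).
Proof.
move=> mg /integrable_kerJ ig2; have mk := measurable_kerJ mg.
pose b w := ((1 : R)%:E + (kerJ (fun x y => g x y ^+ 2)%R (zeta 0%N w))%:E)%E.
apply: (@le_integrable _ _ _ P setT measurableT _ b).
- apply/measurable_EFinP.
  exact: (measurableT_comp mk (measurable_obs_pair HM Delta0 0%N)).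
- move=> w _; rewrite /b -EFinD !abse_EFin lee_fin.
  have -> : kerJ (fun x y => g x y ^+ 2) (zeta 0%N w) = kerJ g (zeta 0%N w) ^+ 2.
    by rewrite /kerJ !patchE; case: ifP => // _; rewrite expr0n.
  have := sqr_ge0 (`|kerJ g (zeta 0%N w)| - 1); rewrite sqrrB1 real_normK ?num_real//.
  have := sqr_ge0 (kerJ g (zeta 0%N w)); have := ler_norm (1 + kerJ g (zeta 0%N w) ^+ 2).
  rewrite /=; move: (kerJ g (zeta 0%N w)) => x.
  by rewrite mulr2n => ? ? ?; lra.
- apply: integrableD => //; apply/integrableP; split => //.
  by rewrite integral_prob_cst abse_EFin ltry.
Qed.

Lemma lln_obs g (e : R) : measurable_fun (J `*` J) (fun z : R * R => g z.1 z.2) ->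
  P.-integrable setT (EFin \o (kerJ g \o zeta 0%N)) -> 0 < e ->
  wp_to_one P (fun n => [set w |
    `|n%:R^-1 * \sum_(i < n) g (obs n w)`_i (obs n w)`_i.+1 - Epair Delta P Y g| <= e]).
Proof.
move=> mg ig e0; have mk := measurable_kerJ mg.
have H := lln_wp (measurable_obs_pair HM Delta0) mk (lln_obs_pair HM Delta0 mk ig) e0.
apply: wp_to_one_sub_ae H _; exists 0%N => n _.
apply: filterS ae_obs_J => w wJ /=.
by rewrite average_kerJ// Epair_kerJ.
Qed.

Lemma uniform_lln_obs m (g : 'rV[R]_m -> R -> R -> R) (c : 'rV[R]_m) (rad e : R) :
  0 < rad ->
  (forall u : 'rV[R]_m, ball c rad u ->
     measurable_fun (J `*` J) (fun z : R * R => g u z.1 z.2)) ->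
  (forall (u : 'rV[R]_m) x y, ball c rad u -> J x -> J y ->
     {for u, continuous (fun t => g t x y)}) ->
  (exists k, Qintegrable l r Q k /\
     forall (u : 'rV[R]_m) x y, ball c rad u -> J x -> J y -> `|g u x y| <= k x y) ->
  0 < e ->
  exists2 dlt : R, 0 < dlt <= rad & wp_to_one P (fun n => [set w |
    forall u : 'rV[R]_m, ball c dlt u ->
    `|n%:R^-1 * \sum_(i < n) g u (obs n w)`_i (obs n w)`_i.+1
      - Epair Delta P Y (g c)| <= e]).
Proof.
move=> rad0 mg cg [k [ik gk]] e0.
have mgJ (u : 'rV[R]_m) : ball c rad u -> measurable_fun setT (kerJ (g u)).
  by move=> cu; apply: measurable_kerJ; exact: mg.
have cgJ (z : mR * mR) (u : 'rV[R]_m) : ball c rad u ->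
    {for u, continuous (fun t => kerJ (g t) z)}.
  move=> cu; have [[Jx Jy]|nJ] := pselect ((J `*` J) z).
    have -> : (fun t => kerJ (g t) z) = (fun t => g t z.1 z.2).
      by apply/funext => t; rewrite /kerJ patchE mem_set.
    exact: cg.
  have -> : (fun t => kerJ (g t) z) = cst 0.
    by apply/funext => t; rewrite kerJ_notin.
  exact: cst_continuous.
have gkJ (u : 'rV[R]_m) z : ball c rad u -> `|kerJ (g u) z| <= kerJ k z.
  move=> cu; rewrite /kerJ !patchE; case: ifPn => [/set_mem[Jx Jy]|_].
    exact: gk.
  by rewrite normr0.
have [dlt dlt0 H] := uniform_lln (measurable_obs_pair HM Delta0)
  (lln_obs_pair HM Delta0) rad0 mgJ cgJ gkJ (integrable_kerJ ik) e0.
exists dlt => //; apply: wp_to_one_sub_ae H _; exists 0%N => n _.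
apply: filterS ae_obs_J => w wJ H u cu.
by have := H u cu; rewrite average_kerJ// Epair_kerJ.
Qed.

End pair_moments.

(** * Eigenfunction martingale differences *)

Section martingale_differences.
Context (R : realType) (l r : \bar R) (S : set R).
Context (d : measure_display) (Omega : measurableType d).
Variables (P : probability Omega R) (D : diffusion R) (phi : R -> R)
  (p : R -> R -> R -> R) (X T : R -> Omega -> R).
Hypothesis HM : subordinate_model P l r S D phi p X T.
Variables (Delta : R) (Delta0 : 0 < Delta).
Variables (M : nat) (a : 'I_M -> R -> R).
Hypothesis ma : forall m, measurable_fun (oitv l r) (a m).
Local Notation J := (oitv l r).
Local Notation leb := (@lebesgue_measure R).
Local Notation Y := (subordinated X T).
Local Notation mR := (measurableTypeR R).
Local Notation zeta := (obs_pair X T Delta).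
Local Notation mJ := (measurable_oitv l r).

(** One component of [f2]: the weights [a m] are the entries of a column of the matrix [W],
    evaluated at the earlier observation. *)
Definition mart_diff (x y : R) : R :=
  \sum_(m < M) a m x * (eigfun D m.+1 y - rho D phi m.+1 Delta * eigfun D m.+1 x).

Let kappaJ x : kappa HM Delta x J = kappa HM Delta x setT.
Proof.
rewrite !kappaE integral_mkcond; apply: eq_integral => y _.
rewrite patchE; case: ifPn => // yJ; rewrite /pJ Delta0 patchE memNset//.
by move=> [_ /= /mem_set Jy]; rewrite Jy in yJ.
Qed.

Let kappa_kerJ : {ae plaw P (measurable_Y HM (lexx 0) : measurable_fun setT (_ : _ -> mR)),
  forall x, \int[kappa HM Delta x]_y kerJ l r mart_diff (x, y) = 0}.
Proof.
have : {ae plaw P (measurable_Y HM (lexx 0) : measurable_fun setT (_ : _ -> mR)),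
    forall x, forall m, (kappa HM Delta x).-integrable setT (EFin \o eigfunJ l r D m) /\
     \int[kappa HM Delta x]_y eigfunJ l r D m y = rho D phi m Delta * eigfunJ l r D m x}.
  by apply: ae_foralln => m; exact: kappa_eigfun.
apply: filterS2 (kappa_total HM Delta0) => x k1 xphi.
have [Jx|nJx] := pselect (J x); last first.
  rewrite (_ : (fun y => _) = cst 0) ?Rintegral_cst ?mul0r//.
  by apply/funext => y; rewrite kerJ_notin// => -[].
(* Integrability and vanishing of the integral are carried together through the finite sum. The
   factor [\1_J] makes each summand vanish off [J], as [kerJ] does, and its integral is 1 because
   the kernel charges only [J] and has mass 1 at [x]. *)
pose good (f : mR -> R) := (kappa HM Delta x).-integrable setT (EFin \o f) /\
  \int[kappa HM Delta x]_y f y = 0.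
suff : good (\sum_(m < M) (fun y => a m x *
    (eigfunJ l r D m.+1 y - rho D phi m.+1 Delta * eigfun D m.+1 x * \1_J y))).
  move=> [_ <-]; congr Rintegral; apply/funext => y; rewrite fct_sumE /kerJ patchE.
  have [Jy|nJy] := pselect (J y).
    rewrite mem_set// /mart_diff; apply: eq_bigr => m _ /=.
    by rewrite /eigfunJ patchE indicE mem_set// mulr1.
  rewrite memNset => [|[]//]; rewrite big1// => m _.
  by rewrite /eigfunJ patchE indicE memNset// mulr0 subr0 mulr0.
have mJR : measurable (J : set mR) := mJ.
have m1 : measurable_fun setT (\1_J : mR -> R) by exact: measurable_indic.
have i1 : (kappa HM Delta x).-integrable setT (EFin \o (\1_J : mR -> R)).
  apply/integrableP; split; first exact/measurable_EFinP.
  rewrite (_ : (fun y => _) = (fun y => (\1_J y)%:E)); last first.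
    by apply/funext => y; rewrite /= ger0_norm.
  by rewrite integral_indic// setIT [X in (X < _)%E](_ : _ = 1%E) ?ltry// kappaJ.
have e1 : \int[kappa HM Delta x]_y (\1_J y : R) = 1.
  rewrite /Rintegral integral_indic// setIT.
  by rewrite [X in fine X](_ : _ = 1%E)// kappaJ.
apply: big_ind => [|f g [fi f0] [gi g0]|m _].
- split; first exact: (integrable0 (kappa HM Delta x) setT).
  by rewrite Rintegral_cst// mul0r.
- split; first exact: (integrableD measurableT fi gi).
  by rewrite [LHS](RintegralD measurableT fi gi) f0 g0 addr0.
have [ip ep] := xphi m.+1.
pose c := rho D phi m.+1 Delta * eigfun D m.+1 x.
have ic : (kappa HM Delta x).-integrable setT (EFin \o (fun y : mR => (- c) * \1_J y)).
  exact: (integrableZl measurableT (- c) i1).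
have isum : (kappa HM Delta x).-integrable setT
    (EFin \o (fun y : mR => eigfunJ l r D m.+1 y + (- c) * \1_J y)).
  exact: (integrableD measurableT ip ic).
rewrite (_ : (fun y => _) = (fun y => a m x * (eigfunJ l r D m.+1 y + (- c) * \1_J y))); last first.
  by apply/funext => y; rewrite mulNr.
split; first exact: (integrableZl measurableT (a m x) isum).
rewrite (RintegralZl _ measurableT isum) (RintegralD measurableT ip ic).
rewrite (RintegralZl _ measurableT i1) e1 ep /eigfunJ patchE mem_set// mulr1.
by rewrite /c subrr mulr0.
Qed.

Lemma measurable_mart_diff :
  measurable_fun (J `*` J) (fun z : R * R => mart_diff z.1 z.2).
Proof.
have HE : eigensystem l r D by case: HM => _ [].
have mphi m : measurable_fun J (eigfun D m).
  by apply/(measurable_restrictT _ mJ); exact: measurable_eigfunJ.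
have mJJ : measurable (J `*` J : set (R * R)) by apply: measurableX; exact: mJ.
have m1 (f : R -> R) : measurable_fun J f ->
    measurable_fun (J `*` J) (fun z : R * R => f z.1).
  move=> mf; apply: (measurable_comp mJ) => //; first by move=> _ [z [Jz _] <-].
  exact: (measurable_funS measurableT).
have m2 (f : R -> R) : measurable_fun J f ->
    measurable_fun (J `*` J) (fun z : R * R => f z.2).
  move=> mf; apply: (measurable_comp mJ) => //; first by move=> _ [z [_ Jz] <-].
  exact: (measurable_funS measurableT).
rewrite /mart_diff; apply: measurable_sum => m.
apply: measurable_funM; first exact: m1.
apply: measurable_funB; first exact: m2.
by apply: measurable_funM => //; exact: m1.
Qed.

Lemma mart_diff_mean0 :
  P.-integrable setT (EFin \o (kerJ l r mart_diff \o zeta 0%N)) ->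
  ('E_P[fun w => mart_diff (Y 0 w) (Y Delta w)] = 0)%E.
Proof.
move=> ik; rewrite (expectation_kerJ HM Delta0).
under eq_integral do rewrite obs_pair0.
have mk := measurable_kerJ measurable_mart_diff.
rewrite obs_pair0 in ik.
exact: (conditional_mean0 Delta0 mk ik kappa_kerJ).
Qed.

End martingale_differences.

(** * The estimating functions *)

Section block_derivative.
Context (R : realType) (p1 p2 : nat).
Local Notation param := 'rV[R]_(p1 + p2).
Variables (g1 : 'rV[R]_p1 -> 'rV[R]_p1) (g2 : param -> 'rV[R]_p2) (B : set param).
Let g (t : param) : param := row_mx (g1 (lsubmx t)) (g2 t).

Lemma derive_lsubmx (f : 'rV[R]_p1 -> R) (t v : param) :
  'D_v (fun u : param => f (lsubmx u)) t = 'D_(lsubmx v) f (lsubmx t).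
Proof.
have E : (fun h : R => h^-1 *: (((fun u : param => f (lsubmx u)) \o shift t) (h *: v)
      - f (lsubmx t))) =
    (fun h : R => h^-1 *: ((f \o shift (lsubmx t)) (h *: lsubmx v) - f (lsubmx t))).
  apply/funext => h; congr (_ *: (f _ - _)).
  by apply/rowP => j; rewrite !mxE.
by rewrite /derive E.
Qed.

Lemma derive_row_mx (f : param -> R) (t : param) (v : 'rV[R]_p2) :
  'D_v (fun u : 'rV[R]_p2 => f (row_mx (lsubmx t) u)) (rsubmx t) = 'D_(row_mx 0 v) f t.
Proof.
have E0 : row_mx (lsubmx t) (rsubmx t) = t by exact: hsubmxK.
have E : (fun h : R => h^-1 *: (((fun u : 'rV[R]_p2 => f (row_mx (lsubmx t) u))
      \o shift (rsubmx t)) (h *: v) - f (row_mx (lsubmx t) (rsubmx t)))) =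
    (fun h : R => h^-1 *: ((f \o shift t) (h *: row_mx 0 v) - f t)).
  apply/funext => h; rewrite E0; congr (_ *: (f _ - _)).
  by rewrite /= /shift -[t in RHS]hsubmxK scale_row_mx add_row_mx scaler0 add0r.
by rewrite /derive E.
Qed.

Lemma lsubmx_continuous : continuous (lsubmx : param -> 'rV[R]_p1).
Proof.
move=> t; apply/(@cvgrPdist_le R _ _ (nbhs t) (nbhs_filter t)) => e e0.
near=> u; apply: row_norm_le => [|j]; first exact: ltW.
rewrite !mxE; apply: (le_trans (y := `|t - u|)).
  by have := row_entry_le (t - u) (lshift p2 j); rewrite !mxE.
by apply: ltW; apply/ball_rowP; near: u; exact: nbhsx_ballx.
Unshelve. all: by end_near. Qed.

Lemma differentiable_lsubmx (t : param) : differentiable (lsubmx : param -> 'rV[R]_p1) t.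
Proof.
apply: differentiable_row => i.
rewrite (_ : (fun u => _) = fun u : param => u 0 (lshift p2 i)); last first.
  by apply/funext => u; rewrite mxE.
exact: differentiable_coord.
Qed.

Lemma differentiable_const_row_mx (a : 'rV[R]_p1) (u : 'rV[R]_p2) :
  differentiable (fun v : 'rV[R]_p2 => row_mx a v) u.
Proof.
apply: differentiable_row => i; case: (split_ordP i) => k ->.
  rewrite (_ : (fun v => _) = cst (a 0 k)); first exact: differentiable_cst.
  by apply/funext => v; rewrite row_mxEl.
rewrite (_ : (fun v => _) = fun v : 'rV[R]_p2 => v 0 k).
  exact: differentiable_coord.
by apply/funext => v; rewrite row_mxEr.
Qed.

Lemma pderiv_continuous m n (F : 'rV[R]_n -> 'rV[R]_m) (t : 'rV[R]_n) i j :
  {for t, continuous (pderiv F)} -> {for t, continuous (fun u => pderiv F u i j)}.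
Proof.
move=> cF; apply: (@continuous_comp _ _ _ (pderiv F) (fun A : 'M[R]_(m, n) => A i j)) => //.
exact: coord_continuous.
Qed.

Hypothesis oB : open B.
Hypothesis C1g1 : C1_on [set lsubmx t | t in B] g1.
Hypothesis C1g2 : C1_on B g2.

Lemma differentiable_row_mx t : B t -> differentiable g t.
Proof.
move=> Bt; apply: differentiable_row => i; case: (split_ordP i) => k ->.
  rewrite (_ : (fun u => _) = fun u : param => g1 (lsubmx u) 0 k); last first.
    by apply/funext => u; rewrite /g row_mxEl.
  apply: (@differentiable_entry _ _ _ (g1 \o lsubmx)).
  apply: differentiable_comp; first exact: differentiable_lsubmx.
  by have [] := C1g1 (imageP lsubmx Bt).
rewrite (_ : (fun u => _) = fun u : param => g2 u 0 k); last first.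
  by apply/funext => u; rewrite /g row_mxEr.
by apply: differentiable_entry; have [] := C1g2 Bt.
Qed.

Lemma pderiv_row_mx_r t i j : B t -> pderiv g t (rshift p1 i) j = pderiv g2 t i j.
Proof.
move=> Bt; rewrite pderivE; last exact: differentiable_row_mx.
rewrite pderivE; last by have [] := C1g2 Bt.
have -> : (fun u => g u 0 (rshift p1 i)) = (fun u => g2 u 0 i).
  by apply/funext => u; rewrite /g row_mxEr.
by [].
Qed.

Let pderiv_l t i j : B t -> pderiv g t (lshift p2 i) j =
  'D_(lsubmx (delta_mx 0 j)) (fun u => g1 u 0 i) (lsubmx t).
Proof.
move=> Bt; rewrite pderivE; last exact: differentiable_row_mx.
have -> : (fun u => g u 0 (lshift p2 i)) = (fun u => g1 (lsubmx u) 0 i).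
  by apply/funext => u; rewrite /g row_mxEl.
exact: (derive_lsubmx (fun u => g1 u 0 i)).
Qed.

Lemma pderiv_row_mx_ll t i j : B t ->
  pderiv g t (lshift p2 i) (lshift p2 j) = pderiv g1 (lsubmx t) i j.
Proof.
move=> Bt; rewrite pderiv_l// pderivE; last by have [] := C1g1 (imageP lsubmx Bt).
by congr ('D_ _ _ _); apply/rowP => k; rewrite !mxE (inj_eq (@lshift_inj _ _)).
Qed.

Lemma pderiv_row_mx_lr t i j : B t -> pderiv g t (lshift p2 i) (rshift p1 j) = 0.
Proof.
move=> Bt; rewrite pderiv_l//.
have -> : lsubmx (delta_mx 0 (rshift p1 j)) = 0 :> 'rV[R]_p1.
  by apply/rowP => k; rewrite !mxE eq_lrshift andbF.
rewrite deriveE ?linear0//; apply: differentiable_entry.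
by have [] := C1g1 (imageP lsubmx Bt).
Qed.

Lemma pderiv_row_mx_continuous t i j : B t ->
  {for t, continuous (fun u => pderiv g u i j)}.
Proof.
move=> Bt.
have nB : \forall u \near t, B u by exact: open_nbhs_nbhs.
(* The block formulas for the partial derivatives hold on [B] only; [B] being open, they hold near
   [t], which is enough for continuity at [t]. *)
have near_eq_continuous (f f' : param -> R) : (forall u, B u -> f u = f' u) ->
    f @ t --> f t -> f' @ t --> f' t.
  move=> ff'; rewrite -ff'//; apply: cvg_trans.
  apply: (@near_eq_cvg _ _ (nbhs t) (nbhs_filter t)).
  by apply: filterS nB => u Bu; rewrite ff'.
case: (split_ordP i) => k ->; last first.
  apply: (near_eq_continuous (fun u => pderiv g2 u k j)).
    by move=> u Bu; rewrite pderiv_row_mx_r.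
  exact: (pderiv_continuous (C1g2 Bt).2).
case: (split_ordP j) => j' ->.
  apply: (near_eq_continuous (fun u => pderiv g1 (lsubmx u) k j')).
    by move=> u Bu; rewrite pderiv_row_mx_ll.
  apply: (@continuous_comp _ _ _ (@lsubmx R 1 p1 p2) (fun v => pderiv g1 v k j')).
    exact: lsubmx_continuous.
  exact: (pderiv_continuous (C1g1 (imageP lsubmx Bt)).2).
apply: (near_eq_continuous (fun=> 0)); last exact: (@cvg_cst _ _ _ (nbhs t) (nbhs_filter t)).
by move=> u Bu; rewrite pderiv_row_mx_lr.
Qed.

End block_derivative.

(** The derivative is a pointwise limit of difference quotients along the steps [rad / k.+2], which
    tend to 0 and stay strictly below [rad], so that each quotient involves only parameters where
    measurability is assumed. *)
Lemma measurable_pderiv (R : realType) d (U : measurableType d) (E : set U)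
    m n (F : 'rV[R]_n -> U -> 'rV[R]_m) (t : 'rV[R]_n) (rad : R) i j :
  0 < rad -> measurable E ->
  (forall u : 'rV[R]_n, ball t rad u -> measurable_fun E (fun z => F u z 0 i)) ->
  (forall z, E z -> differentiable (F ^~ z) t) ->
  measurable_fun E (fun z => pderiv (F ^~ z) t i j).
Proof.
move=> rad0 mE mF dF.
pose s (k : nat) : R := rad / k.+2%:R.
have s0 k : 0 < s k by rewrite divr_gt0.
have sr k : s k < rad.
  by rewrite ltr_pdivrMr// ltr_pMr// ltr1n.
pose v : 'rV[R]_n := delta_mx 0 j.
have tv k : ball t rad (s k *: v + t).
  apply/ball_rowP; rewrite opprD addrCA subrr addr0 normrN normrZ gtr0_norm//.
  apply: le_lt_trans (sr k); rewrite -[leRHS]mulr1 ler_pM2l//.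
  by apply: row_norm_le => // j'; rewrite !mxE/=; case: eqP; rewrite ?normr1 ?normr0.
have s_cvg : s @ \oo --> (0 : R)^'.
  move=> A; rewrite /dnbhs /within/= => /nbhs_ballP[e /= e0 eA].
  have [N _ HN] := near_infty_natSinv_lt (PosNum (divr_gt0 e0 rad0)).
  exists N => // k /= Nk; apply: eA; last by rewrite gt_eqF.
  rewrite /ball/= sub0r normrN gtr0_norm//.
  have := HN k.+1 (leq_trans Nk (leqnSn k)); rewrite /= ltr_pdivlMr//.
  by rewrite mulrC.
apply: (@measurable_fun_cvg _ _ _ _
  (fun k z => (s k)^-1 * (F (s k *: v + t) z 0 i - F t z 0 i))).
  move=> k; apply: measurable_funM => //; apply: measurable_funB; apply: mF => //.
  exact: ballxx.
move=> z Ez; rewrite pderivE; last exact: dF.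
have df : derivable (fun u => F u z 0 i) t v.
  by apply: diff_derivable; apply: differentiable_entry; exact: dF.
exact: (cvg_comp _ _ s_cvg df).
Qed.

(** * Limits of the estimating functions and of their Jacobian matrices *)

Section estimating_functions.
Context (R : realType) (p1 p2 M : nat) (l r : \bar R) (S : set R).
Context (d : measure_display) (Omega : measurableType d).
Local Notation param := 'rV[R]_(p1 + p2).
Variables (P : param -> probability Omega R) (X T : R -> Omega -> R).
Variables (D : 'rV[R]_p1 -> diffusion R) (phi : 'rV[R]_p2 -> R -> R).
Variables (p : param -> R -> R -> R -> R) (Delta : R) (Theta B : set param).
Variables (tbar : param) (f1 : 'rV[R]_p1 -> R -> R -> 'rV[R]_p1).
Variable W : param -> R -> 'M[R]_(M, p2).
Local Notation J := (oitv l r).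
Local Notation Y := (subordinated X T).
Local Notation Pbar := (P tbar).
Local Notation obs := (observations Y Delta).
Local Notation Qbar := (fun x y => sdens (D (lsubmx tbar)) x * p tbar Delta x y).
Local Notation f2 := (f2fun D phi Delta W).
Local Notation f := (ffun f1 f2).
Local Notation zeta := (obs_pair X T Delta).
Hypothesis Delta0 : 0 < Delta.
Hypothesis HM : forall t, Theta t ->
  subordinate_model (P t) l r S (D (lsubmx t)) (phi (rsubmx t)) (p t) X T.
Hypothesis Hmom : moment_functions l r Delta Pbar Y Theta tbar f1 D.
Hypothesis HW : forall t i j, Theta t -> measurable_fun J (fun x => W t x i j).
Hypothesis H2 : assumption2 l r Delta Pbar Y Qbar Theta tbar f1 f2 B.

Let Ttbar : Theta tbar. Proof. by case: H2 => -[]. Qed.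
Let oB : open B. Proof. by case: H2 => -[]. Qed.
Let BT : B `<=` Theta. Proof. by case: H2 => -[]. Qed.
Let Btbar : B tbar. Proof. by case: H2 => -[]. Qed.
Let HMbar := HM Ttbar.

Lemma ffun_r t x y k : f t x y 0 (rshift p1 k) =
  mart_diff (D (lsubmx t)) (phi (rsubmx t)) Delta (fun m x => W t x m k) x y.
Proof.
rewrite /ffun row_mxEr /f2fun mxE mxE; apply: eq_bigr => m _.
by rewrite !mxE.
Qed.

Lemma measurable_ffun t j : Theta t ->
  measurable_fun (J `*` J) (fun z : R * R => f t z.1 z.2 0 j).
Proof.
move=> Tt; case: (split_ordP j) => k ->.
  under eq_fun do rewrite /ffun row_mxEl.
  by have [+ _ _] := Hmom k; apply.
under eq_fun do rewrite ffun_r.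
by apply: (measurable_mart_diff (HM Tt)) => m; exact: HW.
Qed.

Let mfbar := fun j => measurable_ffun j Ttbar.

Let integrable_fbar j :
  Pbar.-integrable setT (EFin \o (kerJ l r (fun x y => f tbar x y 0 j) \o zeta 0%N)).
Proof.
have [_ _ _ /(_ j)[_ [_ q2]] _] := H2.
exact: (integrable_kerJ_sqr HMbar Delta0 (mfbar j) q2).
Qed.

(** In the first block this is part of the choice of the moment functions; in the second it is the
    martingale property. *)
Lemma ffun_mean0 j : Epair Delta Pbar Y (fun x y => f tbar x y 0 j) = 0.
Proof.
rewrite /Epair; case: (split_ordP j) => k jk.
  have [_ _] := Hmom k; rewrite jk => E0.
  by under eq_fun do rewrite /ffun row_mxEl; rewrite E0.
rewrite jk; under eq_fun do rewrite ffun_r.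
rewrite (mart_diff_mean0 HMbar Delta0)//; first by move=> m; exact: HW.
have := integrable_fbar j; rewrite jk.
congr (Pbar.-integrable setT (EFin \o (kerJ l r _ \o zeta 0%N))).
by apply/funext => x; apply/funext => y; rewrite ffun_r.
Qed.

Lemma lln_ffun (e : R) : 0 < e -> wp_to_one Pbar (fun n => [set w |
  `|n%:R^-1 *: Fsum f (obs n w) tbar| <= e]).
Proof.
move=> e0.
have : wp_to_one Pbar (fun n => [set w | forall j : 'I_(p1 + p2),
    `|n%:R^-1 * \sum_(i < n) f tbar (obs n w)`_i (obs n w)`_i.+1 0 j
      - Epair Delta Pbar Y (fun x y => f tbar x y 0 j)| <= e]).
  apply: (wp_to_one_forall (E := fun j n => [set w |
    `|n%:R^-1 * \sum_(i < n) f tbar (obs n w)`_i (obs n w)`_i.+1 0 j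
      - Epair Delta Pbar Y (fun x y => f tbar x y 0 j)| <= e])) => j.
  exact: (lln_obs HMbar Delta0 (g := fun x y => f tbar x y 0 j)).
move=> H; apply: wp_to_one_sub H _ => n w /= H.
apply: row_norm_le => [|j]; first exact: ltW.
by have := H j; rewrite ffun_mean0 subr0 mxE /Fsum summxE.
Qed.

Let df x y t i j := pderiv (fun u => f u x y) t i j.

Lemma differentiable_ffun x y t : J x -> J y -> B t ->
  differentiable (fun u => f u x y) t.
Proof.
move=> Jx Jy Bt; have [_ /(_ x y Jx Jy)[c1 c2] _ _ _] := H2.
exact: (differentiable_row_mx c1 c2 Bt).
Qed.

Let df_ll x y t i j : J x -> J y -> B t -> df x y t (lshift p2 i) (lshift p2 j) =
  pderiv (fun t1 => f1 t1 x y) (lsubmx t) i j.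
Proof.
move=> Jx Jy Bt; have [_ /(_ x y Jx Jy)[c1 c2] _ _ _] := H2.
exact: (pderiv_row_mx_ll c1 c2).
Qed.

Let df_lr x y t i j : J x -> J y -> B t -> df x y t (lshift p2 i) (rshift p1 j) = 0.
Proof.
move=> Jx Jy Bt; have [_ /(_ x y Jx Jy)[c1 c2] _ _ _] := H2.
exact: (pderiv_row_mx_lr c1 c2).
Qed.

Let df_r x y t i j : J x -> J y -> B t -> df x y t (rshift p1 i) j =
  pderiv (fun u => f2 u x y) t i j.
Proof.
move=> Jx Jy Bt; have [_ /(_ x y Jx Jy)[c1 c2] _ _ _] := H2.
exact: (pderiv_row_mx_r c1 c2).
Qed.

Definition Amx : 'M[R]_(p1 + p2) := \matrix_(i, j)
  Epair Delta Pbar Y (fun x y => df x y tbar i j).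

Let Epair_eq (g g' : R -> R -> R) : (forall x y, J x -> J y -> g x y = g' x y) ->
  Epair Delta Pbar Y g = Epair Delta Pbar Y g'.
Proof.
move=> gg'; rewrite !(Epair_kerJ HMbar Delta0); congr (mean0 _ _ _).
apply/funext => z; rewrite /kerJ !patchE; case: ifPn => // /set_mem[Jx Jy].
exact: gg'.
Qed.

Lemma Amx_block : Amx = block_mx (A1mx Delta Pbar Y tbar f1) 0
  (dlsubmx Amx) (A2mx Delta Pbar Y tbar f2).
Proof.
rewrite -[LHS]submxK; congr block_mx; apply/matrixP => i j; rewrite !mxE.
- by apply: Epair_eq => x y Jx Jy; rewrite df_ll.
- rewrite (@Epair_eq _ (fun _ _ => 0)); last by move=> x y Jx Jy; rewrite df_lr.
  by rewrite /Epair unlock integral0.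
(* [A2mx] differentiates with the first block of the parameter frozen at its true value. As a
   derivative of [f2] in the full parameter this is the direction [row_mx 0 (delta_mx 0 j)], a
   coordinate direction. *)
- apply: Epair_eq => x y Jx Jy; rewrite df_r// pderivE; last first.
    by have [_ /(_ x y Jx Jy)[_ /(_ _ Btbar)[]]] := H2.
  rewrite pderivE; last first.
    apply: (@differentiable_comp _ _ _ _ (fun u => row_mx (lsubmx tbar) u)
      (fun u => f2 u x y)); first exact: differentiable_const_row_mx.
    rewrite hsubmxK.
    by have [_ /(_ x y Jx Jy)[_ /(_ _ Btbar)[]]] := H2.
  rewrite (derive_row_mx (fun u => f2 u x y 0 i)).
  suff -> : row_mx 0 (delta_mx 0 j) = delta_mx 0 (rshift p1 j) :> param by [].
  apply/rowP => k; case: (split_ordP k) => k' ->.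
    by rewrite row_mxEl !mxE eq_lrshift andbF.
  by rewrite row_mxEr !mxE (inj_eq (@rshift_inj _ _)).
Qed.

(** Explicit inverse of the block triangular matrix [Amx^T], whose diagonal blocks are invertible by
    part (d) of Assumption 2. The inverse has a zero lower left block, so the first block of
    [u *m N] depends only on the first block of [u]; the equality of the first components of the two
    estimators rests on this. *)
Lemma Amx_inverse : exists N : 'M[R]_(p1 + p2), Amx^T *m N = 1%:M /\
  forall u v : param, lsubmx u = lsubmx v -> lsubmx (u *m N) = lsubmx (v *m N).
Proof.
have [_ _ _ _ [u1 u2]] := H2.
pose N1 := invmx (A1mx Delta Pbar Y tbar f1)^T.
pose N2 := invmx (A2mx Delta Pbar Y tbar f2)^T.
pose C := (dlsubmx Amx)^T.
exists (block_mx N1 (- (N1 *m C *m N2)) 0 N2); split.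
  rewrite Amx_block tr_block_mx trmx0 mulmx_block !mulmx0 !mul0mx !addr0 add0r.
  rewrite !mulmxV ?unitmx_tr// -/C mulmxN !mulmxA mulmxV ?unitmx_tr// mul1mx addNr.
  by rewrite -scalar_mx_block.
move=> u v uv; rewrite -(hsubmxK u) -(hsubmxK v) !mul_row_block !row_mxKl uv.
by rewrite !mulmx0.
Qed.

Lemma differentiable_Fsum n (y : n.+1.-tuple R) t :
  (forall k, (k <= n)%N -> J y`_k) -> B t -> differentiable (Fsum f y) t.
Proof.
move=> yJ Bt; have -> : Fsum f y = \sum_(k < n) (fun u => f u y`_k y`_k.+1).
  by apply/funext => u; rewrite fct_sumE.
apply: differentiable_sum => k; apply: differentiable_ffun => //; last exact: yJ.
by apply: yJ; exact: ltnW.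
Qed.

Lemma pderiv_Fsum n (y : n.+1.-tuple R) t i j :
  (forall k, (k <= n)%N -> J y`_k) -> B t ->
  pderiv (Fsum f y) t i j = \sum_(k < n) df y`_k y`_k.+1 t i j.
Proof.
move=> yJ Bt.
have yk (k : 'I_n) : J y`_k by apply: yJ; exact: ltnW.
have yk1 (k : 'I_n) : J y`_k.+1 by exact: yJ.
have dk (k : 'I_n) := differentiable_ffun (yk k) (yk1 k) Bt.
rewrite pderivE; last exact: differentiable_Fsum.
have -> : (fun u => Fsum f y u 0 i) = \sum_(k < n) (fun u => f u y`_k y`_k.+1 0 i).
  by apply/funext => u; rewrite fct_sumE summxE.
rewrite derive_sum => [|k]; last first.
  by apply: diff_derivable; apply: differentiable_entry; exact: dk.
by apply: eq_bigr => k _; rewrite /df pderivE.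
Qed.

Let dominated_df i j : dominated_on l r Qbar B (fun t x y => df x y t i j).
Proof.
have [_ _ [d1 d2] _ _] := H2.
case: (split_ordP i) => i' ->; last first.
  have [k [ik kB]] := d2 i' j; exists k; split => // t x y Bt Jx Jy.
  by rewrite df_r//; exact: kB.
case: (split_ordP j) => j' ->.
  have [k [ik kB]] := d1 i' j'; exists k; split => // t x y Bt Jx Jy.
  by rewrite df_ll//; exact: kB.
exists (fun _ _ => 0); split; last by move=> t x y Bt Jx Jy; rewrite df_lr// normr0.
split; first exact: measurable_cst.
under eq_fun do rewrite mul0r; exact: integrable0.
Qed.

Lemma uniform_lln_pderiv (e : R) : 0 < e -> exists2 rad : R, 0 < rad &
  ball tbar rad `<=` B /\ wp_to_one Pbar (fun n => [set w |
    forall (u : param) i j, ball tbar rad u ->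
    `|n%:R^-1 * pderiv (Fsum f (obs n w)) u i j - Amx i j| <= e]).
Proof.
move=> e0; have /nbhs_ballP[rad/= rad0 radB] : nbhs tbar B by exact: open_nbhs_nbhs.
have mJJ : measurable (J `*` J : set (R * R)).
  by apply: measurableX; exact: measurable_oitv.
have H (ij : 'I_(p1 + p2) * 'I_(p1 + p2)) : exists dlt : R, 0 < dlt <= rad /\
    wp_to_one Pbar (fun n => [set w | forall u : param, ball tbar dlt u ->
      `|n%:R^-1 * (\sum_(k < n) df (obs n w)`_k (obs n w)`_k.+1 u ij.1 ij.2)
        - Amx ij.1 ij.2| <= e]).
  pose g (u : param) x y := df x y u ij.1 ij.2.
  have mg (u : param) : ball tbar rad u ->
      measurable_fun (J `*` J) (fun z : R * R => g u z.1 z.2).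
    move=> cu; have /nbhs_ballP[ru/= ru0 ruB] : nbhs u B.
      by apply: open_nbhs_nbhs; split => //; exact: radB.
    apply: (@measurable_pderiv R _ (R * R)%type (J `*` J) _ _
      (fun u z => f u z.1 z.2) u ru ij.1 ij.2 ru0 mJJ).
      by move=> v uv; apply: measurable_ffun; apply: BT; exact: ruB.
    by move=> z [Jx Jy]; apply: differentiable_ffun => //; exact: radB.
  have cg (u : param) x y : ball tbar rad u -> J x -> J y ->
      {for u, continuous (fun t => g t x y)}.
    move=> cu Jx Jy; have [_ /(_ x y Jx Jy)[c1 c2] _ _ _] := H2.
    apply: (pderiv_row_mx_continuous oB c1 c2); exact: radB.
  have kg : exists k, Qintegrable l r Qbar k /\
      forall (u : param) x y, ball tbar rad u -> J x -> J y -> `|g u x y| <= k x y.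
    have [k [ik kB]] := dominated_df ij.1 ij.2; exists k; split => // u x y cu.
    exact: kB (radB _ cu).
  have [dlt dltr Hd] := uniform_lln_obs HMbar Delta0 rad0 mg cg kg e0.
  exists dlt; split => //; apply: wp_to_one_sub Hd _ => n w /= Hw u cu.
  by rewrite mxE; exact: Hw.
have /choice[dlt dltP] := H.
(* Each entry of the Jacobian comes with its own radius; there are finitely many entries, so the
   smallest radius works for all of them. *)
exists (\big[Num.min/rad]_ij dlt ij).
  by apply: lt_bigmin => // ij _; have [/andP[]] := dltP ij.
split.
  by apply: subset_trans radB; apply: le_ball; exact: bigmin_le_id.
have := wp_to_one_forall (fun ij => (dltP ij).2); move=> /wp_to_one_sub_ae; apply.
exists 0%N => n _; apply: filterS (ae_obs_J HMbar Delta0) => w wJ Hw u i j cu.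
have cu' : ball tbar (dlt (i, j)) u by apply: le_ball cu; exact: bigmin_le.
have Bu : B u by apply: radB; apply: le_ball cu; exact: bigmin_le_id.
rewrite (pderiv_Fsum (y := obs n w) i j _ Bu); last first.
  by move=> k kn; rewrite nth_obs.
exact: (Hw (i, j)).
Qed.

(** Some coordinate has mean [m] different from 0. A uniform error of [|m| / 2] around [t] leaves at
    least [|m| / 2] of it. *)
Lemma ffun_away_from_zero t :
  assumption3 l r Delta Pbar Y Qbar Theta tbar f1 f2 ->
  continuous_in_parameter l r Theta f1 f2 -> open Theta ->
  Theta t -> t != tbar -> exists (rad eta : R), [/\ 0 < rad, 0 < eta &
    wp_to_one Pbar (fun n => [set w | forall u : param, ball t rad u ->
      eta <= `|n%:R^-1 *: Fsum f (obs n w) u|])].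
Proof.
move=> [E0 ld] cf oT Tt tn.
have /rV0Pn[j] := E0 t Tt tn; rewrite mxE => Ej.
have [U [k [tU ik k0 fk]]] := ld j t Tt.
have /nbhs_ballP[rad/= rad0 radT] : nbhs t (U `&` Theta).
  by apply: filterI => //; exact: open_nbhs_nbhs.
set m := Epair _ _ _ _ in Ej.
have m0 : 0 < `|m| / 2 by rewrite divr_gt0// normr_gt0.
pose g (u : param) x y := f u x y 0 j.
have mg (u : param) : ball t rad u ->
    measurable_fun (J `*` J) (fun z : R * R => g u z.1 z.2).
  by move=> /radT[_ Tu]; exact: measurable_ffun.
have cg (u : param) x y : ball t rad u -> J x -> J y ->
    {for u, continuous (fun v => g v x y)}.
  move=> /radT[_ Tu] Jx Jy.
  apply: (@continuous_comp _ _ _ (fun v => f v x y) (fun v : param => v 0 j)).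
    exact: cf.
  exact: coord_continuous.
have kg : exists k, Qintegrable l r Qbar k /\
    forall (u : param) x y, ball t rad u -> J x -> J y -> `|g u x y| <= k x y.
  by exists k; split => // u x y /radT[Uu Tu] Jx Jy; apply: ltW; exact: fk.
have [dlt /andP[dlt0 _] H] := uniform_lln_obs HMbar Delta0 rad0 mg cg kg m0.
exists dlt, (`|m| / 2); split => //; apply: wp_to_one_sub H _ => n w /= H u tu.
apply: le_trans (row_entry_le _ j); rewrite mxE /Fsum summxE.
have := H u tu; rewrite -/m /g; set x := _ * _ => h.
have := ler_normD (m - x) x; rewrite subrK distrC.
by move: h; rewrite -/m; move: `|x - m| `|x| => a b; lra.
Qed.

Lemma ffun_away_from_zero_compact (K : set param) :
  assumption3 l r Delta Pbar Y Qbar Theta tbar f1 f2 ->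
  continuous_in_parameter l r Theta f1 f2 -> open Theta ->
  compact K -> K `<=` Theta -> ~ K tbar -> exists2 eta : R, 0 < eta &
    wp_to_one Pbar (fun n => [set w | forall u : param, K u ->
      eta <= `|n%:R^-1 *: Fsum f (obs n w) u|]).
Proof.
move=> A3 cf oT cK KT Kt.
pose good (Z : set param) := exists2 eta : R, 0 < eta &
  wp_to_one Pbar (fun n => [set w | forall u : param, Z u ->
      eta <= `|n%:R^-1 *: Fsum f (obs n w) u|]).
have good_sub Z Z' : Z `<=` Z' -> good Z' -> good Z.
  move=> ZZ' [eta eta0 H]; exists eta => //.
  by apply: wp_to_one_sub H _ => n w /= H u /ZZ'; exact: H.
have goodU Z Z' : good Z -> good Z' -> good (Z `|` Z').
  move=> [e1 e10 H1] [e2 e20 H2']; exists (Num.min e1 e2).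
    by rewrite lt_min e10.
  apply: wp_to_one_sub (wp_to_oneI H1 H2') _ => n w /= [h1 h2] u [/h1|/h2] h.
    by rewrite (le_trans _ h)// ge_min lexx.
  by rewrite (le_trans _ h)// ge_min lexx orbT.
have good0 : good set0.
  exists 1 => //; apply: wp_to_one_ae => n; apply: aeW => w u [].
apply: contrapT => nK.
(* Compactness through a filter: if no [eta] worked for [K], the sets whose complement in [K] admits
   one would form a proper filter containing [K]. It would cluster at a point [t] of [K], yet the
   complement of a small ball around [t] belongs to it. *)
pose FF : set_system param := [set Z | good (K `\` Z)].
have FFf : ProperFilter FF.
  split; first by rewrite /FF /= setD0.
  split; rewrite /FF /=.
  - by rewrite setDT.
  - by move=> Z Z' h h' /=; rewrite setDIr; exact: goodU.
  - by move=> Z Z' ZZ'; apply: good_sub; exact: setDS.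
have [t [Kt' ct]] : K `&` cluster FF !=set0.
  by apply: cK; rewrite /FF /= setDv.
have [rad [eta [rad0 eta0 H]]] := ffun_away_from_zero A3 cf oT (KT _ Kt')
  (introN eqP (fun e => Kt (ecast t (K t) e Kt'))).
have Fb : FF (~` ball t rad).
  rewrite /FF /= setDE setCK; apply: (good_sub _ (ball t rad)); first exact: subIsetr.
  by exists eta.
by have [v []] := ct _ _ Fb (nbhsx_ballx t rad rad0).
Qed.

(** * The estimators *)

Variables (B' : set param) (F2h : forall n, R -> n.+1.-tuple R -> param -> 'rV[R]_p2)
  (h : nat -> R) (a b : R) (C : param -> R)
  (Cij : 'I_(p1 + p2) -> 'I_(p1 + p2) -> param -> R).
Local Notation F := (fun n => @Fsum R _ _ f n).
Local Notation Fh := (fun n => Fhsum f1 F2h (h n)).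
Hypothesis oT : open Theta.
Hypothesis mF2h : forall n t j, Theta t ->
  measurable_fun setT (fun y : n.+1.-tuple R => @F2h n (h n) y t 0 j).
Hypothesis h0 : forall n, 0 < h n.
Hypothesis h_cvg : h @ \oo --> (0 : R).
Hypothesis C1Fh : forall n, (0 < n)%N ->
  {ae Pbar, forall w, C1_on B' (Fh n (obs n w))}.
Hypothesis a0 : 0 < a.
Hypothesis cC : forall t, Theta t -> {for t, continuous C}.
Hypothesis E1 : error_bound1 Pbar Y Delta f2 F2h h Theta a C.
Hypothesis E2 : error_bound2 Pbar Y Delta f1 f2 F2h h (B `&` B') b Cij.

Lemma powR_cvg0 (e x : R) : 0 < e -> 0 < x ->
  exists N, forall n, (N <= n)%N -> h n `^ x <= e.
Proof.
move=> e0 x0; have ex0 : 0 < e `^ x^-1 by exact: powR_gt0.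
have [N _ HN] := (cvgrPdist_le _ _).1 h_cvg _ ex0.
exists N => n Nn; have := HN n Nn; rewrite /= sub0r normrN gtr0_norm// => hn.
apply: (@le_trans _ _ ((e `^ x^-1) `^ x)).
  by apply: ge0_ler_powR => //; rewrite ?nnegrE ltW// h0.
by rewrite -powRrM mulVf ?gt_eqF// powRr1// ltW.
Qed.

Lemma Fsum_ffun n (y : n.+1.-tuple R) t :
  F n y t = row_mx (Fsum f1 y (lsubmx t)) (Fsum f2 y t).
Proof.
apply/rowP => j; rewrite /Fsum summxE; case: (split_ordP j) => k ->.
  by rewrite row_mxEl summxE; apply: eq_bigr => i _; rewrite /ffun row_mxEl.
by rewrite row_mxEr summxE; apply: eq_bigr => i _; rewrite /ffun row_mxEr.
Qed.

(** Collects the almost sure properties at sample size [n], so that the analysis of the estimators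
    becomes deterministic on these paths. *)
Definition regular_path n w :=
  [/\ forall i : nat, J (Y (i%:R * Delta) w),
      forall t, Theta t -> enorm (F2h (h n) (obs n w) t - Fsum f2 (obs n w) t)
        <= C t * n%:R * h n `^ a,
      forall t, (B `&` B') t -> forall i j : 'I_(p1 + p2), (p1 <= i)%N ->
        `|pderiv (Fh n (obs n w)) t i j - pderiv (F n (obs n w)) t i j|
          <= Cij i j t * n%:R * h n `^ b
    & C1_on B' (Fh n (obs n w))].

Lemma ae_regular_path n : (0 < n)%N -> {ae Pbar, forall w, regular_path n w}.
Proof.
move=> n0; apply: filterS2 (filterI (ae_obs_J HMbar Delta0) (C1Fh n0))
  (filterI (E1 n0) (E2 n0)) => w [? ?] [? ?]; split => //.
Qed.

Lemma Fh_error n w t : (0 < n)%N -> regular_path n w -> Theta t ->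
  `|n%:R^-1 *: Fh n (obs n w) t - n%:R^-1 *: F n (obs n w) t| <= C t * h n `^ a.
Proof.
move=> n0 [_ /(_ t) He _ _] /He {}He.
have n0' : (0 : R) < n%:R by rewrite ltr0n.
(* No sign is assumed on [C]; nonnegativity of the bound follows from (E1) itself, whose left-hand
   side is a norm. *)
have C0 : 0 <= C t * h n `^ a.
  rewrite -(pmulr_rge0 _ n0') mulrCA mulrA (le_trans _ He)//.
  exact: sqrtr_ge0.
rewrite -scalerBr Fsum_ffun /Fhsum opp_row_mx add_row_mx subrr.
apply: row_norm_le => // j; rewrite mxE; case: (split_ordP j) => k ->.
  by rewrite row_mxEl mxE mulr0 normr0.
rewrite row_mxEr normrM gtr0_norm ?invr_gt0// mulrC ler_pdivrMr//.
by apply: (le_trans (entry_le_enorm _ _)); rewrite (le_trans He)// mulrAC.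
Qed.

(** (E2) bounds the rows of the second block. In the rows with [i < p1] the two maps have the same
    entry as functions of the parameter, so their derivatives coincide. *)
Lemma pderiv_Fh_error n w t i j (e c2 : R) : (0 < n)%N -> regular_path n w ->
  (B `&` B') t -> Cij i j t <= c2 -> c2 * h n `^ b <= e -> 0 <= e ->
  `|n%:R^-1 * pderiv (Fh n (obs n w)) t i j - n%:R^-1 * pderiv (F n (obs n w)) t i j|
    <= e.
Proof.
move=> n0 [wJ _ /(_ t) He C1] BB /[swap] ce /[swap] e0 cc.
have n0' : (0 : R) < n%:R by rewrite ltr0n.
rewrite -mulrBr normrM gtr0_norm ?invr_gt0// mulrC ler_pdivrMr//.
have [ip1|p1i] := ltnP i p1; last first.
  apply: (le_trans (He BB i j p1i)); rewrite mulrAC ler_wpM2r ?ler0n//.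
  by apply: le_trans ce; rewrite ler_wpM2r// powR_ge0.
have dF : differentiable (F n (obs n w)) t.
  apply: differentiable_Fsum; last exact: BB.1.
  by move=> k kn; rewrite nth_obs.
have [dFh _] := C1 t BB.2.
have /eqP -> : pderiv (Fh n (obs n w)) t i j - pderiv (F n (obs n w)) t i j == 0.
  rewrite subr_eq0; apply/eqP; apply: eq_entry_pderiv => // u; rewrite Fsum_ffun /Fhsum.
  have -> : i = lshift p2 (Ordinal ip1) by apply: val_inj.
  by rewrite !row_mxEl.
by rewrite normr0 mulr_ge0// ltW.
Qed.

(** * Construction of the estimators for given constants *)

Section construction.
Variables (N : 'M[R]_(p1 + p2)) (cN rad cmax c2 e : R) (N0 : nat).
Hypothesis AN : Amx^T *m N = 1%:M.
Hypothesis NL : forall u v : param, lsubmx u = lsubmx v ->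
  lsubmx (u *m N) = lsubmx (v *m N).
Hypothesis cN0 : 0 < cN.
Hypothesis cNP : forall v : param, `|v *m N| <= cN * `|v|.
Hypothesis rad0 : 0 < rad.
Hypothesis radB : ball tbar rad `<=` B `&` B'.
Hypothesis cmax0 : 0 < cmax.
Hypothesis Cmax : forall u, ball tbar rad u -> C u <= cmax.
Hypothesis c2P : forall (u : param) i j, ball tbar rad u -> Cij i j u <= c2.
Hypothesis e0 : 0 < e.
Hypothesis jac : forall (H : param -> param) (k : R),
  (forall u : param, ball tbar rad u -> differentiable H u) ->
  (forall (u : param) i j, ball tbar rad u -> `|k * pderiv H u i j - Amx i j| <= e) ->
  contracting tbar rad (fun u => (k *: H u) *m N).
Hypothesis N00 : (0 < N0)%N.
Hypothesis N0b : forall n, (N0 <= n)%N -> c2 * h n `^ b <= e / 2.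
Hypothesis N0a : forall n, (N0 <= n)%N -> cN * (cmax * h n `^ a) <= rad / 8.
Hypothesis wp_pderiv : wp_to_one Pbar (fun n => [set w |
  forall (u : param) i j, ball tbar rad u ->
  `|n%:R^-1 * pderiv (F n (obs n w)) u i j - Amx i j| <= e / 2]).

Let bt : ball tbar rad tbar. Proof. exact: ballxx. Qed.
Let ballT u : ball tbar rad u -> Theta u.
Proof. by move=> /radB[/BT]. Qed.

Let score (H : forall n, n.+1.-tuple R -> param -> param) n y u : param :=
  (n%:R^-1 *: H n y u) *m N.

Definition inJ n : set (n.+1.-tuple R) := [set y | forall i : 'I_n.+1, J (tnth y i)].
Arguments inJ : clear implicits.

(* Set to 0 off J, where the estimating functions need not be measurable. *)
Let scoreJ H n (y : n.+1.-tuple R) u : param :=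
  if `[< inJ n y >] then score H y u else 0.

(** A condition on the data alone, made of countably many inequalities, so that it is measurable. It
    is empty for [n < N0], where the approximation errors are not yet controlled. *)
Definition good_data n : set (n.+1.-tuple R) := [set y |
  [/\ (N0 <= n)%N, inJ n y,
      dense_contracting tbar rad (scoreJ F y) /\ `|scoreJ F y tbar| <= rad / 4
    & dense_contracting tbar rad (scoreJ Fh y) /\ `|scoreJ Fh y tbar| <= rad / 4]].
Arguments good_data : clear implicits.

Definition exact_est n (y : n.+1.-tuple R) := zero_est tbar rad (scoreJ F y).
Definition approx_est n (y : n.+1.-tuple R) := zero_est tbar rad (scoreJ Fh y).

Let measurable_inJ n : measurable (inJ n).
Proof.
have -> : inJ n = \bigcap_(i in [set: 'I_n.+1]) ((fun y : n.+1.-tuple R => tnth y i) @^-1` J).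
  by apply/seteqP; split=> y /= yJ i; [move=> _; exact: yJ|exact: yJ].
apply: fin_bigcap_measurable => // i _.
rewrite -[X in measurable X]setTI; apply: measurable_tnth => //.
exact: measurable_oitv.
Qed.

Let pair_inJ n (y : n.+1.-tuple R) i : inJ n y -> (i < n)%N -> J y`_i /\ J y`_i.+1.
Proof.
move=> yJ i_n; have i1 : (i < n.+1)%N by exact: ltnW.
have i2 : (i.+1 < n.+1)%N by [].
by split; [have := yJ (Ordinal i1)|have := yJ (Ordinal i2)]; rewrite (tnth_nth 0).
Qed.

Let measurable_F n (u : param) j : Theta u ->
  measurable_fun (inJ n) (fun y : n.+1.-tuple R => F n y u 0 j).
Proof.
move=> Tu; rewrite /Fsum; under eq_fun do rewrite summxE.
apply: measurable_sum => i.
have mJJ : measurable (J `*` J : set (R * R)).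
  by apply: measurableX; exact: measurable_oitv.
apply: (measurable_comp mJJ _ (measurable_ffun j Tu)
  (g := fun y : n.+1.-tuple R => (y`_i, y`_i.+1))).
  by move=> _ [y yJ <-]; exact: (pair_inJ yJ).
apply: (measurable_funS measurableT) => //.
have mn (k : 'I_n.+1) : measurable_fun setT (fun y : n.+1.-tuple R => y`_k).
  by under eq_fun do rewrite -tnth_nth; exact: measurable_tnth.
have i1 : (i < n.+1)%N := ltnW (ltn_ord i).
have i2 : (i.+1 < n.+1)%N := ltn_ord i.
by apply/measurable_fun_pairP; split; [exact: (mn (Ordinal i1))|exact: (mn (Ordinal i2))].
Qed.

Let measurable_Fh n (u : param) j : Theta u ->
  measurable_fun (inJ n) (fun y : n.+1.-tuple R => Fh n y u 0 j).
Proof.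
move=> Tu; case: (split_ordP j) => k ->.
  have := @measurable_F n u (lshift p2 k) Tu.
  by apply: eq_measurable_fun => y _; rewrite Fsum_ffun /Fhsum !row_mxEl.
under eq_fun do rewrite /Fhsum row_mxEr.
by apply: (measurable_funS measurableT) => //; exact: mF2h.
Qed.

Let measurable_scoreJ (H : forall n, n.+1.-tuple R -> param -> param) n (u : param) j :
  (forall j', measurable_fun (inJ n) (fun y : n.+1.-tuple R => H n y u 0 j')) ->
  measurable_fun setT (fun y : n.+1.-tuple R => scoreJ H y u 0 j).
Proof.
move=> mH.
have -> : (fun y : n.+1.-tuple R => scoreJ H y u 0 j) =
    (fun y => \sum_k n%:R^-1 * H n y u 0 k * N k j) \_ (inJ n).
  apply/funext => y; rewrite patchE /scoreJ; case: asboolP => yJ.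
    by rewrite mem_set// mxE; apply: eq_bigr => k _; rewrite mxE.
  by rewrite memNset// mxE.
have mS : measurable_fun (inJ n)
    (fun y : n.+1.-tuple R => \sum_k n%:R^-1 * H n y u 0 k * N k j : R).
  by apply: measurable_sum => k; do 2 (apply: measurable_funM => //).
exact: (measurable_restrictT _ (@measurable_inJ n)).1 mS.
Qed.

Let mscoreF n (u : param) j : ball tbar rad u ->
  measurable_fun setT (fun y : n.+1.-tuple R => scoreJ F y u 0 j).
Proof. by move=> cu; apply: measurable_scoreJ => j'; apply: measurable_F; exact: ballT. Qed.

Let mscoreFh n (u : param) j : ball tbar rad u ->
  measurable_fun setT (fun y : n.+1.-tuple R => scoreJ Fh y u 0 j).
Proof. by move=> cu; apply: measurable_scoreJ => j'; apply: measurable_Fh; exact: ballT. Qed.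

Lemma measurable_good_data n : measurable (good_data n).
Proof.
have [nn|nn] := leqP N0 n; last first.
  rewrite (_ : good_data n = set0); first exact: measurable0.
  by apply/seteqP; split => // y []; rewrite leqNgt nn.
rewrite (_ : good_data n = inJ n `&`
  ([set y | dense_contracting tbar rad (scoreJ F y) /\ `|scoreJ F y tbar| <= rad / 4] `&`
   [set y | dense_contracting tbar rad (scoreJ Fh y) /\ `|scoreJ Fh y tbar| <= rad / 4])).
  apply: measurableI => //; apply: measurableI.
    exact: (measurable_dense_contracting rad0 (@mscoreF n)).
  exact: (measurable_dense_contracting rad0 (@mscoreFh n)).
by apply/seteqP; split => y; [case=> *; split|case=> ? [? ?]; split].
Qed.

Lemma measurable_exact_est n j : measurable_fun setT (fun y => @exact_est n y 0 j).
Proof. exact: (measurable_zero_est rad0 (@mscoreF n)). Qed.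

Lemma measurable_approx_est n j : measurable_fun setT (fun y => @approx_est n y 0 j).
Proof. exact: (measurable_zero_est rad0 (@mscoreFh n)). Qed.

Lemma inJ_obs n w : regular_path n w -> inJ n (obs n w).
Proof. by move=> [wJ _ _ _] i; rewrite tnth_mktuple. Qed.

Let scoreJE (H : forall n, n.+1.-tuple R -> param -> param) n w : regular_path n w -> scoreJ H (obs n w) = score H (obs n w).
Proof.
move=> rw; apply/funext => u; rewrite /scoreJ; case: asboolP => // -[].
exact: inJ_obs.
Qed.
Let n_gt0 n : (N0 <= n)%N -> (0 < n)%N. Proof. exact: leq_trans. Qed.

Let score0 (H : forall n, n.+1.-tuple R -> param -> param) n y u :
  (N0 <= n)%N -> @score H n y u = 0 -> H n y u = 0.
Proof.
move=> /n_gt0 n0 /(congr1 (mulmx^~ Amx^T)).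
rewrite /score -mulmxA (mulmx1C AN) mulmx1 mul0mx => /eqP.
by rewrite scaler_eq0 invr_eq0 pnatr_eq0 gtn_eqF// => /eqP.
Qed.

Let score_continuous (H : forall n, n.+1.-tuple R -> param -> param) n y (u : param) :
  differentiable (H n y) u -> {for u, continuous (@score H n y)}.
Proof.
move=> /differentiable_continuous cH.
apply/(@cvgrPdist_le R _ _ (nbhs u) (nbhs_filter u)) => x x0.
have k0 : 0 < cN * `|n%:R^-1 : R| + 1.
  by rewrite ltr_wpDl// mulr_ge0// ltW.
have := (@cvgrPdist_le R _ _ (nbhs u) (nbhs_filter u) _ _).1 cH _ (divr_gt0 x0 k0).
apply: filterS => v Huv; rewrite /score -mulmxBl -scalerBr.
apply: (le_trans (cNP _)); rewrite normrZ mulrA.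
apply: (@le_trans _ _ ((cN * `|n%:R^-1 : R| + 1) * `|H n y u - H n y v|)).
  by rewrite ler_wpM2r// lerDl.
by rewrite mulrC -ler_pdivlMr.
Qed.

Let differentiable_F n w (u : param) : regular_path n w -> ball tbar rad u ->
  differentiable (F n (obs n w)) u.
Proof.
move=> [wJ _ _ _] /radB[Bu _].
apply: (differentiable_Fsum _ Bu) => i i_n.
by rewrite nth_obs.
Qed.

Let differentiable_Fh n w (u : param) : regular_path n w -> ball tbar rad u ->
  differentiable (Fh n (obs n w)) u.
Proof. by move=> [_ _ _ C1] /radB[_ B'u]; exact: (C1 u B'u).1. Qed.

(** Continuity of both scores on the ball upgrades the inequalities at the dense points to
    contraction on the whole ball. *)
Let good_score n w : regular_path n w -> good_data n (obs n w) ->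
  [/\ contracting tbar rad (score F (obs n w)), `|score F (obs n w) tbar| <= rad / 4,
      contracting tbar rad (score Fh (obs n w)) & `|score Fh (obs n w) tbar| <= rad / 4].
Proof.
move=> rw [_ _ [c1 s1] [c2' s2]].
rewrite (scoreJE F rw) in c1; rewrite (scoreJE F rw) in s1.
rewrite (scoreJE Fh rw) in c2'; rewrite (scoreJE Fh rw) in s2.
split; [|exact: s1| |exact: s2].
  apply: (dense_contracting_ball _ c1) => u cu.
  by apply: score_continuous; exact: differentiable_F.
apply: (dense_contracting_ball _ c2') => u cu.
by apply: score_continuous; exact: differentiable_Fh.
Qed.

Lemma exact_estP n w : regular_path n w -> good_data n (obs n w) ->
  ball tbar rad (exact_est (obs n w)) /\ score F (obs n w) (exact_est (obs n w)) = 0.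
Proof.
move=> rw gw; have [c1 s1 _ _] := good_score rw gw.
by rewrite /exact_est (scoreJE F rw); exact: (zero_estP rad0 c1 s1).
Qed.

Lemma approx_estP n w : regular_path n w -> good_data n (obs n w) ->
  ball tbar rad (approx_est (obs n w)) /\ score Fh (obs n w) (approx_est (obs n w)) = 0.
Proof.
move=> rw gw; have [_ _ c1 s1] := good_score rw gw.
by rewrite /approx_est (scoreJE Fh rw); exact: (zero_estP rad0 c1 s1).
Qed.

Let score_error n w u : (N0 <= n)%N -> regular_path n w -> ball tbar rad u ->
  `|score Fh (obs n w) u - score F (obs n w) u| <= cN * (cmax * h n `^ a).
Proof.
move=> Nn rw cu; rewrite /score -mulmxBl; apply: (le_trans (cNP _)).
rewrite ler_pM2l//; apply: (le_trans (Fh_error (n_gt0 Nn) rw (ballT cu))).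
by rewrite ler_wpM2r ?powR_ge0// Cmax.
Qed.

Lemma lsubmx_est n w : regular_path n w -> good_data n (obs n w) ->
  lsubmx (approx_est (obs n w)) = lsubmx (exact_est (obs n w)).
Proof.
move=> rw gw; have [cF _ _ _] := good_score rw gw.
have [b1 z1] := exact_estP rw gw; have [b2 z2] := approx_estP rw gw.
set u := exact_est _ in b1 z1 *; set v := approx_est _ in b2 z2 *.
(* Moving only the first block inside the ball does not change the second one,
   and the first block of the score depends on the first block only. *)
pose w1 : param := row_mx (lsubmx v) (rsubmx u).
have bw : ball tbar rad w1.
  split=> // i j; case: (split_ordP j) => k ->; rewrite /w1.
    by rewrite (ord1 i) row_mxEl mxE; exact: b2.2.
  by rewrite (ord1 i) row_mxEr mxE; exact: b1.2.
have ls : lsubmx (score F (obs n w) w1) = 0.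
  have -> : lsubmx (score F (obs n w) w1) = lsubmx (score Fh (obs n w) v).
    by apply: NL; rewrite !linearZ/= Fsum_ffun /Fhsum !row_mxKl.
  by rewrite z2 linear0.
have := cF w1 u bw b1; rewrite z1 subr0 => H.
have wu : w1 - u = row_mx (lsubmx v - lsubmx u) 0.
  by rewrite -[u in LHS]hsubmxK opp_row_mx add_row_mx subrr.
(* The vector [w1 - u] lives in the first block, where the score vanishes at [w1] and at [u]. There
   the contraction defect equals the displacement itself, which is thus at most half its own
   norm. *)
have : `|w1 - u| <= `|w1 - u| / 2.
  apply: le_trans H; rewrite {1}wu; apply: row_norm_le => // j.
  case: (split_ordP j) => k ->; last by rewrite row_mxEr mxE normr0.
  rewrite row_mxEl.
  have E : (score F (obs n w) w1 - (w1 - u)) 0 (lshift p2 k) = - (lsubmx v - lsubmx u) 0 k.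
    transitivity (lsubmx (score F (obs n w) w1 - (w1 - u)) 0 k); first by rewrite [RHS]mxE.
    by rewrite linearB/= ls wu row_mxKl sub0r [LHS]mxE.
  have := row_entry_le (score F (obs n w) w1 - (w1 - u)) (lshift p2 k).
  by rewrite E normrN.
rewrite ler_pdivlMr// => H2'.
have : `|w1 - u| <= 0 by move: H2' (normr_ge0 (w1 - u)); lra.
rewrite normr_le0 wu => /eqP /(congr1 lsubmx).
by rewrite row_mxKl linear0 => /subr0_eq.
Qed.

Let lln_score (x : R) : 0 < x -> wp_to_one Pbar (fun n => [set w |
  `|score F (obs n w) tbar| <= x]).
Proof.
move=> x0; have xc : 0 < x / cN by rewrite divr_gt0.
apply: wp_to_one_sub (lln_ffun xc) _ => n w /= H.
by apply: (le_trans (cNP _)); rewrite mulrC -ler_pdivlMr.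
Qed.

(** The tolerance [e] on the Jacobian is shared equally between the law of large numbers and (E2).
    Likewise the score at the true parameter is at most [rad / 8], and (E1) adds at most [rad / 8],
    within the [rad / 4] that guarantees a zero. *)
Lemma wp_good_data : wp_to_one Pbar (fun n => [set w | good_data n (obs n w)]).
Proof.
have r8 : 0 < rad / 8 by rewrite divr_gt0.
apply: wp_to_one_sub_ae (wp_to_oneI wp_pderiv (lln_score r8)) _.
exists N0 => n Nn; apply: filterS (ae_regular_path (n_gt0 Nn)) => w rw [/= dF sF].
have cF : contracting tbar rad (score F (obs n w)).
  apply: jac => [u cu|u i j cu]; first exact: differentiable_F.
  by apply: (le_trans (dF u i j cu)); move: e0; lra.
have cFh : contracting tbar rad (score Fh (obs n w)).
  apply: jac => [u cu|u i j cu]; first exact: differentiable_Fh.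
  have e20 : 0 <= e / 2 by rewrite divr_ge0// ltW.
  have h1 := pderiv_Fh_error (n_gt0 Nn) rw (radB cu) (c2P i j cu) (N0b Nn) e20.
  have := le_trans (ler_normD _ _) (lerD h1 (dF u i j cu)).
  by rewrite subrKA -splitr.
have sFh : `|score Fh (obs n w) tbar| <= rad / 4.
  have h1 := le_trans (score_error Nn rw bt) (N0a Nn).
  have := le_trans (ler_normD _ _) (lerD h1 sF); rewrite subrK.
  by move=> h2; apply: (le_trans h2); move: rad0; lra.
split => //; first exact: inJ_obs.
  rewrite (scoreJE F rw); split; first exact: contracting_dense.
  by apply: (le_trans sF); move: rad0; lra.
by rewrite (scoreJE Fh rw); split; first exact: contracting_dense.
Qed.

(** The distance from a zero to [tbar] is at most twice the score at [tbar]. For the approximate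
    score this is [x / 4] from the law of large numbers plus [x / 4] from (E1), doubled. *)
Lemma est_close (x : R) : 0 < x -> wp_to_one Pbar (fun n => [set w |
  good_data n (obs n w) ->
  `|exact_est (obs n w) - tbar| <= x /\ `|approx_est (obs n w) - tbar| <= x]).
Proof.
move=> x0; have x4 : 0 < x / 4 by rewrite divr_gt0.
have [N1 N1P] := powR_cvg0 (divr_gt0 x4 (mulr_gt0 cN0 cmax0)) a0.
apply: wp_to_one_sub_ae (lln_score x4) _.
exists (maxn N0 N1) => n; rewrite geq_max => /andP[Nn N1n].
apply: filterS (ae_regular_path (n_gt0 Nn)) => w rw /= sF gw.
have [cF _ cFh _] := good_score rw gw.
have [b1 z1] := exact_estP rw gw; have [b2 z2] := approx_estP rw gw.
have h1 := contraction_dist_le cF b1 bt; rewrite z1 sub0r normrN in h1.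
have h2 := contraction_dist_le cFh b2 bt; rewrite z2 sub0r normrN in h2.
have h3 := score_error Nn rw bt.
have h4 : cN * (cmax * h n `^ a) <= x / 4.
  by rewrite mulrA mulrC -ler_pdivlMr ?mulr_gt0//; exact: N1P.
have h5 := le_trans (ler_normD _ _) (lerD (le_trans h3 h4) sF).
rewrite subrK in h5; split.
  by apply: (le_trans h1); move: sF; lra.
by apply: (le_trans h2); move: h5; lra.
Qed.

(** At the exact estimator the exact score vanishes, so the approximate score there is a pure
    approximation error; twice its norm bounds the distance to the approximate zero. *)
Lemma est_rate n w : (N0 <= n)%N -> regular_path n w -> good_data n (obs n w) ->
  `|approx_est (obs n w) - exact_est (obs n w)| <= 2 * (cN * (cmax * h n `^ a)).
Proof.
move=> Nn rw gw; have [_ _ cFh _] := good_score rw gw.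
have [b1 z1] := exact_estP rw gw; have [b2 z2] := approx_estP rw gw.
apply: (le_trans (contraction_dist_le cFh b2 b1)); rewrite ler_pM2l//.
rewrite z2 sub0r normrN; have := score_error Nn rw b1.
by rewrite z1 subr0.
Qed.

(** Inside the ball uniqueness comes from contraction. The rest of the closure of [K] is compact and
    avoids [tbar]: there [F / n] stays at distance [eta] from 0, while [C] is bounded by continuity,
    so that (E1) moves it by at most [eta / 2]. *)
Lemma approx_est_unique (K : set param) :
  assumption3 l r Delta Pbar Y Qbar Theta tbar f1 f2 ->
  continuous_in_parameter l r Theta f1 f2 ->
  bounded_set K -> closure K `<=` Theta ->
  wp_to_one Pbar (fun n => [set w | [/\ good_data n (obs n w),
    nbhs tbar K -> K (approx_est (obs n w)) &
    forall t, K t -> Fh n (obs n w) t = 0 -> t = approx_est (obs n w)]]).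
Proof.
move=> A3 cf bK KT.
pose K' := closure K `\` ball tbar rad.
have KK' : K' `<=` Theta by move=> t [/KT].
have cK' : compact K'.
  apply: bounded_closed_compact.
    (* A point of the closure is within distance 1 of [K], which is itself bounded by [|m| + 1]. *)
    have [m [_ mP]] := bK; exists (`|m| + 2); split; first exact: num_real.
    move=> m' mm' t [ct _] /=; have [v [Kv /ball_rowP tv]] := ct _ (nbhsx_ballx t 1 ltr01).
    have vm : `|v| <= `|m| + 1.
      by apply: (mP (`|m| + 1)) => //; rewrite (le_lt_trans (ler_norm _))// ltrDl.
    have := ler_normD v (t - v); rewrite subrKC => tvt.
    by apply: (le_trans tvt); move: vm tv mm'; lra.
  apply: closedI; first exact: closed_closure.
  exact/open_closedC/ball_open.
have nK' : ~ K' tbar by case.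
have [eta eta0 Heta] := ffun_away_from_zero_compact A3 cf oT cK' KK' nK'.
have [c c0 cP] : exists2 c : R, 0 < c & forall t, K' t -> C t <= c.
  have [->|/set0P K'0] := eqVneq K' set0; first by exists 1.
  have [t _ tmax] := EVT_max_rV K'0 cK'
    (continuous_in_subspaceT (fun t Kt => cC (KK' _ (set_mem Kt)))).
  exists (`|C t| + 1); first by rewrite ltr_wpDl.
  move=> u K'u; apply: (le_trans (tmax u (mem_set K'u))).
  by rewrite (le_trans (ler_norm _))// lerDl.
have eta2 : 0 < eta / 2 by rewrite divr_gt0.
have [N1 N1P] := powR_cvg0 (divr_gt0 eta2 c0) a0.
have [x x0 xP] : exists2 x : R, 0 < x & nbhs tbar K ->
    forall t, `|t - tbar| <= x -> K t.
  have [/nbhs_ballP[x /= x0 xK]|nK] := pselect (nbhs tbar K); last by exists 1.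
  exists (x / 2); first by rewrite divr_gt0.
  move=> _ t tx; apply: xK; apply/ball_rowP; rewrite distrC.
  by apply: (le_lt_trans tx); move: x0; lra.
apply: wp_to_one_sub_ae (wp_to_oneI (wp_to_oneI wp_good_data (est_close x0)) Heta) _.
exists (maxn N0 N1) => n; rewrite geq_max => /andP[Nn N1n].
apply: filterS (ae_regular_path (n_gt0 Nn)) => w rw [[/= gw ew] etaw].
have [_ _ cFh _] := good_score rw gw; have [b2 z2] := approx_estP rw gw.
split => //; first by move=> nK; apply: (xP nK); exact: (ew gw).2.
move=> t Kt Ft; have ct : ball tbar rad t.
  apply: contrapT => nt; have K't : K' t by split => //; exact: subset_closure.
  have := Fh_error (n_gt0 Nn) rw (KK' _ K't); rewrite Ft scaler0 sub0r normrN.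
  apply/negP; rewrite -ltNge; apply: lt_le_trans (etaw t K't).
  apply: (@le_lt_trans _ _ (eta / 2)); last by move: eta0; lra.
  apply: (@le_trans _ _ (c * h n `^ a)); first by rewrite ler_wpM2r ?powR_ge0// cP.
  by rewrite mulrC -ler_pdivlMr//; exact: N1P.
apply: (contraction_zero_unique cFh ct b2) => //.
by rewrite /score Ft scaler0 mul0mx.
Qed.

Let ae_good n (Q : Omega -> Prop) :
  (forall w, (N0 <= n)%N -> regular_path n w -> good_data n (obs n w) -> Q w) ->
  {ae Pbar, forall w, good_data n (obs n w) -> Q w}.
Proof.
move=> H; have [Nn|nN] := leqP N0 n.
  by apply: filterS (ae_regular_path (n_gt0 Nn)) => w rw gw; exact: H.
by apply: aeW => w [Nn]; rewrite ltnNge Nn in nN.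
Qed.

Let measurable_preobs n (Z : set (n.+1.-tuple R)) : measurable Z ->
  measurable [set w | Z (obs n w)].
Proof.
move=> mZ; rewrite -[X in measurable X]setTI.
exact: (measurable_obs HMbar Delta0 measurableT mZ).
Qed.

Let cvg_prob k (Z : forall n, n.+1.-tuple R -> 'rV[R]_k) (z : 'rV[R]_k) :
  (forall n j, measurable_fun setT (fun y => Z n y 0 j)) ->
  (forall x : R, 0 < x -> wp_to_one Pbar (fun n => [set w |
    good_data n (obs n w) -> `|Z n (obs n w) - z| <= x])) ->
  cvg_prob_on Pbar Y Delta good_data Z z.
Proof.
move=> mZ Zz eps eps0.
(* The Euclidean norm is at most [k] times the maximum norm; [k.+1] avoids a division by 0 for empty
   vectors. *)
have x0 : 0 < eps / k.+1%:R by rewrite divr_gt0.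
apply: (wp_to_one_cvg0 (Zz _ x0)) => [n|].
  apply: (@measurable_preobs n (good_data n `&` [set y | eps < enorm (Z n y - z)])).
  apply: measurableI; first exact: measurable_good_data.
  rewrite (_ : [set y | _] = (fun y => enorm (Z n y - z)) @^-1` [set` `]eps, +oo[]).
    rewrite -[X in measurable X]setTI.
    have ms : measurable_fun setT (fun y => \sum_j (Z n y - z) 0 j ^+ 2).
      apply: measurable_sum => j; apply: measurable_funX.
      rewrite (_ : (fun y => _) = fun y => Z n y 0 j - z 0 j).
        by apply: measurable_funB => //; exact: mZ.
      by apply/funext => y; rewrite !mxE.
    suff : measurable_fun setT (fun y => enorm (Z n y - z)) by apply.
    exact: (measurableT_comp (continuous_measurable_fun (@sqrt_continuous R)) ms).
  by apply/seteqP; split => y /=; rewrite in_itv/= andbT.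
exists 0%N => n _; apply: aeW => w Hw [gw]; apply/negP; rewrite -leNgt.
apply: (le_trans (enorm_le _)); have := Hw gw.
rewrite ler_pdivlMr// mulrC; apply: le_trans.
by rewrite ler_wpM2r// ler_nat.
Qed.

Lemma estimators_of_construction :
  exists (A : forall n, set (n.+1.-tuple R)) (est esth : forall n, n.+1.-tuple R -> param),
  [/\ (fun n => Pbar [set w | A n (obs n w)]) @ \oo --> 1%E,
      estimator_on Pbar Y Delta Theta Fh A esth /\
      cvg_prob_on Pbar Y Delta A (fun n y => rsubmx (esth n y)) (rsubmx tbar),
      [/\ estimator_on Pbar Y Delta Theta F A est,
          cvg_prob_on Pbar Y Delta A est tbar
        & forall n, {ae Pbar, forall w, A n (obs n w) ->
            lsubmx (esth n (obs n w)) = lsubmx (est n (obs n w))}],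
      assumption3 l r Delta Pbar Y Qbar Theta tbar f1 f2 ->
      continuous_in_parameter l r Theta f1 f2 ->
      forall K : set param,
        bounded_set K -> closure K `<=` Theta -> K tbar ->
        wp_to_one Pbar (fun n => [set w |
          [/\ A n (obs n w), nbhs tbar K -> K (esth n (obs n w))
            & forall t, K t -> Fh n (obs n w) t = 0 -> t = esth n (obs n w)]])
    & exists (c : R) (N : nat), forall n, (N <= n)%N ->
        {ae Pbar, forall w, A n (obs n w) ->
          enorm (rsubmx (esth n (obs n w)) - rsubmx (est n (obs n w)))
            <= c * h n `^ a}].
Proof.
exists good_data, (@exact_est), (@approx_est); split.
- apply: (wp_to_one_cvg1 wp_good_data) => n.
  exact: (measurable_preobs (@measurable_good_data n)).
- split.
    move=> n; split; [exact: measurable_good_data|exact: measurable_approx_est|].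
    apply: ae_good => w Nn rw gw; have [b2 z2] := approx_estP rw gw.
    by split; [exact: ballT|exact: (score0 Nn z2)].
  apply: cvg_prob => [n j|x x0].
    by under eq_fun do rewrite mxE; exact: measurable_approx_est.
  apply: wp_to_one_sub (est_close x0) _ => n w /= H gw.
  by rewrite -linearB; apply: le_trans (H gw).2; exact: rsubmx_norm_le.
- split.
  + move=> n; split; [exact: measurable_good_data|exact: measurable_exact_est|].
    apply: ae_good => w Nn rw gw; have [b1 z1] := exact_estP rw gw.
    by split; [exact: ballT|exact: (score0 Nn z1)].
  + apply: cvg_prob => [n j|x x0]; first exact: measurable_exact_est.
    by apply: wp_to_one_sub (est_close x0) _ => n w /= H gw; exact: (H gw).1.
  + by move=> n; apply: ae_good => w _ rw gw; exact: lsubmx_est.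
- by move=> A3 cf K bK KT _; exact: approx_est_unique.
(* The factor [p2] passes from the maximum norm to the Euclidean norm, 2 is the contraction
   estimate, [cN] the norm of [N], and [cmax] bounds [C] on the ball. *)
- exists (p2%:R * (2 * (cN * cmax))), N0 => n Nn; apply: ae_good => w _ rw gw.
  apply: (le_trans (enorm_le _)); rewrite -!mulrA ler_wpM2l//.
  rewrite -linearB; apply: (le_trans (rsubmx_norm_le _)).
  exact: (est_rate Nn rw gw).
Qed.

End construction.

End estimating_functions.

Theorem theorem4p2 (R : realType) (p1 p2 M : nat)
  (l r : \bar R) (S : set R) (d : measure_display) (Omega : measurableType d)
  (P : 'rV[R]_(p1 + p2) -> probability Omega R) (X T : R -> Omega -> R)
  (D : 'rV[R]_p1 -> diffusion R) (phi : 'rV[R]_p2 -> R -> R)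
  (p : 'rV[R]_(p1 + p2) -> R -> R -> R -> R)
  (Delta : R) (Theta B B' : set 'rV[R]_(p1 + p2)) (tbar : 'rV[R]_(p1 + p2))
  (f1 : 'rV[R]_p1 -> R -> R -> 'rV[R]_p1)
  (W : 'rV[R]_(p1 + p2) -> R -> 'M[R]_(M, p2))
  (F2h : forall n, R -> n.+1.-tuple R -> 'rV[R]_(p1 + p2) -> 'rV[R]_p2)
  (h : nat -> R) (a b : R) (C : 'rV[R]_(p1 + p2) -> R)
  (Cij : 'I_(p1 + p2) -> 'I_(p1 + p2) -> 'rV[R]_(p1 + p2) -> R) :
  let Y := subordinated X T in
  let Pbar := P tbar in
  let obs := observations Y Delta in
  let Qbar := fun x y => sdens (D (lsubmx tbar)) x * p tbar Delta x y in
  let f2 := f2fun D phi Delta W in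
  let F := fun n => @Fsum R _ _ (ffun f1 f2) n in
  let Fh := fun n => Fhsum f1 F2h (h n) in
  state_space l r S -> open Theta -> 0 < Delta ->
  (forall t, Theta t ->
    subordinate_model (P t) l r S (D (lsubmx t)) (phi (rsubmx t)) (p t) X T) ->
  moment_functions l r Delta Pbar Y Theta tbar f1 D ->
  (forall t i j, Theta t -> measurable_fun (oitv l r) (fun x => W t x i j)) ->
  assumption2 l r Delta Pbar Y Qbar Theta tbar f1 f2 B ->
  (forall n t j, Theta t ->
    measurable_fun setT (fun y : n.+1.-tuple R => F2h n (h n) y t 0 j)) ->
  (forall n, 0 < h n) -> h @ \oo --> 0 ->
  open B' -> B' tbar -> B' `<=` Theta ->
  (forall n, (0 < n)%N -> {ae Pbar, forall w, C1_on B' (Fh n (obs n w))}) ->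
  0 < a -> 0 < b ->
  (forall t, Theta t -> {for t, continuous C}) ->
  (forall i j t, Theta t -> {for t, continuous (Cij i j)}) ->
  error_bound1 Pbar Y Delta f2 F2h h Theta a C ->
  error_bound2 Pbar Y Delta f1 f2 F2h h (B `&` B') b Cij ->
  exists (A : forall n, set (n.+1.-tuple R))
         (est esth : forall n, n.+1.-tuple R -> 'rV[R]_(p1 + p2)),
  [/\ (fun n => Pbar [set w | A n (obs n w)]) @ \oo --> 1%E,
      estimator_on Pbar Y Delta Theta Fh A esth /\
      cvg_prob_on Pbar Y Delta A (fun n y => rsubmx (esth n y)) (rsubmx tbar),
      [/\ estimator_on Pbar Y Delta Theta F A est,
          cvg_prob_on Pbar Y Delta A est tbar
        & forall n, {ae Pbar, forall w, A n (obs n w) ->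
            lsubmx (esth n (obs n w)) = lsubmx (est n (obs n w))}],
      assumption3 l r Delta Pbar Y Qbar Theta tbar f1 f2 ->
      continuous_in_parameter l r Theta f1 f2 ->
      forall K : set 'rV[R]_(p1 + p2),
        bounded_set K -> closure K `<=` Theta -> K tbar ->
        wp_to_one Pbar (fun n => [set w |
          [/\ A n (obs n w), nbhs tbar K -> K (esth n (obs n w))
            & forall t, K t -> Fh n (obs n w) t = 0 ->
                t = esth n (obs n w)]])
    & exists (c : R) (N : nat), forall n, (N <= n)%N ->
        {ae Pbar, forall w, A n (obs n w) ->
          enorm (rsubmx (esth n (obs n w)) - rsubmx (est n (obs n w)))
            <= c * h n `^ a}].
Proof.
move=> Y Pbar obs Qbar f2 F Fh _ oT Delta0 HM Hmom HW H2 mF2h h0 hcvg oB' B't _ C1Fh.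
move=> a0 b0 cC cCij E1 E2.
have [[Tt _ _ _] _ _ _ _] := H2.
have [N [AN NL]] := Amx_inverse Delta0 HM H2.
have [cN cN0 cNP] := mulmx_norm_le N.
(* The tolerance depends only on the limiting Jacobian and is fixed first; the radius of the ball
   and the sample sizes are then chosen for it. *)
have [e e0 jac] := jacobian_contracting AN.
have e20 : 0 < e / 2 by rewrite divr_gt0.
have [r1 r10 [r1B wp1]] := uniform_lln_pderiv Delta0 HM Hmom HW H2 e20.
(* Upper bounds for [C] and the [Cij] near the true parameter, by continuity. The sum over all
   entries serves as a common bound for the finitely many [Cij]. *)
pose cmax := `|C tbar| + 1; pose c2 := \sum_i \sum_j `|Cij i j tbar| + 1.
have cmax0 : 0 < cmax by rewrite ltr_wpDl.
have sum0 : 0 <= \sum_i \sum_j `|Cij i j tbar| by do 2 (apply: sumr_ge0 => ? _).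
have c20 : 0 < c2 by rewrite ltr_wpDl.
have near_bound (g : 'rV[R]_(p1 + p2) -> R) : {for tbar, continuous g} ->
    \forall u \near tbar, g u <= `|g tbar| + 1.
  move=> /(@cvgrPdist_le R R^o _ (nbhs tbar) (nbhs_filter tbar))/(_ 1 ltr01).
  apply: filterS => u; have := ler_norm (g tbar).
  by rewrite ler_norml => gt /andP[gu _]; move: gt gu; lra.
have near_all : \forall u \near tbar, [/\ B' u, C u <= cmax &
    forall ij : 'I_(p1 + p2) * 'I_(p1 + p2), Cij ij.1 ij.2 u <= c2].
  have h1 : \forall u \near tbar, B' u by exact: open_nbhs_nbhs.
  have h2 := near_bound _ (cC _ Tt).
  have h3 : \forall u \near tbar,
      forall ij : 'I_(p1 + p2) * 'I_(p1 + p2), Cij ij.1 ij.2 u <= c2.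
    suff h3 (ij : 'I_(p1 + p2) * 'I_(p1 + p2)) : \forall u \near tbar, Cij ij.1 ij.2 u <= c2.
      exact: (@filter_forall _ _ _ (nbhs tbar) (nbhs_filter tbar) h3).
    case: ij => i j; apply: filterS (near_bound _ (cCij i j _ Tt)) => u /=.
    move=> /le_trans; apply; rewrite lerD2r (bigD1 i)//= (bigD1 j)//= -addrA lerDl.
    by rewrite addr_ge0//; do ?[apply: sumr_ge0 => ? _].
  by apply: filterS3 h1 h2 h3 => u.
have /nbhs_ballP[r2 /= r20 r2P] := near_all.
pose rad := Num.min r1 r2.
have rad0 : 0 < rad by rewrite lt_min r10.
have sub1 : ball tbar rad `<=` ball tbar r1 by apply: le_ball; rewrite ge_min lexx.
have sub2 : ball tbar rad `<=` ball tbar r2 by apply: le_ball; rewrite ge_min lexx orbT.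
have [N1 N1P] := powR_cvg0 h0 hcvg (divr_gt0 e20 c20) b0.
have r80 : 0 < rad / 8 by rewrite divr_gt0.
have [N2 N2P] := powR_cvg0 h0 hcvg (divr_gt0 r80 (mulr_gt0 cN0 cmax0)) a0.
(* The threshold combines 1, to have at least one observed pair, [N1], from which (E2) costs at most
   [e / 2], and [N2], from which (E1) costs at most [rad / 8]. *)
apply: (estimators_of_construction Delta0 HM Hmom HW H2 oT mF2h h0 hcvg C1Fh a0 cC
  E1 E2 (c2 := c2) (N0 := maxn 1 (maxn N1 N2)) AN NL cN0 cNP rad0 _ cmax0 _ _ e0 _ _ _ _ _).
- by move=> u cu; split; [apply: r1B; exact: sub1|have [] := r2P _ (sub2 _ cu)].
- by move=> u cu; have [] := r2P _ (sub2 _ cu).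
- by move=> u i j cu; have [_ _ /(_ (i, j))] := r2P _ (sub2 _ cu).
- by move=> H k; exact: jac.
- by rewrite leq_max.
- move=> n; rewrite !geq_max => /and3P[_ N1n _].
  by rewrite mulrC -ler_pdivlMr//; exact: N1P.
- move=> n; rewrite !geq_max => /and3P[_ _ N2n].
  by rewrite mulrA mulrC -ler_pdivlMr ?mulr_gt0//; exact: N2P.
- by apply: wp_to_one_sub wp1 _ => n w Hw u i j cu; apply: Hw; exact: sub1.
Qed.
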